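(* Every finite semisimple 2-category (over $k$) is equivalent to the 2-category $\mathrm{Mod}(\mathrm{C})$ of finite semisimple module categories of some multifusion category $\mathrm{C}$ over $k$.
   Context: Throughout, $k$ is an algebraically closed field of characteristic zero and $\mathrm{Vect}$ is the category of finite-dimensional $k$-vector spaces. A linear 1-category is a $\mathrm{Vect}$-enriched category; a linear 2-category is a (weak) 2-category whose 2-morphism sets are finite-dimensional $k$-vector spaces and whose horizontal and vertical compositions of 2-morphisms are $k$-bilinear; linear 2-functors are 2-functors that are locally $k$-linear, and equivalence means equivalence by linear 2-functors. Composition of 1-morphisms is written $\circ$, vertical composition of 2-morphisms is written $\cdot$, the identity 1-morphism of $A$ is $1_A$. Semisimple linear 1-category: additive, idempotent complete, every object is a finite direct sum of simple objects (nonzero objects whose subobjects are all zero or isomorphisms), and composites of nonzero morphisms between simple objects are nonzero (equivalently: additive, idempotent complete, with semisimple endomorphism algebras). It is finite if it has finitely many isomorphism classes of simple objects. A multifusion category is a finite semisimple linear monoidal 1-category (with bilinear tensor product) all of whose objects have left and right duals. $\mathrm{Mod}(\mathrm{C})$ has as objects the right $\mathrm{C}$-module categories whose underlying linear category is finite semisimple, as 1-morphisms linear $\mathrm{C}$-module functors, and as 2-morphisms natural transformations of module functors. A linear 2-category is locally (finite) semisimple if all its Hom 1-categories are (finite) semisimple. Zero object: an object $0$ with $1_0$ a zero object of $\mathrm{Hom}(0,0)$. Direct sum of objects $A_1,A_2$: an object $A_1\boxplus A_2$ with 1-morphisms $\iota_i:A_i\to A_1\boxplus A_2$, $\rho_i:A_1\boxplus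 A_2\to A_i$ such that $\rho_i\circ\iota_i\cong 1_{A_i}$, $\rho_2\circ\iota_1$ and $\rho_1\circ\iota_2$ are zero objects of the Hom-categories, and $1_{A_1\boxplus A_2}$ is a direct sum of $\iota_1\circ\rho_1$ and $\iota_2\circ\rho_2$. A 2-category is additive if it is locally additive, has a zero object and has direct sums of pairs of objects. A monad $E:B\to B$ with multiplication $m:E\circ E\Rightarrow E$ and unit $u:1_B\Rightarrow E$ is separable if there is an $E$-$E$-bimodule map $c:E\Rightarrow E\circ E$ with $m\cdot c=1_E$. It admits a separable splitting if there are 1-morphisms $\iota:A\to B$, $\rho:B\to A$ with $\rho$ left adjoint to $\iota$, such that the counit $\epsilon:\rho\circ\iota\Rightarrow 1_A$ has a right inverse $\phi:1_A\Rightarrow\rho\circ\iota$ ($\epsilon\cdot\phi=1$), together with an isomorphism of monads $E\cong\iota\circ\rho$. A 2-category is idempotent complete if its Hom 1-categories are idempotent complete and every separable monad in it admits a separable splitting. A semisimple 2-category is a locally semisimple linear 2-category in which every 1-morphism has a left and a right adjoint, and which is additive and idempotent complete. A nonzero object $B$ is simple if every fully faithful 1-morphism $A\to B$ (i.e. one such that $\mathrm{Hom}(X,A)\to\mathrm{Hom}(X,B)$ is fully faithful for all $X$) has $A$ a zero object or is an equivalence. A semisimple 2-category is finite if it is locally finite semisimple and has finitely many equivalence classes of simple objects. *)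

(* Defs.v *)
From HB Require Import structures.
From mathcomp Require Import all_boot all_order all_algebra.
From mathcomp Require Import boolp.

Set Implicit Arguments.
Unset Strict Implicit.
Unset Printing Implicit Defensive.

Import GRing.Theory.
Local Open Scope ring_scope.

(* Hom-spaces are arbitrary k-vector spaces in the records below.  That they
   are finite-dimensional is the predicate [locally_fd], which is part of
   [semisimple] and hence of every finiteness hypothesis further down. *)
Definition fin_dim (k : fieldType) (V : lmodType k) : Prop :=
  exists n : nat, inhabited (Vector.axiom n V).

Record lincat (k : fieldType) : Type := LinCat {
  ob :> Type;
  hom : ob -> ob -> lmodType k;
  idm : forall x : ob, hom x x;
  comp : forall x y z : ob, hom y z -> hom x y -> hom x z;
  comp_linl : forall x y z (f : hom x y),
    linear (fun g : hom y z => comp g f);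
  comp_linr : forall x y z (g : hom y z),
    linear (fun f : hom x y => comp g f);
  compA : forall x y z t (h : hom z t) (g : hom y z) (f : hom x y),
    comp h (comp g f) = comp (comp h g) f;
  comp1m : forall x y (f : hom x y), comp (idm y) f = f;
  compm1 : forall x y (f : hom x y), comp f (idm x) = f
}.

Arguments hom {k} l _ _.
Arguments idm {k l} x.
Arguments comp {k l x y z} _ _.

Declare Scope cat_scope.
Delimit Scope cat_scope with cat.
Open Scope cat_scope.

Notation "g • f" := (comp g f) (at level 40, left associativity) : cat_scope.

Record iso (k : fieldType) (C : lincat k) (x y : C) : Type := Iso {
  fwd :> hom C x y;
  bwd : hom C y x;
  fwdK : bwd • fwd = idm x;
  bwdK : fwd • bwd = idm y
}.

Notation "f ⁻" := (bwd f) (at level 3, left associativity, format "f ⁻") : cat_scope.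

Definition isomorphic (k : fieldType) (C : lincat k) (x y : C) : Prop :=
  inhabited (iso x y).

Section LinearCategories.

Variables (k : fieldType) (C : lincat k).

Definition locally_fd : Prop := forall x y : C, fin_dim (hom C x y).

Definition is_iso (x y : C) (f : hom C x y) : Prop :=
  exists g : hom C y x, g • f = idm x /\ f • g = idm y.

Definition is_mono (x y : C) (f : hom C x y) : Prop :=
  forall (z : C) (g h : hom C z x), f • g = f • h -> g = h.

(* Initial and terminal; existence of the two maps is automatic. *)
Definition is_zero_ob (z : C) : Prop :=
  forall x : C, (forall f g : hom C z x, f = g) /\ (forall f g : hom C x z, f = g).

Definition is_sum2 (x1 x2 s : C) : Prop :=
  exists (i1 : hom C x1 s) (i2 : hom C x2 s)
         (p1 : hom C s x1) (p2 : hom C s x2),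
    [/\ p1 • i1 = idm x1, p2 • i2 = idm x2, p2 • i1 = 0, p1 • i2 = 0
      & i1 • p1 + i2 • p2 = idm s].

Definition is_sum (n : nat) (x : 'I_n -> C) (s : C) : Prop :=
  exists (i : forall a, hom C (x a) s) (p : forall a, hom C s (x a)),
    [/\ forall a, p a • i a = idm (x a),
        forall a b, a != b -> p a • i b = 0
      & \sum_(a < n) i a • p a = idm s].

Definition additive_cat : Prop :=
  (exists z : C, is_zero_ob z) /\
  (forall x1 x2 : C, exists s : C, is_sum2 x1 x2 s).

Definition idem_complete_cat : Prop :=
  forall (x : C) (e : hom C x x), e • e = e ->
  exists (y : C) (r : hom C x y) (i : hom C y x),
    r • i = idm y /\ i • r = e.

Definition simple_ob (x : C) : Prop :=
  ~ is_zero_ob x /\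
  forall (y : C) (i : hom C y x), is_mono i -> i = 0 \/ is_iso i.

Definition semisimple : Prop :=
  [/\ locally_fd, additive_cat, idem_complete_cat,
      forall x : C, exists (n : nat) (s : 'I_n -> C),
        (forall a, simple_ob (s a)) /\ is_sum s x
    & forall (x y z : C) (g : hom C y z) (f : hom C x y),
        simple_ob x -> simple_ob y -> simple_ob z ->
        g <> 0 -> f <> 0 -> g • f <> 0].

Definition finite_semisimple : Prop :=
  semisimple /\
  exists (n : nat) (s : 'I_n -> C),
    forall x : C, simple_ob x -> exists a, isomorphic x (s a).

End LinearCategories.

Record lfunctor (k : fieldType) (C D : lincat k) : Type := LFunctor {
  fob :> C -> D;
  fmap : forall x y : C, hom C x y -> hom D (fob x) (fob y);
  fmap_lin : forall x y : C, linear (fun f : hom C x y => fmap f);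
  fmap_id : forall x : C, fmap (idm x) = idm (fob x);
  fmap_comp : forall x y z (g : hom C y z) (f : hom C x y),
    fmap (g • f) = fmap g • fmap f
}.

Arguments fmap {k C D} l {x y} _.

Record bilfunctor (k : fieldType) (C D E : lincat k) : Type := BilFunctor {
  bob :> C -> D -> E;
  bmap : forall (x x' : C) (y y' : D),
    hom C x x' -> hom D y y' -> hom E (bob x y) (bob x' y');
  bmap_linl : forall x x' y y' (g : hom D y y'),
    linear (fun f : hom C x x' => bmap f g);
  bmap_linr : forall x x' y y' (f : hom C x x'),
    linear (fun g : hom D y y' => bmap f g);
  bmap_id : forall x y, bmap (idm x) (idm y) = idm (bob x y);
  bmap_comp : forall x x' x'' y y' y''
    (f' : hom C x' x'') (f : hom C x x') (g' : hom D y' y'') (g : hom D y y'),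
    bmap (f' • f) (g' • g) = bmap f' g' • bmap f g
}.

Arguments bob {k C D E} b _ _.
Arguments bmap {k C D E} b {x x' y y'} _ _.

Record monoidal (k : fieldType) : Type := Monoidal {
  mcat :> lincat k;
  tens : bilfunctor mcat mcat mcat;
  munit : mcat;
  massoc : forall x y z : mcat, iso (tens (tens x y) z) (tens x (tens y z));
  mlun : forall x : mcat, iso (tens munit x) x;
  mrun : forall x : mcat, iso (tens x munit) x;
  massoc_nat : forall x x' y y' z z'
    (f : hom mcat x x') (g : hom mcat y y') (h : hom mcat z z'),
    massoc x' y' z' • bmap tens (bmap tens f g) h
    = bmap tens f (bmap tens g h) • massoc x y z;
  mlun_nat : forall x x' (f : hom mcat x x'),
    mlun x' • bmap tens (idm munit) f = f • mlun x;
  mrun_nat : forall x x' (f : hom mcat x x'),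
    mrun x' • bmap tens f (idm munit) = f • mrun x;
  mpentagon : forall x y z t : mcat,
    massoc x y (tens z t) • massoc (tens x y) z t
    = bmap tens (idm x) (massoc y z t) • massoc x (tens y z) t
      • bmap tens (massoc x y z) (idm t);
  mtriangle : forall x y : mcat,
    bmap tens (idm x) (mlun y) • massoc x munit y
    = bmap tens (mrun x) (idm y)
}.

Arguments tens {k} m.
Arguments munit {k} m.
Arguments massoc {k m} x y z.
Arguments mlun {k m} x.
Arguments mrun {k m} x.

Notation "x ⊗ y" := (bob (tens _) x y) (at level 39, left associativity) : cat_scope.
Notation "f ⊠ g" := (bmap (tens _) f g) (at level 39, left associativity) : cat_scope.

(* [y] is a left dual of [x], and [x] is a right dual of [y]. *)
Definition dual_pair (k : fieldType) (C : monoidal k) (y x : C) : Prop :=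
  exists (ev : hom C (y ⊗ x) (munit C)) (coev : hom C (munit C) (x ⊗ y)),
    mrun x • (idm x ⊠ ev) • massoc x y x • (coev ⊠ idm x) • (mlun x)⁻ = idm x
 /\ mlun y • (ev ⊠ idm y) • (massoc y x y)⁻ • (idm y ⊠ coev) • (mrun y)⁻
    = idm y.

Definition multifusion (k : fieldType) (C : monoidal k) : Prop :=
  finite_semisimple C /\
  forall x : C, (exists y : C, dual_pair y x) /\ (exists y : C, dual_pair x y).

Record lin2cat (k : fieldType) : Type := Lin2Cat {
  ob2 :> Type;
  hom1 : ob2 -> ob2 -> lincat k;
  id1 : forall A : ob2, hom1 A A;
  comp1 : forall A B C : ob2, bilfunctor (hom1 B C) (hom1 A B) (hom1 A C);
  asc : forall A B C D (h : hom1 C D) (g : hom1 B C) (f : hom1 A B),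
    iso (comp1 A B D (comp1 B C D h g) f) (comp1 A C D h (comp1 A B C g f));
  lun : forall A B (f : hom1 A B), iso (comp1 A B B (id1 B) f) f;
  run : forall A B (f : hom1 A B), iso (comp1 A A B f (id1 A)) f;
  asc_nat : forall A B C D (h h' : hom1 C D) (g g' : hom1 B C)
      (f f' : hom1 A B) (c : hom (hom1 C D) h h') (b : hom (hom1 B C) g g')
      (a : hom (hom1 A B) f f'),
    asc h' g' f' • bmap (comp1 A B D) (bmap (comp1 B C D) c b) a
    = bmap (comp1 A C D) c (bmap (comp1 A B C) b a) • asc h g f;
  lun_nat : forall A B (f f' : hom1 A B) (a : hom (hom1 A B) f f'),
    lun f' • bmap (comp1 A B B) (idm (id1 B)) a = a • lun f;
  run_nat : forall A B (f f' : hom1 A B) (a : hom (hom1 A B) f f'),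
    run f' • bmap (comp1 A A B) a (idm (id1 A)) = a • run f;
  pentagon : forall A B C D E (i : hom1 D E) (h : hom1 C D) (g : hom1 B C)
      (f : hom1 A B),
    asc i h (comp1 A B C g f) • asc (comp1 C D E i h) g f
    = bmap (comp1 A D E) (idm i) (asc h g f)
      • asc i (comp1 B C D h g) f
      • bmap (comp1 A B E) (asc i h g) (idm f);
  triangle : forall A B C (g : hom1 B C) (f : hom1 A B),
    bmap (comp1 A B C) (idm g) (lun f) • asc g (id1 B) f
    = bmap (comp1 A B C) (run g) (idm f)
}.

Arguments hom1 {k} l _ _.
Arguments id1 {k l} A.
Arguments comp1 {k} l A B C.
Arguments asc {k l A B C D} h g f.
Arguments lun {k l A B} f.
Arguments run {k l A B} f.

Notation "g ∘ f" := (bob (comp1 _ _ _ _) g f)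
  (at level 39, left associativity) : cat_scope.
Notation "b ∗ a" := (bmap (comp1 _ _ _ _) b a)
  (at level 39, left associativity) : cat_scope.

Section TwoCategories.

Variables (k : fieldType) (X : lin2cat k).

Definition equivalence1 (A B : X) (f : hom1 X A B) : Prop :=
  exists g : hom1 X B A,
    isomorphic (g ∘ f) (id1 A) /\ isomorphic (f ∘ g) (id1 B).

Definition equivalent_ob (A B : X) : Prop :=
  exists f : hom1 X A B, equivalence1 f.

(* The triangle identities for [l] left adjoint to [r], with the given unit
   and counit. *)
Definition is_adjunction (A B : X) (l : hom1 X B A) (r : hom1 X A B)
    (eta : hom (hom1 X B B) (id1 B) (r ∘ l))
    (eps : hom (hom1 X A A) (l ∘ r) (id1 A)) : Prop :=
  lun l • (eps ∗ idm l) • (asc l r l)⁻ • (idm l ∗ eta) • (run l)⁻ = idm l /\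
  run r • (idm r ∗ eps) • asc r l r • (eta ∗ idm r) • (lun r)⁻ = idm r.

Definition left_adjoint (A B : X) (l : hom1 X B A) (r : hom1 X A B) : Prop :=
  exists (eta : hom (hom1 X B B) (id1 B) (r ∘ l))
         (eps : hom (hom1 X A A) (l ∘ r) (id1 A)), is_adjunction eta eps.

Definition has_adjoints : Prop :=
  forall (A B : X) (f : hom1 X A B),
    (exists g : hom1 X B A, left_adjoint g f) /\
    (exists g : hom1 X B A, left_adjoint f g).

Definition locally_semisimple : Prop := forall A B : X, semisimple (hom1 X A B).

Definition locally_finite_semisimple : Prop :=
  forall A B : X, finite_semisimple (hom1 X A B).

Definition zero_ob2 (Z : X) : Prop := is_zero_ob (id1 Z).

Definition is_sum_ob2 (A1 A2 S : X) : Prop :=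
  exists (i1 : hom1 X A1 S) (i2 : hom1 X A2 S)
         (r1 : hom1 X S A1) (r2 : hom1 X S A2),
    [/\ isomorphic (r1 ∘ i1) (id1 A1), isomorphic (r2 ∘ i2) (id1 A2),
        is_zero_ob (r2 ∘ i1), is_zero_ob (r1 ∘ i2)
      & is_sum2 (i1 ∘ r1) (i2 ∘ r2) (id1 S)].

Definition additive2 : Prop :=
  [/\ forall A B : X, additive_cat (hom1 X A B),
      exists Z : X, zero_ob2 Z
    & forall A1 A2 : X, exists S : X, is_sum_ob2 A1 A2 S].

Definition is_monad (B : X) (E : hom1 X B B)
    (m : hom (hom1 X B B) (E ∘ E) E) (u : hom (hom1 X B B) (id1 B) E) : Prop :=
  [/\ m • (m ∗ idm E) = m • (idm E ∗ m) • asc E E E,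
      m • (u ∗ idm E) = lun E
    & m • (idm E ∗ u) = run E].

(* [c] is a section of [m] which is a map of left and of right [E]-modules,
   [E ∘ E] carrying the left action on the first factor and the right action
   on the second one. *)
Definition separable (B : X) (E : hom1 X B B)
    (m : hom (hom1 X B B) (E ∘ E) E) : Prop :=
  exists c : hom (hom1 X B B) E (E ∘ E),
    [/\ c • m = (m ∗ idm E) • (asc E E E)⁻ • (idm E ∗ c),
        c • m = (idm E ∗ m) • asc E E E • (c ∗ idm E)
      & m • c = idm E].

(* The multiplication (r ∘ l) ∘ (r ∘ l) => r ∘ l of the monad of an
   adjunction with counit [eps]; its unit is the unit of the adjunction. *)
Definition adj_mult (A B : X) (l : hom1 X B A) (r : hom1 X A B)
    (eps : hom (hom1 X A A) (l ∘ r) (id1 A)) :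
    hom (hom1 X B B) ((r ∘ l) ∘ (r ∘ l)) (r ∘ l) :=
  (idm r ∗ (lun l • (eps ∗ idm l) • (asc l r l)⁻)) • asc r l (r ∘ l).

Definition separable_splitting (B : X) (E : hom1 X B B)
    (m : hom (hom1 X B B) (E ∘ E) E) (u : hom (hom1 X B B) (id1 B) E) : Prop :=
  exists (A : X) (i : hom1 X A B) (r : hom1 X B A)
         (eta : hom (hom1 X B B) (id1 B) (i ∘ r))
         (eps : hom (hom1 X A A) (r ∘ i) (id1 A)),
    [/\ is_adjunction eta eps,
        exists phi : hom (hom1 X A A) (id1 A) (r ∘ i), eps • phi = idm (id1 A)
      & exists t : iso E (i ∘ r),
          t • m = adj_mult eps • (t ∗ t) /\ t • u = eta].

Definition idem_complete2 : Prop :=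
  (forall A B : X, idem_complete_cat (hom1 X A B)) /\
  (forall (B : X) (E : hom1 X B B) (m : hom (hom1 X B B) (E ∘ E) E)
     (u : hom (hom1 X B B) (id1 B) E),
     is_monad m u -> separable m -> separable_splitting m u).

Definition semisimple2 : Prop :=
  [/\ locally_semisimple, has_adjoints, additive2 & idem_complete2].

Definition fully_faithful1 (A B : X) (f : hom1 X A B) : Prop :=
  forall (Y : X) (g h : hom1 X Y A),
    bijective (fun a : hom (hom1 X Y A) g h => idm f ∗ a).

Definition simple_ob2 (B : X) : Prop :=
  ~ zero_ob2 B /\
  forall (A : X) (f : hom1 X A B), fully_faithful1 f ->
    zero_ob2 A \/ equivalence1 f.

Definition finite_semisimple2 : Prop :=
  [/\ semisimple2, locally_finite_semisimple
    & exists (n : nat) (s : 'I_n -> X),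
        forall B : X, simple_ob2 B -> exists a, equivalent_ob B (s a)].

End TwoCategories.

Record lin2functor (k : fieldType) (X Y : lin2cat k) : Type := Lin2Functor {
  fob2 :> X -> Y;
  fhom : forall A B : X, lfunctor (hom1 X A B) (hom1 Y (fob2 A) (fob2 B));
  fcmp : forall A B C (g : hom1 X B C) (f : hom1 X A B),
    iso (fhom B C g ∘ fhom A B f) (fhom A C (g ∘ f));
  fidn : forall A : X, iso (id1 (fob2 A)) (fhom A A (id1 A));
  fcmp_nat : forall A B C (g g' : hom1 X B C) (f f' : hom1 X A B)
      (b : hom (hom1 X B C) g g') (a : hom (hom1 X A B) f f'),
    fmap (fhom A C) (b ∗ a) • fcmp g f
    = fcmp g' f' • (fmap (fhom B C) b ∗ fmap (fhom A B) a);
  fcmp_asc : forall A B C D (h : hom1 X C D) (g : hom1 X B C) (f : hom1 X A B),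
    fmap (fhom A D) (asc h g f) • fcmp (h ∘ g) f • (fcmp h g ∗ idm (fhom A B f))
    = fcmp h (g ∘ f) • (idm (fhom C D h) ∗ fcmp g f)
      • asc (fhom C D h) (fhom B C g) (fhom A B f);
  fcmp_lun : forall A B (f : hom1 X A B),
    fmap (fhom A B) (lun f) • fcmp (id1 B) f • (fidn B ∗ idm (fhom A B f))
    = lun (fhom A B f);
  fcmp_run : forall A B (f : hom1 X A B),
    fmap (fhom A B) (run f) • fcmp f (id1 A) • (idm (fhom A B f) ∗ fidn A)
    = run (fhom A B f)
}.

Arguments fhom {k X Y} l {A B}.
Arguments fcmp {k X Y} l {A B C} g f.
Arguments fidn {k X Y} l A.

Record pseudonat (k : fieldType) (X Y : lin2cat k) (F G : lin2functor X Y) :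
    Type := PseudoNat {
  pcomp :> forall A : X, hom1 Y (F A) (G A);
  psq : forall A B (f : hom1 X A B),
    iso (fhom G f ∘ pcomp A) (pcomp B ∘ fhom F f);
  psq_nat : forall A B (f f' : hom1 X A B) (a : hom (hom1 X A B) f f'),
    (idm (pcomp B) ∗ fmap (fhom F) a) • psq f
    = psq f' • (fmap (fhom G) a ∗ idm (pcomp A));
  psq_id : forall A : X,
    psq (id1 A) • (fidn G A ∗ idm (pcomp A))
    = (idm (pcomp A) ∗ fidn F A) • (run (pcomp A))⁻ • lun (pcomp A);
  psq_comp : forall A B C (g : hom1 X B C) (f : hom1 X A B),
    psq (g ∘ f) • (fcmp G g f ∗ idm (pcomp A))
    = (idm (pcomp C) ∗ fcmp F g f)
      • asc (pcomp C) (fhom F g) (fhom F f)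
      • (psq g ∗ idm (fhom F f))
      • (asc (fhom G g) (pcomp B) (fhom F f))⁻
      • (idm (fhom G g) ∗ psq f)
      • asc (fhom G g) (fhom G f) (pcomp A)
}.

Definition pseudonat_equiv (k : fieldType) (X Y : lin2cat k)
    (F G : lin2functor X Y) : Prop :=
  exists t : pseudonat F G, forall A : X, equivalence1 (t A).

Section Composites.

Variable k : fieldType.

Definition iso_refl (C : lincat k) (x : C) : iso x x :=
  @Iso k C x x (idm x) (idm x) (comp1m _) (comp1m _).

Lemma iso_transK (C : lincat k) (x y z : C) (g : iso y z) (f : iso x y) :
  (f⁻ • g⁻) • (g • f) = idm x.
Proof. by rewrite -compA (compA g⁻) fwdK comp1m fwdK. Qed.

Lemma iso_trans_bK (C : lincat k) (x y z : C) (g : iso y z) (f : iso x y) :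
  (g • f) • (f⁻ • g⁻) = idm z.
Proof. by rewrite -compA (compA f) bwdK comp1m bwdK. Qed.

Definition iso_trans (C : lincat k) (x y z : C) (g : iso y z) (f : iso x y) :
  iso x z := Iso (iso_transK g f) (iso_trans_bK g f).

Lemma iso_fmapK (C D : lincat k) (F : lfunctor C D) (x y : C) (f : iso x y) :
  fmap F f⁻ • fmap F f = idm (F x).
Proof. by rewrite -fmap_comp fwdK fmap_id. Qed.

Lemma iso_fmap_bK (C D : lincat k) (F : lfunctor C D) (x y : C) (f : iso x y) :
  fmap F f • fmap F f⁻ = idm (F y).
Proof. by rewrite -fmap_comp bwdK fmap_id. Qed.

Definition iso_fmap (C D : lincat k) (F : lfunctor C D) (x y : C)
  (f : iso x y) : iso (F x) (F y) := Iso (iso_fmapK F f) (iso_fmap_bK F f).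

Lemma comp0m (C : lincat k) (x y z : C) (f : hom C x y) :
  (0 : hom C y z) • f = 0.
Proof.
have := comp_linl f (-1) (0 : hom C y z) 0.
by rewrite scaler0 addr0 scaleN1r addNr.
Qed.

Lemma compm0 (C : lincat k) (x y z : C) (g : hom C y z) :
  g • (0 : hom C x y) = 0.
Proof.
have := comp_linr g (-1) (0 : hom C x y) 0.
by rewrite scaler0 addr0 scaleN1r addNr.
Qed.

Lemma bmap_compl (C D E : lincat k) (T : bilfunctor C D E) (x x' x'' : C)
    (y : D) (f' : hom C x' x'') (f : hom C x x') :
  bmap T (f' • f) (idm y) = bmap T f' (idm y) • bmap T f (idm y).
Proof. by rewrite -bmap_comp comp1m. Qed.

Lemma bmap_compr (C D E : lincat k) (T : bilfunctor C D E) (x : C)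
    (y y' y'' : D) (g' : hom D y' y'') (g : hom D y y') :
  bmap T (idm x) (g' • g) = bmap T (idm x) g' • bmap T (idm x) g.
Proof. by rewrite -bmap_comp comp1m. Qed.

Lemma lfunctor_comp_lin (C D E : lincat k) (G : lfunctor D E)
    (F : lfunctor C D) (x y : C) :
  linear (fun f : hom C x y => fmap G (fmap F f)).
Proof. by move=> a f g; rewrite !fmap_lin. Qed.

Lemma lfunctor_comp_id (C D E : lincat k) (G : lfunctor D E)
    (F : lfunctor C D) (x : C) : fmap G (fmap F (idm x)) = idm (G (F x)).
Proof. by rewrite !fmap_id. Qed.

Lemma lfunctor_comp_comp (C D E : lincat k) (G : lfunctor D E)
    (F : lfunctor C D) (x y z : C) (g : hom C y z) (f : hom C x y) :
  fmap G (fmap F (g • f)) = fmap G (fmap F g) • fmap G (fmap F f).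
Proof. by rewrite !fmap_comp. Qed.

Definition lfunctor_comp (C D E : lincat k) (G : lfunctor D E)
    (F : lfunctor C D) : lfunctor C E :=
  LFunctor (lfunctor_comp_lin G F) (lfunctor_comp_id G F)
    (lfunctor_comp_comp G F).

Definition lfunctor_id (C : lincat k) : lfunctor C C :=
  @LFunctor k C C id (fun _ _ f => f) (fun _ _ _ _ _ => erefl)
    (fun _ => erefl) (fun _ _ _ _ _ => erefl).

Section Lin2FunctorId.

Variable X : lin2cat k.

Lemma l2id_nat (A B C : X) (g g' : hom1 X B C) (f f' : hom1 X A B)
    (b : hom (hom1 X B C) g g') (a : hom (hom1 X A B) f f') :
  (b ∗ a) • iso_refl (g ∘ f) = iso_refl (g' ∘ f') • (b ∗ a).
Proof. by rewrite /= comp1m compm1. Qed.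

Lemma l2id_asc (A B C D : X) (h : hom1 X C D) (g : hom1 X B C)
    (f : hom1 X A B) :
  asc h g f • iso_refl ((h ∘ g) ∘ f) • (iso_refl (h ∘ g) ∗ idm f)
  = iso_refl (h ∘ (g ∘ f)) • (idm h ∗ iso_refl (g ∘ f)) • asc h g f.
Proof. by rewrite /= !bmap_id !compm1 !comp1m. Qed.

Lemma l2id_lun (A B : X) (f : hom1 X A B) :
  lun f • iso_refl (id1 B ∘ f) • (iso_refl (id1 B) ∗ idm f) = lun f.
Proof. by rewrite /= !bmap_id !compm1. Qed.

Lemma l2id_run (A B : X) (f : hom1 X A B) :
  run f • iso_refl (f ∘ id1 A) • (idm f ∗ iso_refl (id1 A)) = run f.
Proof. by rewrite /= !bmap_id !compm1. Qed.

Definition lin2functor_id : lin2functor X X :=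
  @Lin2Functor k X X id (fun A B => lfunctor_id (hom1 X A B))
    (fun A B C g f => iso_refl (g ∘ f)) (fun A => iso_refl (id1 A))
    l2id_nat l2id_asc l2id_lun l2id_run.

End Lin2FunctorId.

Section Lin2FunctorComp.

Variables (X Y Z : lin2cat k) (G : lin2functor Y Z) (F : lin2functor X Y).

Let H (A B : X) := lfunctor_comp (@fhom k Y Z G (F A) (F B)) (@fhom k X Y F A B).

Definition l2comp_cmp (A B C : X) (g : hom1 X B C) (f : hom1 X A B) :
    iso (H B C g ∘ H A B f) (H A C (g ∘ f)) :=
  iso_trans (iso_fmap (fhom G) (fcmp F g f)) (fcmp G (fhom F g) (fhom F f)).

Definition l2comp_idn (A : X) : iso (id1 (G (F A))) (H A A (id1 A)) :=
  iso_trans (iso_fmap (fhom G) (fidn F A)) (fidn G (F A)).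

Lemma l2comp_nat (A B C : X) (g g' : hom1 X B C) (f f' : hom1 X A B)
    (b : hom (hom1 X B C) g g') (a : hom (hom1 X A B) f f') :
  fmap (H A C) (b ∗ a) • l2comp_cmp g f
  = l2comp_cmp g' f' • (fmap (H B C) b ∗ fmap (H A B) a).
Proof.
by rewrite /= compA -fmap_comp fcmp_nat fmap_comp -!compA fcmp_nat.
Qed.

Lemma l2comp_asc (A B C D : X) (h : hom1 X C D) (g : hom1 X B C)
    (f : hom1 X A B) :
  fmap (H A D) (asc h g f) • l2comp_cmp (h ∘ g) f
    • (l2comp_cmp h g ∗ idm (H A B f))
  = l2comp_cmp h (g ∘ f) • (idm (H C D h) ∗ l2comp_cmp g f)
    • asc (H C D h) (H B C g) (H A B f).
Proof.
rewrite /= bmap_compl bmap_compr -!compA.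
rewrite (compA (fcmp G _ _)) -[in LHS](fmap_id (fhom G) (fhom F f)) -fcmp_nat.
rewrite (compA (fcmp G (fhom F h) _)).
rewrite -{1}[in RHS](fmap_id (fhom G) (fhom F h)) -fcmp_nat.
rewrite fmap_id -!compA [X in _ = _ • (_ • X)]compA -fcmp_asc.
by rewrite !compA -!fmap_comp fcmp_asc.
Qed.

Lemma l2comp_lun (A B : X) (f : hom1 X A B) :
  fmap (H A B) (lun f) • l2comp_cmp (id1 B) f
    • (l2comp_idn B ∗ idm (H A B f)) = lun (H A B f).
Proof.
rewrite /= bmap_compl -!compA.
rewrite (compA (fcmp G _ _)) -{1}(fmap_id (fhom G) (fhom F f)) -fcmp_nat.
by rewrite !compA -!fmap_comp fcmp_lun fcmp_lun.
Qed.

Lemma l2comp_run (A B : X) (f : hom1 X A B) :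
  fmap (H A B) (run f) • l2comp_cmp f (id1 A)
    • (idm (H A B f) ∗ l2comp_idn A) = run (H A B f).
Proof.
rewrite /= bmap_compr -!compA.
rewrite (compA (fcmp G _ _)) -{1}(fmap_id (fhom G) (fhom F f)) -fcmp_nat.
by rewrite !compA -!fmap_comp fcmp_run fcmp_run.
Qed.

Definition lin2functor_comp : lin2functor X Z :=
  @Lin2Functor k X Z (fun A => G (F A)) H l2comp_cmp l2comp_idn
    l2comp_nat l2comp_asc l2comp_lun l2comp_run.

End Lin2FunctorComp.

End Composites.

Definition equivalent2 (k : fieldType) (X Y : lin2cat k) : Prop :=
  exists (F : lin2functor X Y) (G : lin2functor Y X),
    pseudonat_equiv (lin2functor_id X) (lin2functor_comp G F) /\
    pseudonat_equiv (lin2functor_comp F G) (lin2functor_id Y).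

Record modcat (k : fieldType) (C : monoidal k) : Type := ModCat {
  mdcat :> lincat k;
  act : bilfunctor mdcat C mdcat;
  aasc : forall (m : mdcat) (c d : C), iso (act (act m c) d) (act m (c ⊗ d));
  aun : forall m : mdcat, iso (act m (munit C)) m;
  aasc_nat : forall (m m' : mdcat) (c c' d d' : C) (f : hom mdcat m m')
      (g : hom C c c') (h : hom C d d'),
    aasc m' c' d' • bmap act (bmap act f g) h
    = bmap act f (g ⊠ h) • aasc m c d;
  aun_nat : forall (m m' : mdcat) (f : hom mdcat m m'),
    aun m' • bmap act f (idm (munit C)) = f • aun m;
  apentagon : forall (m : mdcat) (c d e : C),
    aasc m c (d ⊗ e) • aasc (act m c) d e
    = bmap act (idm m) (massoc c d e) • aasc m (c ⊗ d) e
      • bmap act (aasc m c d) (idm e);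
  atriangle : forall (m : mdcat) (c : C),
    bmap act (idm m) (mlun c) • aasc m (munit C) c = bmap act (aun m) (idm c)
}.

Arguments act {k C} M : rename.
Arguments aasc {k C M} m c d : rename.
Arguments aun {k C M} m : rename.

Notation "m ◁ c" := (bob (act _) m c) (at level 39, left associativity) : cat_scope.
Notation "f ◂ g" := (bmap (act _) f g) (at level 39, left associativity) : cat_scope.

Record modfun (k : fieldType) (C : monoidal k) (M N : modcat C) : Type := ModFun {
  mfun :> lfunctor M N;
  mstr : forall (m : M) (c : C), iso (mfun (m ◁ c)) (mfun m ◁ c);
  mstr_nat : forall (m m' : M) (c c' : C) (f : hom M m m') (g : hom C c c'),
    mstr m' c' • fmap mfun (f ◂ g) = (fmap mfun f ◂ g) • mstr m c;
  mstr_asc : forall (m : M) (c d : C),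
    aasc (mfun m) c d • (mstr m c ◂ idm d) • mstr (m ◁ c) d
    = mstr m (c ⊗ d) • fmap mfun (aasc m c d);
  mstr_un : forall m : M,
    aun (mfun m) • mstr m (munit C) = fmap mfun (aun m)
}.

Arguments mstr {k C M N} F x c : rename.

Record modnat (k : fieldType) (C : monoidal k) (M N : modcat C)
    (F G : modfun M N) : Type := ModNat {
  mnat :> forall m : M, hom N (F m) (G m);
  mnat_nat : forall (m m' : M) (f : hom M m m'),
    mnat m' • fmap F f = fmap G f • mnat m;
  mnat_act : forall (m : M) (c : C),
    mstr G m c • mnat (m ◁ c) = (mnat m ◂ idm c) • mstr F m c
}.

Section ModuleTransformations.

Variables (k : fieldType) (C : monoidal k).

Lemma modnat_eq (M N : modcat C) (F G : modfun M N) (s t : modnat F G) :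
  (forall m, s m = t m) -> s = t.
Proof.
case: s t => s s1 s2 [t t1 t2] /= st.
have e : s = t by apply: functional_extensionality_dep.
by case: t / e t1 t2 st => t1 t2 _; congr ModNat; apply: Prop_irrelevance.
Qed.

Section LinearStructure.

Variables (M N : modcat C) (F G : modfun M N).

HB.instance Definition _ := gen_eqMixin (modnat F G).
HB.instance Definition _ := gen_choiceMixin (modnat F G).

Lemma actDl (m m' : N) (c : C) (a : k) (f g : hom N m m') :
  (a *: f + g) ◂ idm c = a *: (f ◂ idm c) + (g ◂ idm c).
Proof. exact: bmap_linl. Qed.

Section LinComb.

Variables (a : k) (s t : modnat F G).

Lemma mnat_lin_nat (m m' : M) (f : hom M m m') :
  (a *: s m' + t m') • fmap F f = fmap G f • (a *: s m + t m).
Proof. by rewrite comp_linl comp_linr !mnat_nat. Qed.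

Lemma mnat_lin_act (m : M) (c : C) :
  mstr G m c • (a *: s (m ◁ c) + t (m ◁ c))
  = ((a *: s m + t m) ◂ idm c) • mstr F m c.
Proof. by rewrite actDl comp_linl comp_linr !mnat_act. Qed.

Definition mnat_lin : modnat F G :=
  @ModNat k C M N F G (fun m => a *: s m + t m) mnat_lin_nat mnat_lin_act.

End LinComb.

Lemma mnat_zero_nat (m m' : M) (f : hom M m m') :
  (0 : hom N (F m') (G m')) • fmap F f = fmap G f • 0.
Proof. by rewrite comp0m compm0. Qed.

Lemma mnat_zero_act (m : M) (c : C) :
  mstr G m c • (0 : hom N (F (m ◁ c)) (G (m ◁ c)))
  = ((0 : hom N (F m) (G m)) ◂ idm c) • mstr F m c.
Proof.
rewrite compm0; have := actDl c (-1) (0 : hom N (F m) (G m)) 0.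
by rewrite scaler0 addr0 scaleN1r addNr => ->; rewrite comp0m.
Qed.

Definition mnat_zero : modnat F G :=
  @ModNat k C M N F G (fun m => 0) mnat_zero_nat mnat_zero_act.

Definition mnat_add (s t : modnat F G) := mnat_lin 1 s t.
Definition mnat_scale (a : k) (s : modnat F G) := mnat_lin a s mnat_zero.
Definition mnat_opp (s : modnat F G) := mnat_scale (-1) s.

Lemma mnat_addA : associative mnat_add.
Proof. by move=> r s t; apply: modnat_eq => m /=; rewrite !scale1r addrA. Qed.

Lemma mnat_addC : commutative mnat_add.
Proof. by move=> s t; apply: modnat_eq => m /=; rewrite !scale1r addrC. Qed.

Lemma mnat_add0 : left_id mnat_zero mnat_add.
Proof. by move=> s; apply: modnat_eq => m /=; rewrite !scale1r add0r. Qed.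

Lemma mnat_addN : left_inverse mnat_zero mnat_opp mnat_add.
Proof.
by move=> s; apply: modnat_eq => m /=; rewrite scale1r addr0 scaleN1r addNr.
Qed.

HB.instance Definition _ := GRing.isZmodule.Build (modnat F G)
  mnat_addA mnat_addC mnat_add0 mnat_addN.

Lemma mnat_scaleA a b s : mnat_scale a (mnat_scale b s) = mnat_scale (a * b) s.
Proof. by apply: modnat_eq => m /=; rewrite !addr0 scalerA. Qed.

Lemma mnat_scale1 : left_id 1 mnat_scale.
Proof. by move=> s; apply: modnat_eq => m /=; rewrite addr0 scale1r. Qed.

Lemma mnat_scaleDr : right_distributive mnat_scale +%R.
Proof.
by move=> a s t; apply: modnat_eq => m /=; rewrite !addr0 !scale1r scalerDr.
Qed.

Lemma mnat_scaleDl s : {morph mnat_scale^~ s : a b / a + b}.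
Proof.
by move=> a b; apply: modnat_eq => m /=; rewrite !addr0 !scale1r scalerDl.
Qed.

HB.instance Definition _ := GRing.Zmodule_isLmodule.Build k (modnat F G)
  mnat_scaleA mnat_scale1 mnat_scaleDr mnat_scaleDl.

Lemma mnat_linE (a : k) (s t : modnat F G) (m : M) :
  (a *: s + t) m = a *: s m + t m.
Proof. by rewrite /= addr0 scale1r. Qed.

End LinearStructure.

Section ModHom.

Variables (M N : modcat C).

Lemma mnat_id_nat (F : modfun M N) (m m' : M) (f : hom M m m') :
  idm (F m') • fmap F f = fmap F f • idm (F m).
Proof. by rewrite comp1m compm1. Qed.

Lemma mnat_id_act (F : modfun M N) (m : M) (c : C) :
  mstr F m c • idm (F (m ◁ c)) = (idm (F m) ◂ idm c) • mstr F m c.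
Proof. by rewrite bmap_id comp1m compm1. Qed.

Definition mnat_id (F : modfun M N) : modnat F F :=
  @ModNat k C M N F F (fun m => idm (F m)) (@mnat_id_nat F) (@mnat_id_act F).

Section Vertical.

Variables (F G H : modfun M N) (t : modnat G H) (s : modnat F G).

Lemma mnat_comp_nat (m m' : M) (f : hom M m m') :
  (t m' • s m') • fmap F f = fmap H f • (t m • s m).
Proof. by rewrite -compA mnat_nat compA mnat_nat compA. Qed.

Lemma mnat_comp_act (m : M) (c : C) :
  mstr H m c • (t (m ◁ c) • s (m ◁ c))
  = ((t m • s m) ◂ idm c) • mstr F m c.
Proof. by rewrite compA mnat_act -compA mnat_act compA bmap_compl. Qed.

Definition mnat_comp : modnat F H :=
  @ModNat k C M N F H (fun m => t m • s m) mnat_comp_nat mnat_comp_act.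

End Vertical.

Lemma mod_hom_linl (F G H : modfun M N) (s : modnat F G) :
  linear (fun t : modnat G H => mnat_comp t s).
Proof.
move=> a t t'; apply: modnat_eq => m.
by rewrite mnat_linE /= addr0 scale1r comp_linl.
Qed.

Lemma mod_hom_linr (F G H : modfun M N) (t : modnat G H) :
  linear (fun s : modnat F G => mnat_comp t s).
Proof.
move=> a s s'; apply: modnat_eq => m.
by rewrite mnat_linE /= addr0 scale1r comp_linr.
Qed.

Lemma mod_homA (F G H K : modfun M N) (r : modnat H K) (t : modnat G H)
    (s : modnat F G) :
  mnat_comp r (mnat_comp t s) = mnat_comp (mnat_comp r t) s.
Proof. by apply: modnat_eq => m /=; rewrite compA. Qed.

Lemma mod_hom1m (F G : modfun M N) (s : modnat F G) :
  mnat_comp (mnat_id G) s = s.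
Proof. by apply: modnat_eq => m /=; rewrite comp1m. Qed.

Lemma mod_homm1 (F G : modfun M N) (s : modnat F G) :
  mnat_comp s (mnat_id F) = s.
Proof. by apply: modnat_eq => m /=; rewrite compm1. Qed.

Definition mod_hom : lincat k :=
  @LinCat k (modfun M N) (fun F G => modnat F G : lmodType k) mnat_id mnat_comp
    mod_hom_linl mod_hom_linr mod_homA mod_hom1m mod_homm1.

End ModHom.

Section ModId.

Variable M : modcat C.

Lemma mfun_id_nat (m m' : M) (c c' : C) (f : hom M m m') (g : hom C c c') :
  iso_refl (m' ◁ c') • (f ◂ g) = (f ◂ g) • iso_refl (m ◁ c).
Proof. by rewrite /= comp1m compm1. Qed.

Lemma mfun_id_asc (m : M) (c d : C) :
  aasc m c d • (iso_refl (m ◁ c) ◂ idm d) • iso_refl (m ◁ c ◁ d)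
  = iso_refl (m ◁ (c ⊗ d)) • aasc m c d.
Proof. by rewrite /= bmap_id !compm1 comp1m. Qed.

Lemma mfun_id_un (m : M) : aun m • iso_refl (m ◁ munit C) = aun m.
Proof. by rewrite /= compm1. Qed.

Definition mfun_id : modfun M M :=
  @ModFun k C M M (lfunctor_id M) (fun m c => iso_refl (m ◁ c))
    mfun_id_nat mfun_id_asc mfun_id_un.

End ModId.

Section ModComp.

Variables (M N P : modcat C).

Section OnObjects.

Variables (G : modfun N P) (F : modfun M N).

Definition mfun_comp_str (m : M) (c : C) : iso (G (F (m ◁ c))) (G (F m) ◁ c) :=
  iso_trans (mstr G (F m) c) (iso_fmap G (mstr F m c)).

Lemma mfun_comp_nat (m m' : M) (c c' : C) (f : hom M m m') (g : hom C c c') :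
  mfun_comp_str m' c' • fmap G (fmap F (f ◂ g))
  = (fmap G (fmap F f) ◂ g) • mfun_comp_str m c.
Proof.
by rewrite /= -compA -fmap_comp mstr_nat fmap_comp compA mstr_nat -compA.
Qed.

Lemma mfun_comp_asc (m : M) (c d : C) :
  aasc (G (F m)) c d • (mfun_comp_str m c ◂ idm d) • mfun_comp_str (m ◁ c) d
  = mfun_comp_str m (c ⊗ d) • fmap G (fmap F (aasc m c d)).
Proof.
rewrite /= bmap_compl -!compA (compA (_ ◂ _) (mstr G _ _)) -mstr_nat.
rewrite -fmap_comp -mstr_asc !compA mstr_asc -!compA; congr (_ • _).
by rewrite -!fmap_comp !compA.
Qed.

Lemma mfun_comp_un (m : M) :
  aun (G (F m)) • mfun_comp_str m (munit C) = fmap G (fmap F (aun m)).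
Proof. by rewrite /= compA mstr_un -fmap_comp mstr_un. Qed.

Definition mfun_comp : modfun M P :=
  @ModFun k C M P (lfunctor_comp G F) mfun_comp_str
    mfun_comp_nat mfun_comp_asc mfun_comp_un.

End OnObjects.

Section OnMorphisms.

Variables (G G' : modfun N P) (F F' : modfun M N).
Variables (t : modnat G G') (s : modnat F F').

Lemma mnat_hcomp_nat (m m' : M) (f : hom M m m') :
  (t (F' m') • fmap G (s m')) • fmap G (fmap F f)
  = fmap G' (fmap F' f) • (t (F' m) • fmap G (s m)).
Proof.
by rewrite -compA -fmap_comp (mnat_nat s) fmap_comp compA (mnat_nat t) -compA.
Qed.

Lemma mnat_hcomp_act (m : M) (c : C) :
  mfun_comp_str G' F' m c • (t (F' (m ◁ c)) • fmap G (s (m ◁ c)))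
  = ((t (F' m) • fmap G (s m)) ◂ idm c) • mfun_comp_str G F m c.
Proof.
rewrite /= bmap_compl -!compA (compA (fmap G' _)) -(mnat_nat t) -!compA.
rewrite -fmap_comp (mnat_act s) fmap_comp (compA (mstr G' _ _)) (mnat_act t).
by rewrite -!compA (compA (mstr G _ _)) mstr_nat -!compA.
Qed.

Definition mnat_hcomp : modnat (mfun_comp G F) (mfun_comp G' F') :=
  @ModNat k C M P (mfun_comp G F) (mfun_comp G' F')
    (fun m => t (F' m) • fmap G (s m)) mnat_hcomp_nat mnat_hcomp_act.

End OnMorphisms.

Lemma mod_comp_linl (G G' : mod_hom N P) (F F' : mod_hom M N)
    (s : hom (mod_hom M N) F F') :
  linear (fun t : hom (mod_hom N P) G G' => mnat_hcomp t s).
Proof.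
move=> a t t'; apply: modnat_eq => m.
by rewrite mnat_linE /= addr0 scale1r comp_linl.
Qed.

Lemma mod_comp_linr (G G' : mod_hom N P) (F F' : mod_hom M N)
    (t : hom (mod_hom N P) G G') :
  linear (fun s : hom (mod_hom M N) F F' => mnat_hcomp t s).
Proof.
move=> a s s'; apply: modnat_eq => m.
by rewrite mnat_linE /= addr0 scale1r fmap_lin comp_linr.
Qed.

Lemma mod_comp_id (G : mod_hom N P) (F : mod_hom M N) :
  mnat_hcomp (mnat_id G) (mnat_id F) = mnat_id (mfun_comp G F).
Proof. by apply: modnat_eq => m /=; rewrite comp1m fmap_id. Qed.

Lemma mod_comp_comp (G G' G'' : mod_hom N P) (F F' F'' : mod_hom M N)
    (t' : hom (mod_hom N P) G' G'') (t : hom (mod_hom N P) G G')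
    (s' : hom (mod_hom M N) F' F'') (s : hom (mod_hom M N) F F') :
  mnat_hcomp (t' • t) (s' • s)
  = mnat_comp (mnat_hcomp t' s') (mnat_hcomp t s).
Proof.
apply: modnat_eq => m /=; rewrite fmap_comp -!compA; congr (_ • _).
by rewrite !compA; congr (_ • _); exact: (mnat_nat t).
Qed.

Definition mod_comp : bilfunctor (mod_hom N P) (mod_hom M N) (mod_hom M P) :=
  @BilFunctor k (mod_hom N P) (mod_hom M N) (mod_hom M P)
    mfun_comp mnat_hcomp mod_comp_linl mod_comp_linr mod_comp_id mod_comp_comp.

End ModComp.

Section Coherence.

Variables (M N P Q : modcat C).
Variables (H : modfun P Q) (G : modfun N P) (F : modfun M N).

Lemma mod_asc_nat (m m' : M) (f : hom M m m') :
  idm (H (G (F m'))) • fmap H (fmap G (fmap F f))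
  = fmap H (fmap G (fmap F f)) • idm (H (G (F m))).
Proof. by rewrite comp1m compm1. Qed.

Lemma mod_asc_str (m : M) (c : C) :
  mstr (mfun_comp (mfun_comp H G) F) m c = mstr (mfun_comp H (mfun_comp G F)) m c
  :> hom Q (H (G (F (m ◁ c)))) (H (G (F m)) ◁ c).
Proof. by rewrite /= fmap_comp compA. Qed.

Lemma mod_asc_act (m : M) (c : C) :
  mstr (mfun_comp H (mfun_comp G F)) m c • idm (H (G (F (m ◁ c))))
  = (idm (H (G (F m))) ◂ idm c) • mstr (mfun_comp (mfun_comp H G) F) m c.
Proof. by rewrite mod_asc_str bmap_id comp1m compm1. Qed.

Lemma mod_asc_bact (m : M) (c : C) :
  mstr (mfun_comp (mfun_comp H G) F) m c • idm (H (G (F (m ◁ c))))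
  = (idm (H (G (F m))) ◂ idm c) • mstr (mfun_comp H (mfun_comp G F)) m c.
Proof. by rewrite -mod_asc_str bmap_id comp1m compm1. Qed.

Definition mod_asc_fwd :
    hom (mod_hom M Q) (mfun_comp (mfun_comp H G) F) (mfun_comp H (mfun_comp G F)) :=
  @ModNat k C M Q (mfun_comp (mfun_comp H G) F) (mfun_comp H (mfun_comp G F))
    (fun m => idm (H (G (F m)))) mod_asc_nat mod_asc_act.

Definition mod_asc_bwd :
    hom (mod_hom M Q) (mfun_comp H (mfun_comp G F)) (mfun_comp (mfun_comp H G) F) :=
  @ModNat k C M Q (mfun_comp H (mfun_comp G F)) (mfun_comp (mfun_comp H G) F)
    (fun m => idm (H (G (F m)))) mod_asc_nat mod_asc_bact.

Lemma mod_ascK : mod_asc_bwd • mod_asc_fwd = idm _.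
Proof. by apply: modnat_eq => m /=; rewrite comp1m. Qed.

Lemma mod_asc_bK : mod_asc_fwd • mod_asc_bwd = idm _.
Proof. by apply: modnat_eq => m /=; rewrite comp1m. Qed.

Definition mod_asc := Iso mod_ascK mod_asc_bK.

End Coherence.

Section Units.

Variables (M N : modcat C) (F : modfun M N).

Lemma mod_lun_str (m : M) (c : C) :
  mstr (mfun_comp (mfun_id N) F) m c = mstr F m c
  :> hom N (F (m ◁ c)) (F m ◁ c).
Proof. by rewrite /= comp1m. Qed.

Lemma mod_run_str (m : M) (c : C) :
  mstr (mfun_comp F (mfun_id M)) m c = mstr F m c
  :> hom N (F (m ◁ c)) (F m ◁ c).
Proof. by rewrite /= fmap_id compm1. Qed.

Lemma mod_lun_act (m : M) (c : C) :
  mstr F m c • idm (F (m ◁ c))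
  = (idm (F m) ◂ idm c) • mstr (mfun_comp (mfun_id N) F) m c.
Proof. by rewrite mod_lun_str bmap_id comp1m compm1. Qed.

Lemma mod_lun_bact (m : M) (c : C) :
  mstr (mfun_comp (mfun_id N) F) m c • idm (F (m ◁ c))
  = (idm (F m) ◂ idm c) • mstr F m c.
Proof. by rewrite -mod_lun_str bmap_id comp1m compm1. Qed.

Lemma mod_run_act (m : M) (c : C) :
  mstr F m c • idm (F (m ◁ c))
  = (idm (F m) ◂ idm c) • mstr (mfun_comp F (mfun_id M)) m c.
Proof. by rewrite mod_run_str bmap_id comp1m compm1. Qed.

Lemma mod_run_bact (m : M) (c : C) :
  mstr (mfun_comp F (mfun_id M)) m c • idm (F (m ◁ c))
  = (idm (F m) ◂ idm c) • mstr F m c.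
Proof. by rewrite -mod_run_str bmap_id comp1m compm1. Qed.

Definition mod_lun_fwd : hom (mod_hom M N) (mfun_comp (mfun_id N) F) F :=
  @ModNat k C M N (mfun_comp (mfun_id N) F) F
    (fun m => idm (F m)) (@mnat_id_nat _ _ F) mod_lun_act.

Definition mod_lun_bwd : hom (mod_hom M N) F (mfun_comp (mfun_id N) F) :=
  @ModNat k C M N F (mfun_comp (mfun_id N) F)
    (fun m => idm (F m)) (@mnat_id_nat _ _ F) mod_lun_bact.

Definition mod_run_fwd : hom (mod_hom M N) (mfun_comp F (mfun_id M)) F :=
  @ModNat k C M N (mfun_comp F (mfun_id M)) F
    (fun m => idm (F m)) (@mnat_id_nat _ _ F) mod_run_act.

Definition mod_run_bwd : hom (mod_hom M N) F (mfun_comp F (mfun_id M)) :=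
  @ModNat k C M N F (mfun_comp F (mfun_id M))
    (fun m => idm (F m)) (@mnat_id_nat _ _ F) mod_run_bact.

Lemma mod_lunK : mod_lun_bwd • mod_lun_fwd = idm _.
Proof. by apply: modnat_eq => m /=; rewrite comp1m. Qed.

Lemma mod_lun_bK : mod_lun_fwd • mod_lun_bwd = idm _.
Proof. by apply: modnat_eq => m /=; rewrite comp1m. Qed.

Lemma mod_runK : mod_run_bwd • mod_run_fwd = idm _.
Proof. by apply: modnat_eq => m /=; rewrite comp1m. Qed.

Lemma mod_run_bK : mod_run_fwd • mod_run_bwd = idm _.
Proof. by apply: modnat_eq => m /=; rewrite comp1m. Qed.

Definition mod_lun := Iso mod_lunK mod_lun_bK.
Definition mod_run := Iso mod_runK mod_run_bK.

End Units.

Lemma mod_asc_natural (M N P Q : modcat C) (H H' : mod_hom P Q)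
    (G G' : mod_hom N P) (F F' : mod_hom M N) (r : hom (mod_hom P Q) H H')
    (t : hom (mod_hom N P) G G') (s : hom (mod_hom M N) F F') :
  mod_asc H' G' F'
    • bmap (mod_comp M N Q) (bmap (mod_comp N P Q) r t) s
  = bmap (mod_comp M P Q) r (bmap (mod_comp M N P) t s) • mod_asc H G F.
Proof. by apply: modnat_eq => m /=; rewrite comp1m compm1 fmap_comp compA. Qed.

Lemma mod_lun_natural (M N : modcat C) (F F' : mod_hom M N)
    (s : hom (mod_hom M N) F F') :
  mod_lun F' • bmap (mod_comp M N N) (idm (mfun_id N : mod_hom N N)) s
  = s • mod_lun F.
Proof. by apply: modnat_eq => m /=; rewrite !comp1m compm1. Qed.

Lemma mod_run_natural (M N : modcat C) (F F' : mod_hom M N)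
    (s : hom (mod_hom M N) F F') :
  mod_run F' • bmap (mod_comp M M N) s (idm (mfun_id M : mod_hom M M))
  = s • mod_run F.
Proof. by apply: modnat_eq => m /=; rewrite comp1m fmap_id. Qed.

Lemma mod_pentagon (M N P Q R : modcat C) (K : mod_hom Q R) (H : mod_hom P Q)
    (G : mod_hom N P) (F : mod_hom M N) :
  mod_asc K H (mod_comp M N P G F) • mod_asc (mod_comp P Q R K H) G F
  = bmap (mod_comp M Q R) (idm K) (mod_asc H G F)
    • mod_asc K (mod_comp N P Q H G) F
    • bmap (mod_comp M N R) (mod_asc K H G) (idm F).
Proof. by apply: modnat_eq => m /=; rewrite !fmap_id !comp1m. Qed.

Lemma mod_triangle (M N P : modcat C) (G : mod_hom N P) (F : mod_hom M N) :
  bmap (mod_comp M N P) (idm G) (mod_lun F)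
    • mod_asc G (mfun_id N : mod_hom N N) F
  = bmap (mod_comp M N P) (mod_run G) (idm F).
Proof. by apply: modnat_eq => m /=; rewrite !fmap_id !comp1m. Qed.

Record fsmodcat : Type := FSModCat {
  fsmod :> modcat C;
  fsmodP : finite_semisimple fsmod
}.

Definition Mod : lin2cat k :=
  @Lin2Cat k fsmodcat (fun M N => mod_hom M N) (fun M => mfun_id M)
    (fun M N P => mod_comp M N P)
    (fun M N P Q H G F => mod_asc H G F)
    (fun M N F => mod_lun F) (fun M N F => mod_run F)
    (fun M N P Q => @mod_asc_natural M N P Q)
    (fun M N => @mod_lun_natural M N) (fun M N => @mod_run_natural M N)
    (fun M N P Q R => @mod_pentagon M N P Q R)
    (fun M N P => @mod_triangle M N P).

End ModuleTransformations.

(* Main.v *)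
Require Import Defs.
From mathcomp Require Import all_boot all_order all_algebra.
From HB Require Import structures.
From mathcomp Require Import boolp ring.
Import Defs.

(** Let [A] be an object of [X] through which the identity of every object factors
    (the sum of the simple objects), and let [C] be the monoidal category of
    endomorphisms of [A].  The 2-functor [B |-> Hom(A, B)] from [X] to [Mod C] is
    locally an equivalence because [A] dominates every object.  Given a module
    category [M], take an object [m] of [M] which contains all simple objects.  The
    functor [m ◁ -] has a right adjoint, and if the counit has a section as a
    morphism of module functors, the resulting monad comes from a separable monad
    on [A].  The latter splits through some [B] in [X], and [Hom(A, B)] is equivalent
    to [M] because separable splittings are unique.

    The section exists because the characteristic is zero.  Averaging a merely
    natural section over the simple objects [X i] of [C] and their duals yields a
    morphism of module functors, which is a section up to the global dimension [D],
    the sum of the squared norms [m i].  To see that [D] is invertible, compare the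
    two ways of dualizing on [Hom(X c, X i X l)]: the partial trace defines an
    operator whose square is the scalar [m c / (m i * m l)].  Let [r] be a vector of
    square roots of the [m i].  Rescaled by [r i * r l / r c], the operator becomes
    an involution, so its trace [A_i l c] is an integer.  Moreover [A_i r = r_i r] and
    [A_i^T r = r_i r] (on each block), so [r] is an eigenvector, with eigenvalue [D],
    of the positive definite integral matrix [sum_i A_i^T A_i]; hence [D] is
    nonzero in characteristic zero. *)

Set Implicit Arguments.
Unset Strict Implicit.
Unset Printing Implicit Defensive.

Import GRing.Theory.
Local Open Scope ring_scope.

(** * Linear categories *)

(** The string calculus is carried out among module endofunctors of the regular module [Z]: their
    associators and unitors have identity components, so diagrams are compared object by object
    without tracking associators, and [rep] identifies these functors with the 1-endomorphisms of
    [A]. Two obstacles shape the argument. The unit of [C] need not be simple, so a closed loop is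
    an endomorphism of the unit and not a scalar. Each loop is still an eigenvector of all such
    endomorphisms, and [scalar_compare] takes the place of cancelling a loop. Nor is a pivotal
    structure available, so [X i] is identified with its double dual by an arbitrary isomorphism.
    Making one of the two loops idempotent turns the scalar of the other into an invariant, the
    squared norm. A natural section on [M] is first spread over all module functors [v] from [Z] to
    [M], which are determined by their value at the unit. Its failure to respect the action is then
    the difference between the component of [v] at [W n] and that of [v] after [W] at [n], and this
    is what averaging removes. *)

Section Linearity.

Variable k : fieldType.

Section Maps.

Variables (V W : lmodType k) (f : V -> W) (fL : linear f).

Lemma lin0 : f 0 = 0.
Proof. by have := fL (-1) 0 0; rewrite scaler0 addr0 scaleN1r addNr. Qed.

Lemma linD u v : f (u + v) = f u + f v.
Proof. by have := fL 1 u v; rewrite !scale1r. Qed.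

Lemma linZ a u : f (a *: u) = a *: f u.
Proof. by have := fL a u 0; rewrite lin0 !addr0. Qed.

Lemma linB u v : f (u - v) = f u - f v.
Proof. by rewrite linD -scaleN1r linZ scaleN1r. Qed.

Lemma lin_sum I (r : seq I) (P : pred I) (F : I -> V) :
  f (\sum_(i <- r | P i) F i) = \sum_(i <- r | P i) f (F i).
Proof. exact: (big_morph f linD lin0). Qed.

End Maps.

Section Comp.

Variable C : lincat k.

Lemma compDl (x y z : C) (g h : hom C y z) (f : hom C x y) :
  (g + h) • f = g • f + h • f.
Proof. exact: (linD (comp_linl f)). Qed.

Lemma compDr (x y z : C) (g : hom C y z) (f h : hom C x y) :
  g • (f + h) = g • f + g • h.
Proof. exact: (linD (comp_linr g)). Qed.

Lemma compZl (x y z : C) a (g : hom C y z) (f : hom C x y) :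
  (a *: g) • f = a *: (g • f).
Proof. exact: (linZ (comp_linl f)). Qed.

Lemma compZr (x y z : C) a (g : hom C y z) (f : hom C x y) :
  g • (a *: f) = a *: (g • f).
Proof. exact: (linZ (comp_linr g)). Qed.

Lemma compBl (x y z : C) (g h : hom C y z) (f : hom C x y) :
  (g - h) • f = g • f - h • f.
Proof. exact: (linB (comp_linl f)). Qed.

Lemma compBr (x y z : C) (g : hom C y z) (f h : hom C x y) :
  g • (f - h) = g • f - g • h.
Proof. exact: (linB (comp_linr g)). Qed.

Lemma comp_suml (x y z : C) (f : hom C x y) I (r : seq I) (P : pred I)
    (F : I -> hom C y z) :
  (\sum_(i <- r | P i) F i) • f = \sum_(i <- r | P i) (F i • f).
Proof. exact: (lin_sum (comp_linl f)). Qed.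

Lemma comp_sumr (x y z : C) (g : hom C y z) I (r : seq I) (P : pred I)
    (F : I -> hom C x y) :
  g • (\sum_(i <- r | P i) F i) = \sum_(i <- r | P i) (g • F i).
Proof. exact: (lin_sum (comp_linr g)). Qed.

End Comp.

Section Fmap.

Variables (C D : lincat k) (F : lfunctor C D).

Lemma fmap0 (x y : C) : fmap F (0 : hom C x y) = 0.
Proof. exact: (lin0 (@fmap_lin k C D F x y)). Qed.

Lemma fmapB (x y : C) (f g : hom C x y) : fmap F (f - g) = fmap F f - fmap F g.
Proof. exact: (linB (@fmap_lin k C D F x y)). Qed.

Lemma fmapZ (x y : C) a (f : hom C x y) : fmap F (a *: f) = a *: fmap F f.
Proof. exact: (linZ (@fmap_lin k C D F x y)). Qed.

Lemma fmap_sum (x y : C) I (r : seq I) (P : pred I) (f : I -> hom C x y) :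
  fmap F (\sum_(i <- r | P i) f i) = \sum_(i <- r | P i) fmap F (f i).
Proof. exact: (lin_sum (@fmap_lin k C D F x y)). Qed.

End Fmap.

Section Bmap.

Variables (C D E : lincat k) (T : bilfunctor C D E).

Lemma bmap0l (x x' : C) (y y' : D) (g : hom D y y') :
  bmap T (0 : hom C x x') g = 0.
Proof. exact: (lin0 (@bmap_linl k C D E T x x' y y' g)). Qed.

Lemma bmap0r (x x' : C) (y y' : D) (f : hom C x x') :
  bmap T f (0 : hom D y y') = 0.
Proof. exact: (lin0 (@bmap_linr k C D E T x x' y y' f)). Qed.

Lemma bmap_lr (x x' : C) (y y' : D) (f : hom C x x') (g : hom D y y') :
  bmap T f g = bmap T f (idm y') • bmap T (idm x) g.
Proof. by rewrite -bmap_comp compm1 comp1m. Qed.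

Lemma bmap_rl (x x' : C) (y y' : D) (f : hom C x x') (g : hom D y y') :
  bmap T f g = bmap T (idm x') g • bmap T f (idm y).
Proof. by rewrite -bmap_comp compm1 comp1m. Qed.

Lemma bmap_interchange (x x' : C) (y y' : D) (f : hom C x x') (g : hom D y y') :
  bmap T (idm x') g • bmap T f (idm y) = bmap T f (idm y') • bmap T (idm x) g.
Proof. by rewrite -bmap_lr -bmap_rl. Qed.

End Bmap.

End Linearity.

Section Isos.

Variables (k : fieldType) (C : lincat k).

Definition iso_sym (x y : C) (f : iso x y) : iso y x := Iso (bwdK f) (fwdK f).

Lemma fwdKl (x y z : C) (f : iso x y) (g : hom C z x) : f⁻ • (f • g) = g.
Proof. by rewrite compA fwdK comp1m. Qed.

Lemma bwdKl (x y z : C) (f : iso x y) (g : hom C z y) : f • (f⁻ • g) = g.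
Proof. by rewrite compA bwdK comp1m. Qed.

Lemma fwdKr (x y z : C) (f : iso x y) (g : hom C x z) : g • f⁻ • f = g.
Proof. by rewrite -compA fwdK compm1. Qed.

Lemma bwdKr (x y z : C) (f : iso x y) (g : hom C y z) : g • f • f⁻ = g.
Proof. by rewrite -compA bwdK compm1. Qed.

Lemma iso_monic (x y z : C) (f : iso x y) (g h : hom C z x) :
  f • g = f • h -> g = h.
Proof. by move=> e; rewrite -(fwdKl f g) e fwdKl. Qed.

Lemma iso_epic (x y z : C) (f : iso x y) (g h : hom C y z) :
  g • f = h • f -> g = h.
Proof. by move=> e; rewrite -(bwdKr f g) e bwdKr. Qed.

Lemma isomorphic_sym (x y : C) : isomorphic x y -> isomorphic y x.
Proof. by case=> f; split; exact: iso_sym. Qed.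

Lemma isomorphic_trans (x y z : C) :
  isomorphic x y -> isomorphic y z -> isomorphic x z.
Proof. by case=> f [g]; split; exact: (iso_trans g f). Qed.

Definition retract (x y : C) : Prop :=
  exists (i : hom C x y) (r : hom C y x), r • i = idm x.

Lemma retract_trans (x y z : C) : retract x y -> retract y z -> retract x z.
Proof.
case=> [i [r ri]] [j [s sj]]; exists (j • i), (r • s).
by rewrite -compA (compA s) sj comp1m.
Qed.

Lemma isomorphic_retract (x y : C) : isomorphic x y -> retract x y.
Proof. by case=> f; exists f, f⁻; rewrite fwdK. Qed.

Lemma zero_id (x : C) : idm x = 0 -> is_zero_ob x.
Proof.
move=> x0 y; split=> f g.
  by rewrite -(compm1 f) -(compm1 g) x0 !compm0.
by rewrite -(comp1m f) -(comp1m g) x0 !comp0m.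
Qed.

End Isos.

Definition iso_bmap (k : fieldType) (C D E : lincat k) (T : bilfunctor C D E)
    (x x' : C) (y y' : D) (f : iso x x') (g : iso y y') : iso (T x y) (T x' y').
Proof.
exists (bmap T f g) (bmap T f⁻ g⁻); first by rewrite -bmap_comp !fwdK bmap_id.
by rewrite -bmap_comp !bwdK bmap_id.
Defined.

Section FullyFaithful.

Variables (k : fieldType) (C D : lincat k) (F : lfunctor C D).

Definition faithful : Prop :=
  forall (x y : C) (f g : hom C x y), fmap F f = fmap F g -> f = g.

Definition full : Prop :=
  forall (x y : C) (g : hom D (F x) (F y)), exists f, fmap F f = g.

Definition ess_surj : Prop := forall y : D, exists x : C, isomorphic (F x) y.

Hypotheses (Ff : faithful) (Fu : full).

Lemma iso_reflect (x y : C) (g : iso (F x) (F y)) :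
  exists f : iso x y, fmap F f = g /\ fmap F f⁻ = g⁻.
Proof.
have [f fE] := Fu g; have [h hE] := Fu g⁻.
have hf : h • f = idm x by apply: Ff; rewrite fmap_comp fE hE fwdK fmap_id.
have fh : f • h = idm y by apply: Ff; rewrite fmap_comp fE hE bwdK fmap_id.
by exists (Iso hf fh).
Qed.

Lemma isomorphic_reflect (x y : C) :
  isomorphic (F x) (F y) -> isomorphic x y.
Proof. by case=> /iso_reflect[f _]; split. Qed.

(** Full faithfulness lifts the idempotent [i • r] of [F x] to an idempotent of [x]. The object
    splitting it in [C] is sent to one splitting [i • r], and splittings of an idempotent are unique
    up to isomorphism. *)
Lemma retract_reflect (x : C) (y : D) :
  idem_complete_cat C -> retract y (F x) ->
  exists x' : C, isomorphic (F x') y.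
Proof.
move=> Cic [i [r ri]].
have [e eE] := Fu (i • r).
have ee : e • e = e.
  by apply: Ff; rewrite fmap_comp eE -compA (compA r) ri comp1m.
have [x' [s [j [sj js]]]] := Cic _ _ ee.
exists x'; split.
have fb : (fmap F s • i) • (r • fmap F j) = idm (F x').
  rewrite compA -(compA _ i) -eE -js fmap_comp !compA -fmap_comp sj fmap_id.
  by rewrite comp1m -fmap_comp sj fmap_id.
have bf : (r • fmap F j) • (fmap F s • i) = idm y.
  rewrite -compA (compA (fmap F j)) -fmap_comp js eE -!compA ri compm1.
  by rewrite ri.
exact: Iso fb bf.
Qed.

End FullyFaithful.

(** Once the [s i] are simple, [inc] and [prj] are dual bases of the multiplicity spaces of [s i] in
    [x]. They are data rather than an existence statement because the traces below are sums over
    them. *)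
Record decomp (k : fieldType) (C : lincat k) (r : nat) (s : 'I_r -> C) (x : C) :=
  Decomp {
    mult : 'I_r -> nat;
    inc : forall i, 'I_(mult i) -> hom C (s i) x;
    prj : forall i, 'I_(mult i) -> hom C x (s i);
    prj_inc : forall i (a b : 'I_(mult i)),
      prj a • inc b = (a == b)%:R *: idm (s i);
    inc_prj : \sum_(i < r) \sum_(a < mult i) inc a • prj a = idm x
  }.

(** Simple objects are characterized here by morphism spaces alone, a form that equivalences
    transport at once ([transport_simples]). *)
Record simples (k : fieldType) (C : lincat k) (r : nat) (s : 'I_r -> C) :=
  Simples {
    simple_nz : forall i, idm (s i) <> 0;
    simple_end : forall i (f : hom C (s i) (s i)), exists a, f = a *: idm (s i);
    simple_hom : forall i j, i <> j -> forall f : hom C (s i) (s j), f = 0;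
    simple_dec : forall x, decomp s x
  }.

(** * Simple objects, Schur's lemma and multiplicity spaces *)

Section SimpleObjects.

Variables (k : fieldType) (C : lincat k) (Css : semisimple C).

Lemma simple_ob_nz (x : C) : simple_ob x -> idm x <> 0.
Proof. by case=> nz _ x0; apply: nz; exact: zero_id. Qed.

(** The source of [g] is decomposed into simple objects. There a vanishing composite with [f] forces
    each component of [g] to vanish. *)
Lemma simple_mono (x y : C) (f : hom C x y) :
  simple_ob x -> simple_ob y -> f <> 0 -> is_mono f.
Proof.
case: Css => _ _ _ dec nz sx sy f0.
suff inj (z : C) (g : hom C z x) : f • g = 0 -> g = 0.
  move=> z g h fgh; apply/eqP; rewrite -subr_eq0; apply/eqP/inj.
  by rewrite compBr fgh subrr.
move=> fg0; have [n [s [ss [i [p [_ _ ip]]]]]] := dec z.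
rewrite -(compm1 g) -ip comp_sumr big1 // => a _; rewrite compA.
suff -> : g • i a = 0 by rewrite comp0m.
apply: contrapT => ga0; apply: (nz _ _ _ f (g • i a)) => //.
by rewrite compA fg0 comp0m.
Qed.

Lemma simple_iso (x y : C) (f : hom C x y) :
  simple_ob x -> simple_ob y -> f <> 0 -> is_iso f.
Proof.
move=> sx sy f0; have mf := simple_mono sx sy f0.
by case: sy => _ /(_ _ _ mf)[].
Qed.

(** Some component of [f] in a simple summand of [y] is nonzero, hence invertible. *)
Lemma simple_split (x y : C) (f : hom C x y) :
  simple_ob x -> f <> 0 -> exists g, g • f = idm x.
Proof.
case: Css => _ _ _ dec nz sx f0; have [n [s [ss [i [p [_ _ ip]]]]]] := dec y.
have [a pa0] : exists a, p a • f <> 0.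
  apply: contrapT => pf; apply: f0; rewrite -(comp1m f) -ip comp_suml big1 // => a _.
  rewrite -compA; suff -> : p a • f = 0 by rewrite compm0.
  by apply: contrapT => pa; apply: pf; exists a.
have [h [hp _]] := simple_iso sx (ss a) pa0.
by exists (h • p a); rewrite -compA.
Qed.

End SimpleObjects.

(** Composition with [f] is a linear map on the finite-dimensional space of endomorphisms of [x], so
    it has an eigenvalue [a]. An eigenvector is killed by [f - a], and composites of nonzero
    morphisms between simple objects are nonzero. *)
Lemma schur (k : closedFieldType) (C : lincat k) (Css : semisimple C) (x : C) :
  simple_ob x -> forall f : hom C x x, exists a, f = a *: idm x.
Proof.
move=> sx f; have [fd _ _ _ nz] := Css.
have [n [[v vL [w vw wv]]]] := fd x x.
have wL : linear w by move=> a u1 u2; apply: (can_inj vw); rewrite wv vL !wv.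
have n0 : (0 < n)%N.
  rewrite lt0n; apply/eqP=> n0; apply: (simple_ob_nz sx).
  rewrite -(vw (idm x)) -(vw 0); congr (w _); subst n; by rewrite [LHS]thinmx0 [RHS]thinmx0.
case: n n0 v vL w vw wv wL => // n _ v vL w vw wv wL.
pose phi (u : 'rV[k]_n.+1) : 'rV_n.+1 := v (f • w u).
have phiL : linear phi by move=> a u1 u2; rewrite /phi wL comp_linr vL.
pose phi' : {linear 'rV[k]_n.+1 -> 'rV[k]_n.+1} :=
  HB.pack phi (GRing.isLinear.Build k _ _ _ phi phiL).
have [a ra] : exists a, root (char_poly (lin1_mx phi')) a.
  by apply/closed_rootP; rewrite size_char_poly.
have /eigenvalueP[u uE u0] : eigenvalue (lin1_mx phi') a.
  by rewrite eigenvalue_root_char.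
exists a; apply/eqP; rewrite -subr_eq0; apply/eqP; apply: contrapT => fa0.
have wu0 : w u <> 0.
  move=> wu; move/eqP: u0; apply; rewrite -(wv u) wu.
  by rewrite (lin0 vL).
apply: (nz _ _ _ _ _ sx sx sx fa0 wu0).
rewrite compBl compZl comp1m -(linZ wL); apply/eqP; rewrite subr_eq0; apply/eqP.
by rewrite -uE mul_rV_lin1 /= /phi vw.
Qed.

Section MakeDecomp.

Variables (k : fieldType) (C : lincat k) (r : nat) (s : 'I_r -> C) (x : C).
Variables (n : nat) (a : 'I_n -> 'I_r).
Variables (f : forall b, hom C (s (a b)) x) (g : forall b, hom C x (s (a b))).
Hypothesis gf1 : forall b, g b • f b = idm (s (a b)).
Hypothesis gf0 : forall b b', b != b' -> g b • f b' = 0.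
Hypothesis fg1 : \sum_(b < n) f b • g b = idm x.

(** Summands of another class receive the value 0, so that the family is defined for all [i] and
    [b]; on the class of [i] the value is transported along [a b = i]. *)
Let inc_at (i : 'I_r) (b : 'I_n) : hom C (s i) x :=
  if a b =P i is ReflectT e then ecast i (hom C (s i) x) e (f b) else 0.
Let prj_at (i : 'I_r) (b : 'I_n) : hom C x (s i) :=
  if a b =P i is ReflectT e then ecast i (hom C x (s i)) e (g b) else 0.

Let prj_inc_at i b b' :
  a b == i -> prj_at i b • inc_at i b' = (b == b')%:R *: idm (s i).
Proof.
rewrite /prj_at /inc_at; case: eqP => // e _; subst i.
case: eqP => [e'|ne] /=; last first.
  rewrite compm0; case: eqP => [bb|_]; last by rewrite scale0r.
  by case: ne; rewrite bb.
case: (eqVneq b b') => [bb|bb].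
  by subst b'; rewrite (eq_axiomK e') /= scale1r gf1.
rewrite scale0r; have := gf0 bb; move: (g b) => gb.
by move: e' (f b') gb => /=; case: _ / => fb gb.
Qed.

Definition make_decomp : decomp s x.
Proof.
exists (fun i => #|[set b | a b == i]|) (fun i al => inc_at i (enum_val al))
  (fun i al => prj_at i (enum_val al)).
  move=> i al be; rewrite prj_inc_at ?(inj_eq enum_val_inj) //.
  by have := enum_valP al; rewrite inE.
transitivity (\sum_(i < r) \sum_(b in [set b | a b == i]) inc_at i b • prj_at i b).
  by apply: eq_bigr => i _; rewrite -(big_enum_val (fun b => inc_at i b • prj_at i b)).
under eq_bigr do under eq_bigl do rewrite inE.
rewrite (exchange_big_dep xpredT) //= -fg1; apply: eq_bigr => b _.
rewrite (big_pred1 (a b)) => [|i]; last by rewrite eq_sym.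
rewrite /inc_at /prj_at; case: eqP => // e; by rewrite (eq_axiomK e).
Qed.

End MakeDecomp.

Lemma simple_ob_isomorphic (k : fieldType) (C : lincat k) (x y : C) :
  isomorphic x y -> simple_ob x -> simple_ob y.
Proof.
case=> f [nz mo]; split.
  move=> zy; apply: nz; apply: zero_id.
  by rewrite -(fwdK f) ((zy _).2 (fwd f) 0) compm0.
move=> z i mi; have mfi : is_mono (f⁻ • i).
  move=> w g h; rewrite -!compA => /(iso_monic (f := iso_sym f)) e.
  exact: mi.
case: (mo _ _ mfi) => [fi0|[h [h1 h2]]].
  by left; rewrite -(bwdKl f i) fi0 compm0.
right; exists (h • f⁻); split; first by rewrite -compA.
by rewrite compA -(bwdKl f (i • h)) (compA _ i) h2 compm1 bwdK.
Qed.

Lemma finite_semisimple_simples (k : closedFieldType) (C : lincat k) :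
  finite_semisimple C -> exists r (s : 'I_r -> C), inhabited (simples s).
Proof.
move=> [Css [n [s0 s0P]]].
(* The given list may contain repetitions and objects that are not simple. An index is kept if its
   object is simple and not isomorphic to an earlier one. *)
pose good (a : 'I_n) :=
  simple_ob (s0 a) /\ forall b : 'I_n, (b < a)%N -> ~ isomorphic (s0 b) (s0 a).
pose J := [set a | `[< good a >]].
have JP (i : 'I_#|J|) : good (enum_val i).
  by have := enum_valP i; rewrite inE => /asboolP.
pose s (i : 'I_#|J|) := s0 (enum_val i).
have ss i : simple_ob (s i) by have [] := JP i.
have cover x : simple_ob x -> exists i, isomorphic x (s i).
  move=> sx; have [a xa] := s0P x sx.
  pose P m := `[< exists b : 'I_n, b = m :> nat /\ isomorphic x (s0 b) >].
  have exP : exists m, P m by exists a; apply/asboolP; exists a.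
  case: (ex_minnP exP) => m /asboolP[b [<- xb]] bmin.
  have bJ : b \in J.
    rewrite inE; apply/asboolP; split; first exact: simple_ob_isomorphic xb sx.
    move=> c cb bc; have /bmin : P c.
      apply/asboolP; exists c; split=> //.
      exact: isomorphic_trans xb (isomorphic_sym bc).
    by rewrite leqNgt cb.
  by exists (enum_rank_in bJ b); rewrite /s enum_rankK_in.
exists #|J|, s; split; split.
- by move=> i; exact: simple_ob_nz (ss i).
- by move=> i; exact: schur Css _ (ss i).
- move=> i j ij f; apply: contrapT => f0.
  have [g [gf fg]] := simple_iso Css (ss i) (ss j) f0.
  have /eqP : i != j by exact/eqP.
  have : enum_val i != enum_val j by rewrite (inj_eq enum_val_inj); exact/eqP.
  rewrite -val_eqE /= neq_ltn => /orP[] lt _.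
    by case: (JP j) => _ /(_ _ lt); apply; split; exact: Iso gf fg.
  by case: (JP i) => _ /(_ _ lt); apply; split; exact: Iso fg gf.
move=> x; have [_ _ _ dec _] := Css.
have /cid[m /cid[y [sy sumy]]] := dec x.
have /cid[i /cid[p [pi1 pi0 ip]]] := sumy.
have /choice[a ya] b := cover _ (sy b).
have {}ya b : iso (y b) (s (a b)) by have /cid[] : exists f : iso (y b) (s (a b)), True by case: (ya b) => f; exists f.
apply: (@make_decomp _ _ _ s x m a (fun b => i b • (ya b)⁻) (fun b => ya b • p b)).
- by move=> b; rewrite -compA (compA (p b)) pi1 comp1m bwdK.
- by move=> b b' bb; rewrite -compA (compA (p b)) pi0 // comp0m compm0.
by rewrite -[RHS]ip; apply: eq_bigr => b _; rewrite -compA fwdKl.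
Qed.

Lemma scal_idm_inj (k : fieldType) (C : lincat k) (x : C) (a b : k) :
  idm x <> 0 -> a *: idm x = b *: idm x -> a = b.
Proof.
move=> /eqP nz /eqP; rewrite -subr_eq0 -scalerBl scaler_eq0 (negbTE nz) orbF.
by rewrite subr_eq0 => /eqP.
Qed.

Section Simples.

Variables (k : fieldType) (C : lincat k) (r : nat) (s : 'I_r -> C).
Variable S : simples s.

Definition coef i (f : hom C (s i) (s i)) : k := sval (cid (simple_end S f)).

Lemma coefE i (f : hom C (s i) (s i)) : f = coef f *: idm (s i).
Proof. by rewrite /coef; case: cid. Qed.

Lemma coef_scal i a : coef (a *: idm (s i)) = a.
Proof. by apply: scal_idm_inj (simple_nz S (i:=i)) _; rewrite -coefE. Qed.

Lemma coef0 i : coef (0 : hom C (s i) (s i)) = 0.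
Proof. by rewrite -(scale0r (idm (s i))) coef_scal. Qed.

Lemma coefD i (f g : hom C (s i) (s i)) : coef (f + g) = coef f + coef g.
Proof. by rewrite {1}(coefE f) {1}(coefE g) -scalerDl coef_scal. Qed.

Lemma coefZ i a (f : hom C (s i) (s i)) : coef (a *: f) = a * coef f.
Proof. by rewrite {1}(coefE f) scalerA coef_scal. Qed.

Lemma coefM i (f g : hom C (s i) (s i)) : coef (f • g) = coef f * coef g.
Proof. by rewrite {1}(coefE f) compZl comp1m coefZ. Qed.

Lemma coef_eq i (f g : hom C (s i) (s i)) : coef f = coef g -> f = g.
Proof. by move=> e; rewrite (coefE f) (coefE g) e. Qed.

Notation dec x := (simple_dec S x).

Lemma expand_prj x i (q : hom C x (s i)) :
  q = \sum_(a < mult (dec x) i) coef (q • inc a) *: prj a.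
Proof.
rewrite -[LHS]compm1 -(inc_prj (dec x)) comp_sumr (bigD1 i) //= [X in _ + X]big1.
  rewrite addr0 comp_sumr; apply: eq_bigr => a _.
  by rewrite compA {1}(coefE (q • _)) compZl comp1m.
move=> j /eqP ji; rewrite comp_sumr big1 // => a _.
by rewrite compA (simple_hom S ji (q • inc a)) comp0m.
Qed.

Lemma expand_inc x i (q : hom C (s i) x) :
  q = \sum_(a < mult (dec x) i) coef (prj a • q) *: inc a.
Proof.
rewrite -[LHS]comp1m -(inc_prj (dec x)) comp_suml (bigD1 i) //= [X in _ + X]big1.
  rewrite addr0 comp_suml; apply: eq_bigr => a _.
  by rewrite -compA {1}(coefE (_ • q)) compZr compm1.
move=> j /eqP ji; rewrite comp_suml big1 // => a _.
by rewrite -compA (simple_hom S (nesym ji) (prj a • q)) compm0.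
Qed.

Lemma hom_ext_prj x y (f g : hom C x y) :
  (forall i (q : hom C y (s i)), q • f = q • g) -> f = g.
Proof.
move=> e; rewrite -(comp1m f) -(comp1m g) -(inc_prj (dec y)) !comp_suml.
apply: eq_bigr => i _; rewrite !comp_suml; apply: eq_bigr => a _.
by rewrite -!compA e.
Qed.

Lemma hom_ext_inc x y (f g : hom C x y) :
  (forall i (q : hom C (s i) x), f • q = g • q) -> f = g.
Proof.
move=> e; rewrite -(compm1 f) -(compm1 g) -(inc_prj (dec x)) !comp_sumr.
apply: eq_bigr => i _; rewrite !comp_sumr; apply: eq_bigr => a _.
by rewrite !compA e.
Qed.

(** Take a nonzero coefficient [t = q • f • j] on a simple object, which is a scalar. The choice
    [g = j • q] works: if [g • f] were 0, then [t • t = 0] and [t] would vanish. *)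
Lemma nonzero_post x y (f : hom C x y) : f <> 0 ->
  exists g : hom C y x, g • f <> 0.
Proof.
move=> f0.
have [i [q [j ne]]] : exists i (q : hom C y (s i)) (j : hom C (s i) x),
    q • f • j <> 0.
  apply: contrapT => h; apply: f0; apply: hom_ext_inc => i j.
  apply: hom_ext_prj => i' q; rewrite comp0m compm0 compA.
  case: (eqVneq i i') => [ii|/eqP ii]; last exact: (simple_hom S ii).
  by subst i'; apply: contrapT => ne; apply: h; exists i, q, j.
exists (j • q) => jqf; apply: ne.
set t := q • f • j; have tE := coefE t.
have tt : t • t = 0 by rewrite /t -!compA (compA j) (compA (j • q)) jqf comp0m !compm0.
apply: coef_eq; rewrite coef0; apply/eqP; move: (congr1 (@coef i) tt).
by rewrite coefM coef0 => /eqP; rewrite mulf_eq0 orbb.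
Qed.

End Simples.

Arguments coef {k C r s} S {i} f.

Section Bricks.

Variables (k : fieldType) (C : lincat k) (r : nat) (s : 'I_r -> C).
Variable S : simples s.

(** Under semisimplicity bricks are the simple objects, but the condition mentions only
    endomorphisms and therefore passes to duals ([brick_dual]). *)
Definition brick (x : C) : Prop :=
  idm x <> 0 /\ forall f : hom C x x, exists a, f = a *: idm x.

Lemma simple_brick i : brick (s i).
Proof. by split; [exact: simple_nz S _ | exact: simple_end S _]. Qed.

(** The composites [g • f] and [f • g] are scalars [a] and [b], and evaluating [f • g • f] in two
    ways gives [a = b]. *)
Lemma brick_iso x y (f : hom C x y) : brick x -> brick y -> f <> 0 ->
  isomorphic x y.
Proof.
move=> [nx ex] [ny ey] f0; have [g gf0] := nonzero_post S f0.
have [a gfE] := ex (g • f); have [b fgE] := ey (f • g).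
have a0 : a != 0 by apply/eqP=> a0; apply: gf0; rewrite gfE a0 scale0r.
have ab : a = b.
  have : a *: f = b *: f.
    by rewrite -[in LHS](compm1 f) -compZr -gfE compA fgE compZl comp1m.
  move/eqP; rewrite -subr_eq0 -scalerBl scaler_eq0.
  by case/orP => [|/eqP //]; rewrite subr_eq0 => /eqP.
split; exists f (a^-1 *: g).
  by rewrite compZl gfE scalerA mulVf // scale1r.
by rewrite compZr fgE -ab scalerA mulVf // scale1r.
Qed.

Lemma brick_simple x : brick x -> exists i, isomorphic x (s i).
Proof.
move=> bx; have [nx _] := bx.
have [i [q q0]] : exists i (q : hom C x (s i)), q <> 0.
  apply: contrapT => h; apply: nx; apply: (hom_ext_prj S) => i q.
  by rewrite compm1 compm0; apply: contrapT => q0; apply: h; exists i, q.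
by exists i; exact: brick_iso bx (simple_brick i) q0.
Qed.

End Bricks.

Section NaturalExtension.

Variables (k : fieldType) (C D : lincat k) (r : nat) (s : 'I_r -> C).
Variables (S : simples s) (F G : lfunctor C D).
Variable t : forall i, hom D (F (s i)) (G (s i)).

Definition nat_ext (x : C) : hom D (F x) (G x) :=
  \sum_(i < r) \sum_(a < mult (simple_dec S x) i)
    fmap G (inc a) • t i • fmap F (prj a).

(** Both sides expand in the same matrix coefficients of [f]: those between distinct simple objects
    vanish, and the remaining ones are scalars, which commute with any family [t]. *)
Lemma nat_ext_nat (x y : C) (f : hom C x y) :
  nat_ext y • fmap F f = fmap G f • nat_ext x.
Proof.
rewrite /nat_ext comp_suml comp_sumr; apply: eq_bigr => i _.
rewrite comp_suml comp_sumr.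
transitivity (\sum_(b < mult (simple_dec S y) i) \sum_(a < mult (simple_dec S x) i)
   coef S (prj b • f • inc a) *: (fmap G (inc b) • t i • fmap F (prj a))).
  apply: eq_bigr => b _; rewrite -compA -fmap_comp [in LHS](expand_prj S (prj b • f)).
  by rewrite fmap_sum comp_sumr; apply: eq_bigr => a _; rewrite fmapZ compZr.
rewrite exchange_big; apply: eq_bigr => a _ /=.
rewrite !compA -fmap_comp (expand_inc S (f • inc a)) fmap_sum !comp_suml.
by apply: eq_bigr => b _; rewrite fmapZ !compZl compA.
Qed.

End NaturalExtension.

Section Transport.

Variables (k : fieldType) (C D : lincat k) (r : nat) (s : 'I_r -> C).
Variables (S : simples s) (F : lfunctor C D).
Hypotheses (Ff : faithful F) (Fu : full F) (Fe : ess_surj F).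

Lemma transport_simples : inhabited (simples (fun i => F (s i))).
Proof.
split; split.
- move=> i; rewrite -fmap_id -(fmap0 F) => /Ff; exact: simple_nz S _.
- move=> i f; have [g <-] := Fu f; have [a ->] := simple_end S g.
  by exists a; rewrite fmapZ fmap_id.
- move=> i j ij f; have [g <-] := Fu f.
  by rewrite (simple_hom S ij g) fmap0.
move=> y; have /cid[x xy] := Fe y.
have {xy} f : iso (F x) y.
  by have /cid[] : exists f : iso (F x) y, True by case: xy => f; exists f.
exists (mult (simple_dec S x)) (fun i a => f • fmap F (inc a))
  (fun i a => fmap F (prj a) • f⁻).
  move=> i a b; rewrite -compA fwdKl -fmap_comp prj_inc fmapZ.
  by rewrite fmap_id.
rewrite -[RHS](bwdK f) -[in RHS](compm1 (fwd f)) -fmap_id.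
rewrite -(inc_prj (simple_dec S x)) fmap_sum comp_sumr comp_suml.
apply: eq_bigr => i _; rewrite fmap_sum comp_sumr comp_suml.
by apply: eq_bigr => a _; rewrite fmap_comp !compA.
Qed.

End Transport.

(** * Linear 2-categories and generators *)

Section Bicategory.

Variables (k : fieldType) (X : lin2cat k).

Lemma asc_natl (A B C D : X) (h h' : hom1 X C D) (g : hom1 X B C)
    (f : hom1 X A B) (c : hom (hom1 X C D) h h') :
  asc h' g f • ((c ∗ idm g) ∗ idm f) = (c ∗ idm (g ∘ f)) • asc h g f.
Proof. by rewrite asc_nat bmap_id. Qed.

Lemma asc_natm (A B C D : X) (h : hom1 X C D) (g g' : hom1 X B C)
    (f : hom1 X A B) (b : hom (hom1 X B C) g g') :
  asc h g' f • ((idm h ∗ b) ∗ idm f) = (idm h ∗ (b ∗ idm f)) • asc h g f.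
Proof. exact: asc_nat. Qed.

Lemma asc_natr (A B C D : X) (h : hom1 X C D) (g : hom1 X B C)
    (f f' : hom1 X A B) (a : hom (hom1 X A B) f f') :
  asc h g f' • (idm (h ∘ g) ∗ a) = (idm h ∗ (idm g ∗ a)) • asc h g f.
Proof. by rewrite -asc_nat bmap_id. Qed.

Lemma whisker_id1_inj (A B : X) (f g : hom1 X A B)
    (a b : hom (hom1 X A B) f g) :
  idm (id1 B) ∗ a = idm (id1 B) ∗ b -> a = b.
Proof. by move=> e; apply: (iso_epic (f := lun f)); rewrite -!lun_nat e. Qed.

Lemma whisker_inj_id1 (A B : X) (f g : hom1 X A B)
    (a b : hom (hom1 X A B) f g) :
  a ∗ idm (id1 A) = b ∗ idm (id1 A) -> a = b.
Proof. by move=> e; apply: (iso_epic (f := run f)); rewrite -!run_nat e. Qed.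

(* The three unit coherences of Kelly, which follow from the pentagon and the
   triangle. *)
Lemma lun_asc (A B C : X) (g : hom1 X B C) (f : hom1 X A B) :
  lun (g ∘ f) • asc (id1 C) g f = lun g ∗ idm f.
Proof.
apply: whisker_id1_inj; rewrite bmap_compr.
apply: (iso_epic (f := asc (id1 C) (id1 C ∘ g) f)).
apply: (iso_epic (f := iso_bmap _ (asc (id1 C) (id1 C) g) (iso_refl f))) => /=.
rewrite -!compA (compA (idm _ ∗ asc _ _ _)) -pentagon !compA triangle.
by rewrite -bmap_id -asc_nat -triangle bmap_compl compA asc_natm.
Qed.

Lemma run_asc (A B C : X) (g : hom1 X B C) (f : hom1 X A B) :
  (idm g ∗ run f) • asc g f (id1 A) = run (g ∘ f).
Proof.
apply: whisker_inj_id1; rewrite bmap_compl.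
apply: (iso_monic (f := asc g f (id1 A))).
rewrite -[in RHS]triangle compA asc_natm [in RHS]compA asc_natr -triangle.
by rewrite bmap_compr -!compA pentagon !compA.
Qed.

Lemma lun_run (A : X) : lun (id1 A) = run (id1 A) :> hom _ _ _.
Proof.
apply: whisker_inj_id1; rewrite -triangle -lun_asc; congr (_ • _).
by apply: (iso_monic (f := lun (id1 A))); rewrite lun_nat.
Qed.

End Bicategory.

Section Dominated.

Variables (k : fieldType) (X : lin2cat k).

Definition dominated (A B : X) : Prop :=
  exists (f : hom1 X A B) (h : hom1 X B A), retract (id1 B) (f ∘ h).

Lemma retract_comp1 (A B C : X) (g g' : hom1 X B C) (f f' : hom1 X A B) :
  retract g g' -> retract f f' -> retract (g ∘ f) (g' ∘ f').
Proof.
case=> [i [r ri]] [j [s sj]]; exists (i ∗ j), (r ∗ s).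
by rewrite -bmap_comp ri sj bmap_id.
Qed.

Lemma retract_refl (A B : X) (f : hom1 X A B) : retract f f.
Proof. by exists (idm f), (idm f); rewrite comp1m. Qed.

Lemma retract_iso (A B : X) (f g : hom1 X A B) : iso f g -> retract f g.
Proof. by move=> t; apply: isomorphic_retract. Qed.

Lemma retract_dominated (A B : X) (x : hom1 X B B) (A' : X) (i : hom1 X A' B)
    (r : hom1 X B A') :
  dominated A A' -> isomorphic x (i ∘ r) ->
  exists (g : hom1 X A B) (h : hom1 X B A), retract x (g ∘ h).
Proof.
move=> [f [h rfh]] xir; exists (i ∘ f), (h ∘ r).
apply: retract_trans (isomorphic_retract xir) _.
apply: (@retract_trans _ _ _ (i ∘ (id1 A' ∘ r))).
  exact: retract_comp1 (retract_refl i) (retract_iso (iso_sym (lun r))).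
apply: (@retract_trans _ _ _ (i ∘ ((f ∘ h) ∘ r))).
  exact: retract_comp1 (retract_refl i) (retract_comp1 rfh (retract_refl r)).
apply: (@retract_trans _ _ _ (i ∘ (f ∘ (h ∘ r)))).
  exact: retract_comp1 (retract_refl i) (retract_iso (asc f h r)).
exact: retract_iso (iso_sym (asc i f (h ∘ r))).
Qed.

Lemma dominated_trans (A B C : X) :
  dominated A B -> dominated B C -> dominated A C.
Proof.
move=> AB [f [h fh]].
have [g [g' r]] := retract_dominated AB (inhabits (iso_refl (f ∘ h))).
by exists g, g'; exact: retract_trans fh r.
Qed.

Lemma equivalent_dominated (A B : X) : equivalent_ob B A -> dominated A B.
Proof.
case=> f [g [gf _]]; exists g, f.
exact: isomorphic_retract (isomorphic_sym gf).
Qed.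

Section Factoring.

Variables (A B : X).
Hypothesis Xadd : additive2 X.

Definition factoring (x : hom1 X B B) (t : hom (hom1 X B B) x x) : Prop :=
  exists (g : hom1 X A B) (h : hom1 X B A) (i : hom (hom1 X B B) x (g ∘ h))
    (r : hom (hom1 X B B) (g ∘ h) x), r • i = t.

(** Two factorizations are placed in the diagonal blocks of the composite of the direct sums [g] and
    [h]. The mixed terms vanish because inclusions and projections of different summands compose to
    0. *)
Lemma factoring_sum (x : hom1 X B B) n (t : 'I_n -> hom (hom1 X B B) x x) :
  (forall a, factoring (t a)) -> factoring (\sum_(a < n) t a).
Proof.
move=> tP; apply: (big_ind (@factoring x)) => //.
  have [add _ _] := Xadd; have [[z _] _] := add A B; have [[z' _] _] := add B A.
  by exists z, z', 0, 0; rewrite comp0m.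
have [add _ _] := Xadd; have [_ sAB] := add A B; have [_ sBA] := add B A.
move=> _ _ [g1 [h1 [i1 [r1 <-]]]] [g2 [h2 [i2 [r2 <-]]]].
have [g [j1 [j2 [p1 [p2 [pj11 pj22 pj21 pj12 _]]]]]] := sAB g1 g2.
have [h [l1 [l2 [q1 [q2 [ql11 ql22 ql21 ql12 _]]]]]] := sBA h1 h2.
exists g, h, ((j1 ∗ l1) • i1 + (j2 ∗ l2) • i2).
exists (r1 • (p1 ∗ q1) + r2 • (p2 ∗ q2)).
have e (g' g'' : hom1 X A B) (h' h'' : hom1 X B A)
    (r : hom (hom1 X B B) (g' ∘ h') x)
    (p : hom (hom1 X A B) g g') (q : hom (hom1 X B A) h h')
    (j : hom (hom1 X A B) g'' g) (l : hom (hom1 X B A) h'' h)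
    (i : hom (hom1 X B B) x (g'' ∘ h'')) :
    r • (p ∗ q) • ((j ∗ l) • i) = r • ((p • j) ∗ (q • l)) • i.
  by rewrite bmap_comp !compA.
rewrite compDl !compDr !e pj11 ql11 pj22 ql22 pj12 ql12 pj21 ql21.
by rewrite !bmap0l !bmap_id !compm1 !compm0 !comp0m addr0 add0r.
Qed.

End Factoring.

End Dominated.

(** * Simple summands of an identity 1-cell *)

Section IdempotentMonad.

Variables (k : fieldType) (X : lin2cat k) (B : X) (x : hom1 X B B).
Variables (i : hom (hom1 X B B) x (id1 B)) (r : hom (hom1 X B B) (id1 B) x).
Hypothesis ri : r • i = idm x.

Variable m : hom (hom1 X B B) (x ∘ x) x.
Hypothesis mE : m = lun x • (i ∗ idm x).
Let l := lun (id1 B).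

Let i_inj (f : hom1 X B B) (g h : hom (hom1 X B B) f x) : i • g = i • h -> g = h.
Proof. by move=> e; rewrite -(comp1m g) -(comp1m h) -ri -!compA e. Qed.

Let im : i • m = l • (i ∗ i).
Proof. by rewrite mE compA -lun_nat -compA -bmap_comp comp1m compm1. Qed.

Let l1 (t : hom (hom1 X B B) (id1 B) (id1 B)) : l • (idm (id1 B) ∗ t) = t • l.
Proof. exact: lun_nat. Qed.

Let l2 (t : hom (hom1 X B B) (id1 B) (id1 B)) : l • (t ∗ idm (id1 B)) = t • l.
Proof. by rewrite /l lun_run run_nat. Qed.

Let eri : i • r • i = i.
Proof. by rewrite -compA ri compm1. Qed.

(** The inclusion [i] is monic and satisfies [i • m = l • (i ∗ i)], so each law reduces to one for
    the identity 1-cell, where it is coherence. *)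
Lemma idem_monad : is_monad m r.
Proof.
split; apply: i_inj.
- rewrite !compA im -(compA l) -bmap_comp compm1 im.
  rewrite -(compA l (i ∗ i)) -bmap_comp compm1 im.
  have -> : (l • (i ∗ i)) ∗ i = (l ∗ idm (id1 B)) • ((i ∗ i) ∗ i).
    by rewrite -bmap_comp comp1m.
  have -> : i ∗ (l • (i ∗ i)) = (idm (id1 B) ∗ l) • (i ∗ (i ∗ i)).
    by rewrite -bmap_comp comp1m.
  rewrite -!compA -asc_nat; congr (_ • _); rewrite compA triangle.
  by rewrite /l lun_run.
- rewrite compA im -compA -bmap_comp compm1 -lun_nat -/l.
  rewrite bmap_lr compA l2 -!compA (lun_nat i) !compA.
  by rewrite eri.
- rewrite compA im -compA -bmap_comp compm1.
  rewrite bmap_rl compA l1 /l lun_run -compA run_nat !compA.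
  by rewrite eri.
Qed.

(** The multiplication is invertible, and associativity makes the inverse of an invertible
    multiplication a bimodule map. *)
Lemma idem_separable : separable m.
Proof.
have [c [cm mc]] : exists c, c • m = idm (x ∘ x) /\ m • c = idm x.
  exists ((r ∗ r) • l⁻ • i); split.
    by rewrite -compA im -compA fwdKl -bmap_comp ri bmap_id.
  apply: i_inj; rewrite compA im !compA -(compA l) -bmap_comp.
  rewrite bmap_lr compA l2 -(compA _ l) l1 !compA bwdKr eri eri compm1.
  by [].
have [assoc _ _] := idem_monad.
exists c; split=> //.
  rewrite cm -(comp1m (_ • _)) -cm -!compA; rewrite (compA m) assoc.
  rewrite -!compA bwdKl -bmap_comp mc comp1m bmap_id compm1.
  by rewrite cm.
rewrite cm -(comp1m (_ • _)) -cm -!compA (compA m) (compA _ _ (c ∗ _)) -assoc.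
by rewrite -compA -bmap_comp mc comp1m bmap_id compm1 cm.
Qed.

End IdempotentMonad.

Section SplitSimple.

Variables (k : fieldType) (X : lin2cat k) (X_ss : semisimple2 X).

(** In a semisimple category this expresses that the identity 1-cell is simple. The form with a
    splitting is the one applied to the unit of an adjunction in [unit_splits_simple]. *)
Definition unit_splits (A : X) : Prop :=
  idm (id1 A) <> 0 /\
  forall (y : hom1 X A A) (f : hom (hom1 X A A) (id1 A) y), f <> 0 ->
    exists g, g • f = idm (id1 A).

Section Conjugation.

Variables (A B : X) (x : hom1 X B B) (i : hom1 X A B) (r : hom1 X B A).
Hypotheses (sx : simple_ob x) (xir : isomorphic x (i ∘ r)).
Variables (j : hom (hom1 X A A) (id1 A) (r ∘ i))
  (q : hom (hom1 X A A) (r ∘ i) (id1 A)).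
Hypothesis qj : q • j = idm (id1 A).

(** Conjugation of 1-cells by [i] and [r]. Conjugating back yields [(r ∘ i) ∘ (y ∘ (r ∘ i))], of
    which [y] is a retract by [J] and [Q], since the identity of [A] is a retract of [r ∘ i]. *)
Let Psi (y y' : hom1 X A A) (a : hom (hom1 X A A) y y') :
  hom (hom1 X B B) (i ∘ (y ∘ r)) (i ∘ (y' ∘ r)) := idm i ∗ (a ∗ idm r).

Let W (y : hom1 X A A) :
    iso ((r ∘ i) ∘ (y ∘ (r ∘ i))) (r ∘ ((i ∘ (y ∘ r)) ∘ i)) :=
  iso_trans (iso_bmap _ (iso_refl r) (iso_sym (asc i (y ∘ r) i)))
    (iso_trans (iso_bmap _ (iso_refl r)
        (iso_bmap _ (iso_refl i) (iso_sym (asc y r i))))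
      (asc r i (y ∘ (r ∘ i)))).

Let J (y : hom1 X A A) : hom (hom1 X A A) y ((r ∘ i) ∘ (y ∘ (r ∘ i))) :=
  (j ∗ (idm y ∗ j)) • (lun (y ∘ id1 A))⁻ • (run y)⁻.

Let Q (y : hom1 X A A) : hom (hom1 X A A) ((r ∘ i) ∘ (y ∘ (r ∘ i))) y :=
  run y • lun (y ∘ id1 A) • (q ∗ (idm y ∗ q)).

Let QJ y : Q y • J y = idm y.
Proof.
rewrite /Q /J -!compA (compA (q ∗ _)) -!bmap_comp qj comp1m !bmap_id comp1m.
by rewrite bwdKl bwdK.
Qed.

Let J_nat y y' (a : hom (hom1 X A A) y y') :
  (idm (r ∘ i) ∗ (a ∗ idm (r ∘ i))) • J y = J y' • a.
Proof.
have lr : (lun (y' ∘ id1 A))⁻ • ((run y')⁻ • a)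
    = (idm (id1 A) ∗ (a ∗ idm (id1 A))) • ((lun (y ∘ id1 A))⁻ • (run y)⁻).
  apply: (iso_monic (f := lun (y' ∘ id1 A))); rewrite bwdKl.
  rewrite compA lun_nat; apply: (iso_monic (f := run y')).
  by rewrite bwdKl -compA bwdKl !compA run_nat bwdKr.
rewrite /J -!compA lr !compA -!bmap_comp !comp1m !compm1.
by [].
Qed.

Let W_nat y y' (a : hom (hom1 X A A) y y') :
  W y' • (idm (r ∘ i) ∗ (a ∗ idm (r ∘ i))) = (idm r ∗ (Psi a ∗ idm i)) • W y.
Proof.
have e1 : (asc y' r i)⁻ • (a ∗ idm (r ∘ i)) = ((a ∗ idm r) ∗ idm i) • (asc y r i)⁻.
  apply: (iso_epic (f := asc y r i)); rewrite fwdKr -compA -asc_natl.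
  by rewrite fwdKl.
have e2 : (asc i (y' ∘ r) i)⁻ • (idm i ∗ ((a ∗ idm r) ∗ idm i))
    = (Psi a ∗ idm i) • (asc i (y ∘ r) i)⁻.
  apply: (iso_epic (f := asc i (y ∘ r) i)); rewrite fwdKr -compA -asc_natm.
  by rewrite fwdKl.
rewrite /= -!compA asc_natr !compA; congr (_ • _).
rewrite -!compA -!bmap_compr e1; rewrite !bmap_compr !compA.
congr (_ • _); rewrite -!bmap_compr; congr (_ ∗ _).
by rewrite e2.
Qed.

Let conj_data : exists (W : forall y : hom1 X A A,
      iso ((r ∘ i) ∘ (y ∘ (r ∘ i))) (r ∘ ((i ∘ (y ∘ r)) ∘ i)))
    (J : forall y : hom1 X A A, hom (hom1 X A A) y ((r ∘ i) ∘ (y ∘ (r ∘ i))))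
    (Q : forall y : hom1 X A A, hom (hom1 X A A) ((r ∘ i) ∘ (y ∘ (r ∘ i))) y),
  [/\ forall y, Q y • J y = idm y,
      forall y y' (a : hom (hom1 X A A) y y'),
        (idm (r ∘ i) ∗ (a ∗ idm (r ∘ i))) • J y = J y' • a
    & forall y y' (a : hom (hom1 X A A) y y'),
        W y' • (idm (r ∘ i) ∗ (a ∗ idm (r ∘ i)))
        = (idm r ∗ (Psi a ∗ idm i)) • W y].
Proof. by exists W, J, Q. Qed.

(** Conjugation sends the identity of [A] to a copy of the simple [x] and kills no nonzero 2-cell,
    because [J] is natural with left inverse [Q]. A splitting of [Psi f] is conjugated back and
    compressed by [J] and [Q] to a splitting of [f]. *)
Lemma split_unit_splits : unit_splits A.
Proof.
have [lss _ _ _] := X_ss; have [W' [J' [Q' [QJ' J_nat' W_nat']]]] := conj_data.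
have retracts y y' (a : hom (hom1 X A A) y y') s : s • Psi a = idm _ ->
    Q' y • (W' y)⁻ • (idm r ∗ (s ∗ idm i)) • W' y' • J' y' • a = idm y.
  move=> sa; rewrite -(compA _ (J' y')) -J_nat' -!compA (compA (fwd (W' y'))).
  rewrite W_nat' -!compA (compA (idm r ∗ _)) -bmap_compr -bmap_compl sa.
  by rewrite !bmap_id comp1m fwdKl QJ'.
have Psi_inj y y' (a : hom (hom1 X A A) y y') : Psi a = 0 -> a = 0.
  move=> a0; have W0 : idm (r ∘ i) ∗ (a ∗ idm (r ∘ i)) = 0.
    apply: (iso_monic (f := W' y')).
    by rewrite W_nat' a0 bmap0l bmap0r comp0m compm0.
  by rewrite -(comp1m a) -QJ' -compA -J_nat' W0 comp0m compm0.
have sir : simple_ob (i ∘ (id1 A ∘ r)).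
  apply: simple_ob_isomorphic sx; apply: isomorphic_trans xir _.
  by split; apply: iso_bmap; [exact: iso_refl | exact: iso_sym (lun r)].
split.
  move=> e; apply: (simple_ob_nz sir); rewrite -bmap_id -(bmap_id _ (id1 A)).
  by rewrite e bmap0l bmap0r.
move=> y f f0; have Pf0 : Psi f <> 0 by move=> /Psi_inj.
have [s sf] := simple_split (lss B B) sir Pf0.
by exists (Q' (id1 A) • (W' (id1 A))⁻ • (idm r ∗ (s ∗ idm i)) • W' y • J' y); rewrite retracts.
Qed.

End Conjugation.

(** Let [l] be left adjoint to a fully faithful [f]. A zero unit makes [f], hence [A], zero.
    Otherwise the unit is split by some [s], the idempotent [eta • s] comes from an endomorphism [q]
    of [l], and a triangle identity forces [q] to be the identity. So the unit is invertible, and by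
    the other triangle identity and full faithfulness so is the counit. *)
Lemma unit_splits_simple (B : X) : unit_splits B -> simple_ob2 B.
Proof.
have [_ adj _ _] := X_ss.
move=> [nz spl]; split=> [z|A f ff]; first by apply: nz; rewrite ((z _).1 (idm _) 0).
have [[l [eta [eps [T1 T2]]]] _] := adj _ _ f.
have [eta0|eta0] := pselect (eta = 0).
  left; apply: zero_id.
  have f0 : idm f = 0 by rewrite -T2 eta0 bmap0l compm0 comp0m.
  have [g gK _] := ff A (id1 A) (id1 A).
  by apply: (can_inj gK); rewrite f0 !bmap0l.
right; have [s seta] := spl _ _ eta0.
have [q qE] : exists q : hom (hom1 X B A) l l, idm f ∗ q = eta • s.
  by have [g _ gK] := ff B l l; exists (g (eta • s)); exact: gK.
(* As [idm f ∗ q = eta • s] and [s • eta] is the identity, [q] is absorbed by the unit inside the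
   triangle identity for [l]. *)
have q1 : q = idm l.
  rewrite -(compm1 q) -{1}T1 !compA.
  have -> : q • lun l • (eps ∗ idm l) • (asc l f l)⁻ • (idm l ∗ eta) • (run l)⁻
    = lun l • (eps ∗ idm l) • (asc l f l)⁻ • (idm l ∗ ((idm f ∗ q) • eta)) • (run l)⁻.
    congr (_ • _); rewrite -lun_nat -(compA (lun l)) bmap_interchange.
    rewrite bmap_compr !compA; congr (_ • _); rewrite -!compA; congr (_ • (_ • _)).
    apply: (iso_monic (f := asc l f l)).
    by rewrite bwdKl compA asc_natr -compA bwdK compm1.
  by rewrite qE -(compA eta) seta compm1 T1.
have es : eta • s = idm (f ∘ l) by rewrite -qE q1 bmap_id.
pose ie := Iso seta es.
exists l; split; last by split; exact: iso_sym ie.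
have epsE : idm f ∗ eps = (run f)⁻ • lun f • (s ∗ idm f) • (asc f l f)⁻.
  apply: (iso_epic (f := asc f l f)); rewrite fwdKr.
  apply: (iso_monic (f := run f)); rewrite !compA bwdK comp1m.
  apply: (iso_epic (f := iso_bmap (comp1 X A B B) ie (iso_refl f))) => /=.
  rewrite -[in RHS]compA -bmap_compl seta bmap_id compm1.
  by apply: (iso_epic (f := iso_sym (lun f))); rewrite T2 bwdK.
have [h _ hK] := ff A (id1 A) (l ∘ f).
have [h' h'K _] := ff A (id1 A) (id1 A).
have [h'' h''K _] := ff A (l ∘ f) (l ∘ f).
pose e' := asc f l f • (eta ∗ idm f) • (lun f)⁻ • run f.
have e1 : (idm f ∗ eps) • e' = idm _.
  rewrite epsE /e' !compA fwdKr -(compA _ (s ∗ _)) -bmap_compl seta bmap_id compm1.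
  by rewrite bwdKr fwdK.
have e2 : e' • (idm f ∗ eps) = idm _.
  rewrite epsE /e' !compA bwdKr fwdKr -(compA _ (eta ∗ _)) -bmap_compl es bmap_id.
  by rewrite compm1 bwdK.
split; exists eps (h e').
  apply: (can_inj h''K); rewrite bmap_compr.
  by have := hK e'; rewrite /= => ->; rewrite e2 bmap_id.
apply: (can_inj h'K); rewrite bmap_compr.
by have := hK e'; rewrite /= => ->; rewrite e1 bmap_id.
Qed.

(** A summand of the identity is a separable monad, so idempotent completeness splits it through
    some [A]. The section of the counit is what makes [A] simple. *)
Lemma simple_summand_splits (B : X) (x : hom1 X B B) : simple_ob x ->
  retract x (id1 B) ->
  exists (A : X) (i : hom1 X A B) (r : hom1 X B A),
    simple_ob2 A /\ isomorphic x (i ∘ r).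
Proof.
have [_ _ _ [_ spl]] := X_ss.
move=> sx [i [r ri]]; pose m := lun x • (i ∗ idm x).
have [A [i' [r' [eta [eps [_ [phi ephi] [t _]]]]]]] :=
  spl _ _ _ _ (idem_monad ri (erefl m)) (idem_separable ri (erefl m)).
have xir : isomorphic x (i' ∘ r') by split; exact: t.
by exists A, i', r'; split=> //; exact: unit_splits_simple (split_unit_splits sx xir ephi).
Qed.

(** The identity of [B] is a sum of idempotents with simple images. Each of them factors through a
    simple object, hence through [G], and [factoring_sum] adds the factorizations. *)
Lemma dominated_all (G : X) :
  (forall A, simple_ob2 A -> dominated G A) -> forall B, dominated G B.
Proof.
have [lss _ add2 _] := X_ss; move=> GP B.
have [_ _ _ dec _] := lss B B.
have [n [s [ss [i [p [pi _ ip]]]]]] := dec (id1 B).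
have [|g [h [j [q qj]]]] := @factoring_sum _ X G B add2 (id1 B) n (fun a => i a • p a).
  move=> a; have [|A [i' [r' [sA sir]]]] := simple_summand_splits (ss a).
    by exists (i a), (p a).
  have [g [h [j [q qj]]]] := retract_dominated (GP A sA) sir.
  exists g, h, (j • p a), (i a • q).
  by rewrite -compA (compA q) qj comp1m.
by exists g, h, j, q; rewrite qj ip.
Qed.

Lemma sum_dominates n (s : 'I_n -> X) :
  exists G, forall a, dominated G (s a).
Proof.
have [_ _ [_ [Z _] sum] _] := X_ss.
elim: n s => [|n IHn] s; first by exists Z => -[].
have [G GP] := IHn (fun a => s (lift ord0 a)).
have [H [i1 [i2 [r1 [r2 [ri1 ri2 _ _ _]]]]]] := sum (s ord0) G.
exists H => a; case: (unliftP ord0 a) => [b ->|->].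
  apply: dominated_trans (GP b); exists r2, i2.
  exact: isomorphic_retract (isomorphic_sym ri2).
by exists r1, i1; exact: isomorphic_retract (isomorphic_sym ri1).
Qed.

End SplitSimple.

Theorem generator_exists (k : fieldType) (X : lin2cat k) :
  finite_semisimple2 X -> exists G : X, forall B, dominated G B.
Proof.
case=> X_ss _ [n [s sP]]; have [G GP] := sum_dominates X_ss s.
exists G; apply: (dominated_all X_ss) => A /sP[a Aa].
exact: dominated_trans (GP a) (equivalent_dominated Aa).
Qed.

(** * The representable 2-functor *)

Section Representable.

Variables (k : fieldType) (X : lin2cat k) (A : X).

Definition end_monoidal : monoidal k :=
  @Monoidal k (hom1 X A A) (comp1 X A A A) (id1 A) (fun x y z => asc x y z)
    (fun x => lun x) (fun x => run x) (@asc_nat k X A A A A) (@lun_nat k X A A)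
    (@run_nat k X A A) (fun x y z t => pentagon x y z t)
    (fun x y => triangle x y).

Definition rep_ob (B : X) : modcat end_monoidal :=
  @ModCat k end_monoidal (hom1 X A B) (comp1 X A A B) (fun m c d => asc m c d)
    (fun m => run m) (@asc_nat k X A A A B) (@run_nat k X A B)
    (fun m c d e => pentagon m c d e) (fun m c => triangle m c).

Section OneCells.

Variables (B B' : X) (g : hom1 X B B').

Lemma rep1_lin (m m' : rep_ob B) :
  linear (fun f : hom (rep_ob B) m m' => (idm g ∗ f : hom (rep_ob B') (g ∘ m) (g ∘ m'))).
Proof. exact: bmap_linr. Qed.

Definition rep1_fun : lfunctor (rep_ob B) (rep_ob B') :=
  @LFunctor k (rep_ob B) (rep_ob B') (fun m => g ∘ m)
    (fun m m' f => idm g ∗ f) rep1_lin (fun m => bmap_id _ g m)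
    (fun m m' m'' f h => bmap_compr _ g f h).

Lemma rep1_nat (m m' : rep_ob B) (c c' : end_monoidal)
    (f : hom (rep_ob B) m m') (h : hom end_monoidal c c') :
  iso_sym (asc g m' c') • fmap rep1_fun (f ◂ h)
  = (fmap rep1_fun f ◂ h) • iso_sym (asc g m c).
Proof.
apply: (iso_epic (f := asc g m c)); rewrite /= fwdKr.
by apply: (iso_monic (f := asc g m' c')); rewrite asc_nat -compA bwdKl.
Qed.

Lemma rep1_asc (m : rep_ob B) (c d : end_monoidal) :
  aasc (rep1_fun m : rep_ob B') c d • bmap (act (rep_ob B')) (iso_sym (asc g m c)) (idm d) • iso_sym (asc g (m ∘ c) d)
  = iso_sym (asc g m (c ∘ d)) • fmap rep1_fun (aasc m c d).
Proof.
apply: (iso_monic (f := asc g m (c ∘ d))); rewrite /= bwdKl !compA pentagon.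
rewrite -(compA _ _ (_ ∗ idm d)) -bmap_compl bwdK bmap_id compm1.
by rewrite -compA bwdK compm1.
Qed.

Lemma rep1_un (m : rep_ob B) :
  aun (rep1_fun m : rep_ob B') • iso_sym (asc g m (id1 A)) = fmap rep1_fun (aun m).
Proof. by rewrite /= -run_asc bwdKr. Qed.

Definition rep1 : modfun (rep_ob B) (rep_ob B') :=
  @ModFun k end_monoidal (rep_ob B) (rep_ob B') rep1_fun
    (fun m c => iso_sym (asc g m c)) rep1_nat rep1_asc rep1_un.

End OneCells.

Section TwoCells.

Variables (B B' : X) (g g' : hom1 X B B') (a : hom (hom1 X B B') g g').

Lemma rep2_nat (m m' : rep_ob B) (f : hom (rep_ob B) m m') :
  (a ∗ idm m') • fmap (rep1 g) f = fmap (rep1 g') f • (a ∗ idm m).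
Proof. by rewrite /= bmap_interchange. Qed.

Lemma rep2_act (m : rep_ob B) (c : end_monoidal) :
  mstr (rep1 g') m c • (a ∗ idm (m ∘ c))
  = bmap (act (rep_ob B')) (a ∗ idm m) (idm c) • mstr (rep1 g) m c.
Proof.
apply: (iso_epic (f := asc g m c)); rewrite /= fwdKr -compA -asc_natl.
by rewrite fwdKl.
Qed.

Definition rep2 : modnat (rep1 g) (rep1 g') :=
  @ModNat k end_monoidal _ _ (rep1 g) (rep1 g') (fun m => a ∗ idm m)
    rep2_nat rep2_act.

End TwoCells.

Lemma rep2_lin (B B' : X) (g g' : hom1 X B B') :
  linear (fun a : hom (hom1 X B B') g g' =>
    rep2 a : hom (mod_hom (rep_ob B) (rep_ob B')) (rep1 g) (rep1 g')).
Proof. by move=> c a b; apply: modnat_eq => m; rewrite mnat_linE /= bmap_linl. Qed.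

Lemma rep2_id (B B' : X) (g : hom1 X B B') :
  rep2 (idm g) = idm (rep1 g : mod_hom (rep_ob B) (rep_ob B')).
Proof. by apply: modnat_eq => m /=; rewrite bmap_id. Qed.

Lemma rep2_comp (B B' : X) (g g' g'' : hom1 X B B') (b : hom (hom1 X B B') g' g'')
    (a : hom (hom1 X B B') g g') :
  rep2 (b • a)
  = (rep2 b : hom (mod_hom (rep_ob B) (rep_ob B')) _ _) • rep2 a.
Proof. by apply: modnat_eq => m /=; rewrite bmap_compl. Qed.

Definition rep_hom (B B' : X) :
    lfunctor (hom1 X B B') (mod_hom (rep_ob B) (rep_ob B')) :=
  @LFunctor k (hom1 X B B') (mod_hom (rep_ob B) (rep_ob B')) (@rep1 B B')
    (@rep2 B B') (@rep2_lin B B') (@rep2_id B B') (@rep2_comp B B').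

Section RepCmp.

Variables (B B' B'' : X) (g : hom1 X B' B'') (f : hom1 X B B').

Lemma rep_cmp_nat (m m' : rep_ob B) (h : hom (rep_ob B) m m') :
  (asc g f m')⁻ • fmap (mfun_comp (rep1 g) (rep1 f)) h
  = fmap (rep1 (g ∘ f)) h • (asc g f m)⁻.
Proof.
apply: (iso_monic (f := asc g f m')); rewrite /= bwdKl.
apply: (iso_epic (f := asc g f m)).
by rewrite -asc_natr !compA fwdKr.
Qed.

Lemma rep_cmp_act (m : rep_ob B) (c : end_monoidal) :
  mstr (rep1 (g ∘ f)) m c • (asc g f (m ◁ c))⁻
  = bmap (act (rep_ob B'')) (asc g f m)⁻ (idm c) • mstr (mfun_comp (rep1 g) (rep1 f)) m c.
Proof.
apply: (iso_monic (f := asc (g ∘ f) m c)); rewrite /= bwdKl.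
apply: (iso_monic (f := asc g f (m ∘ c))); rewrite bwdK !compA pentagon.
rewrite -!compA (compA (_ ∗ idm c)) -bmap_compl bwdK bmap_id comp1m.
by rewrite bwdKl -bmap_compr bwdK bmap_id.
Qed.

Lemma rep_cmp_bnat (m m' : rep_ob B) (h : hom (rep_ob B) m m') :
  asc g f m' • fmap (rep1 (g ∘ f)) h
  = fmap (mfun_comp (rep1 g) (rep1 f)) h • asc g f m.
Proof. exact: asc_natr. Qed.

Lemma rep_cmp_bact (m : rep_ob B) (c : end_monoidal) :
  mstr (mfun_comp (rep1 g) (rep1 f)) m c • asc g f (m ◁ c)
  = bmap (act (rep_ob B'')) (asc g f m) (idm c) • mstr (rep1 (g ∘ f)) m c.
Proof.
apply: (iso_epic (f := iso_sym (asc g f (m ∘ c)))) => /=.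
rewrite -compA bwdK compm1 -compA rep_cmp_act.
by rewrite compA -bmap_compl bwdK bmap_id comp1m.
Qed.

Definition rep_cmp_fwd :
    hom (mod_hom (rep_ob B) (rep_ob B'')) (mfun_comp (rep1 g) (rep1 f))
      (rep1 (g ∘ f)) :=
  @ModNat k end_monoidal _ _ (mfun_comp (rep1 g) (rep1 f)) (rep1 (g ∘ f))
    (fun m => (asc g f m)⁻) rep_cmp_nat rep_cmp_act.

Definition rep_cmp_bwd :
    hom (mod_hom (rep_ob B) (rep_ob B'')) (rep1 (g ∘ f))
      (mfun_comp (rep1 g) (rep1 f)) :=
  @ModNat k end_monoidal _ _ (rep1 (g ∘ f)) (mfun_comp (rep1 g) (rep1 f))
    (fun m => fwd (asc g f m)) rep_cmp_bnat rep_cmp_bact.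

Lemma rep_cmpK : rep_cmp_bwd • rep_cmp_fwd = idm _.
Proof. by apply: modnat_eq => m /=; rewrite bwdK. Qed.

Lemma rep_cmp_bK : rep_cmp_fwd • rep_cmp_bwd = idm _.
Proof. by apply: modnat_eq => m /=; rewrite fwdK. Qed.

Definition rep_cmp := Iso rep_cmpK rep_cmp_bK.

End RepCmp.

Section RepIdn.

Variable B : X.

Lemma rep_idn_nat (m m' : rep_ob B) (h : hom (rep_ob B) m m') :
  (lun m')⁻ • h = fmap (rep1 (id1 B)) h • (lun m)⁻.
Proof.
apply: (iso_monic (f := lun m')); rewrite /= bwdKl.
by rewrite compA lun_nat bwdKr.
Qed.

Lemma rep_idn_act (m : rep_ob B) (c : end_monoidal) :
  mstr (rep1 (id1 B)) m c • (lun (m ◁ c))⁻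
  = bmap (act (rep_ob B)) (lun m)⁻ (idm c) • mstr (mfun_id (rep_ob B)) m c.
Proof.
apply: (iso_monic (f := asc (id1 B) m c)); rewrite /= bwdKl compm1.
apply: (iso_monic (f := lun (m ∘ c))); rewrite bwdK compA lun_asc.
by rewrite -bmap_compl bwdK bmap_id.
Qed.

Lemma rep_idn_bnat (m m' : rep_ob B) (h : hom (rep_ob B) m m') :
  lun m' • fmap (rep1 (id1 B)) h = h • lun m.
Proof. exact: lun_nat. Qed.

Lemma rep_idn_bact (m : rep_ob B) (c : end_monoidal) :
  mstr (mfun_id (rep_ob B)) m c • lun (m ◁ c)
  = bmap (act (rep_ob B)) (lun m) (idm c) • mstr (rep1 (id1 B)) m c.
Proof. by rewrite /= comp1m -lun_asc bwdKr. Qed.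

Definition rep_idn_fwd : hom (mod_hom (rep_ob B) (rep_ob B)) (mfun_id (rep_ob B))
    (rep1 (id1 B)) :=
  @ModNat k end_monoidal _ _ (mfun_id (rep_ob B)) (rep1 (id1 B))
    (fun m => (lun m)⁻) rep_idn_nat rep_idn_act.

Definition rep_idn_bwd : hom (mod_hom (rep_ob B) (rep_ob B)) (rep1 (id1 B))
    (mfun_id (rep_ob B)) :=
  @ModNat k end_monoidal _ _ (rep1 (id1 B)) (mfun_id (rep_ob B))
    (fun m => fwd (lun m)) rep_idn_bnat rep_idn_bact.

Lemma rep_idnK : rep_idn_bwd • rep_idn_fwd = idm _.
Proof. by apply: modnat_eq => m /=; rewrite bwdK. Qed.

Lemma rep_idn_bK : rep_idn_fwd • rep_idn_bwd = idm _.
Proof. by apply: modnat_eq => m /=; rewrite fwdK. Qed.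

Definition rep_idn := Iso rep_idnK rep_idn_bK.

End RepIdn.

Hypothesis lfs : locally_finite_semisimple X.

Definition rep_fs (B : X) : fsmodcat end_monoidal :=
  @FSModCat k end_monoidal (rep_ob B) (lfs A B).

Lemma rep_nat (B B' B'' : X) (g g' : hom1 X B' B'') (f f' : hom1 X B B')
    (b : hom (hom1 X B' B'') g g') (a : hom (hom1 X B B') f f') :
  fmap (rep_hom B B'') (b ∗ a) • rep_cmp g f
  = rep_cmp g' f' • mnat_hcomp (rep2 b) (rep2 a).
Proof.
apply: modnat_eq => m /=.
apply: (iso_monic (f := asc g' f' m)); rewrite compA asc_nat bwdKl.
by rewrite -compA bwdK compm1 -bmap_comp comp1m compm1.
Qed.

Lemma rep_asc (B B' B'' B3 : X) (h : hom1 X B'' B3) (g : hom1 X B' B'')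
    (f : hom1 X B B') :
  fmap (rep_hom B B3) (asc h g f) • rep_cmp (h ∘ g) f
    • bmap (mod_comp (rep_ob B) (rep_ob B') (rep_ob B3)) (rep_cmp h g) (idm (rep1 f : mod_hom _ _))
  = rep_cmp h (g ∘ f)
    • bmap (mod_comp (rep_ob B) (rep_ob B'') (rep_ob B3)) (idm (rep1 h : mod_hom _ _)) (rep_cmp g f)
    • mod_asc (rep1 h) (rep1 g) (rep1 f).
Proof.
apply: modnat_eq => m /=; rewrite !bmap_id !comp1m !compm1.
apply: (iso_monic (f := asc h (g ∘ f) m)); rewrite bwdKl.
apply: (iso_monic (f := iso_bmap (comp1 X A B'' B3) (iso_refl h) (asc g f m))) => /=.
rewrite -bmap_compr bwdK bmap_id !compA -pentagon.
by rewrite bwdKr bwdK.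
Qed.

Lemma rep_lun (B B' : X) (f : hom1 X B B') :
  fmap (rep_hom B B') (lun f) • rep_cmp (id1 B') f
    • bmap (mod_comp (rep_ob B) (rep_ob B') (rep_ob B')) (rep_idn B') (idm (rep1 f : mod_hom _ _))
  = mod_lun (rep1 f).
Proof.
apply: modnat_eq => m /=; rewrite ?bmap_id !compm1.
by rewrite -lun_asc bwdKr bwdK.
Qed.

Lemma rep_run (B B' : X) (f : hom1 X B B') :
  fmap (rep_hom B B') (run f) • rep_cmp f (id1 B)
    • bmap (mod_comp (rep_ob B) (rep_ob B) (rep_ob B')) (idm (rep1 f : mod_hom _ _)) (rep_idn B)
  = mod_run (rep1 f).
Proof.
apply: modnat_eq => m /=; rewrite ?bmap_id !comp1m.
by rewrite -triangle bwdKr -bmap_compr bwdK bmap_id.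
Qed.

Definition rep : lin2functor X (Mod end_monoidal) :=
  @Lin2Functor k X (Mod end_monoidal) rep_fs (fun B B' => rep_hom B B')
    (fun B B' B'' g f => rep_cmp g f) (fun B => rep_idn B)
    (fun B B' B'' => @rep_nat B B' B'') (fun B B' B'' B3 => @rep_asc B B' B'' B3)
    (fun B B' => @rep_lun B B') (fun B B' => @rep_run B B').

End Representable.

Section LocalEquivalence.

Variables (k : fieldType) (X : lin2cat k) (A : X).
Hypothesis domA : forall B, dominated A B.

(** The identity of [B] is a retract of some [f ∘ h] with [f] starting at [A], and [a ∗ idm (f ∘ h)]
    is determined by [a ∗ idm f]. *)
Lemma rep_inj (B B' : X) (g g' : hom1 X B B') (a b : hom (hom1 X B B') g g') :
  (forall m : hom1 X A B, a ∗ idm m = b ∗ idm m) -> a = b.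
Proof.
move=> ab; have [f [h [i [r ri]]]] := domA B.
apply: whisker_inj_id1; apply/esym.
rewrite -[idm (id1 B)]ri -[in LHS](comp1m b) -[in RHS](comp1m a) !bmap_comp.
rewrite -[in LHS](comp1m b) -[in RHS](comp1m a).
have e (c : hom (hom1 X B B') g g') : c ∗ i = (c ∗ idm (f ∘ h)) • (idm g ∗ i) by rewrite -bmap_lr.
have e' c : c ∗ idm (f ∘ h) = asc g' f h • ((c ∗ idm f) ∗ idm h) • (asc g f h)⁻.
  by rewrite asc_natl bwdKr.
by rewrite !comp1m (e a) (e b) !e' ab.
Qed.

Lemma rep_faithful (B B' : X) : faithful (rep_hom A B B').
Proof.
move=> g g' a b ab; apply: rep_inj => m.
exact: (congr1 (fun t : modnat (rep1 A g) (rep1 A g') => t m) ab).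
Qed.

(** The preimage is the component of [s] at [f], whiskered by [h] and compressed along the
    retraction of [f ∘ h] onto the identity of [B]. Compatibility with the action turns the
    whiskered component into the one at [f ∘ (h ∘ m)], and naturality along [Q] brings it back to
    [m]. *)
Lemma rep_full (B B' : X) : full (rep_hom A B B').
Proof.
move=> g g' s; have [f [h [i [r ri]]]] := domA B.
pose sf : hom (hom1 X A B') (g ∘ f) (g' ∘ f) := s f.
have sact c : asc g' f c • (sf ∗ idm c) = s (f ∘ c) • asc g f c.
  apply: (iso_monic (f := iso_sym (asc g' f c))) => /=; rewrite fwdKl compA.
  have := mnat_act s f c; rewrite /= => ->.
  by rewrite -compA fwdK compm1.
pose T := (idm g' ∗ r) • asc g' f h • (sf ∗ idm h) • (asc g f h)⁻ • (idm g ∗ i).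
exists (run g' • T • (run g)⁻); apply: modnat_eq => m /=.
pose J := asc f h m • (i ∗ idm m) • (lun m)⁻.
pose Q := lun m • (r ∗ idm m) • (asc f h m)⁻.
have QJ : Q • J = idm m.
  rewrite /Q /J !compA fwdKr -(compA (lun m)) -bmap_compl ri bmap_id compm1.
  by rewrite bwdK.
have TE : asc g' (id1 B) m • (T ∗ idm m) = (idm g' ∗ ((r ∗ idm m) • (asc f h m)⁻))
    • s (f ∘ (h ∘ m)) • (idm g ∗ (asc f h m • (i ∗ idm m))) • asc g (id1 B) m.
  rewrite /T !bmap_compl !compA asc_natm.
  have p1 : asc g' (f ∘ h) m • (asc g' f h ∗ idm m)
      = (idm g' ∗ (asc f h m)⁻) • asc g' f (h ∘ m) • asc (g' ∘ f) h m.
    rewrite -compA pentagon !compA -bmap_compr fwdK bmap_id comp1m.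
    by [].
  have p2 : asc g f (h ∘ m) • asc (g ∘ f) h m • ((asc g f h)⁻ ∗ idm m)
      = (idm g ∗ asc f h m) • asc g (f ∘ h) m.
    rewrite pentagon -!compA -bmap_compl bwdK bmap_id compm1.
    by [].
  rewrite -(compA _ _ (asc g' f h ∗ _)) p1 !compA -(compA _ _ ((sf ∗ _) ∗ _)).
  rewrite asc_natl compA -(compA _ (asc g' f _)) sact !compA.
  rewrite -(compA _ (asc g f _)) -(compA _ (asc g f _ • _)) p2.
  by rewrite !bmap_compr -!compA asc_natm.
clearbody T; rewrite !bmap_compl.
have -> : run g' ∗ idm m = (idm g' ∗ lun m) • asc g' (id1 B) m by rewrite triangle.
have -> : (run g)⁻ ∗ idm m = (asc g (id1 B) m)⁻ • (idm g ∗ (lun m)⁻).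
  apply: (iso_epic (f := iso_bmap (comp1 X A B B') (run g) (iso_refl m))) => /=.
  rewrite -bmap_compl fwdK bmap_id -triangle -!compA (compA (idm g ∗ _)).
  by rewrite -bmap_compr fwdK bmap_id comp1m fwdK.
rewrite -(compA _ _ (T ∗ _)) TE !compA bwdKr -bmap_compr -(compA _ _ (idm g ∗ (lun m)⁻)).
rewrite -bmap_compr compA.
have := mnat_nat s Q; rewrite /= => <-.
by rewrite -compA -bmap_compr QJ bmap_id compm1.
Qed.

Section EssSurj.

Variables (B B' : X) (H : modfun (rep_ob A B) (rep_ob A B')) (f : hom1 X A B).

Let P := mfun_comp H (rep1 A f).
Let Hf : hom1 X A B' := H f.

Lemma free_nat (m m' : rep_ob A A) (h : hom (rep_ob A A) m m') :
  mstr H f m' • fmap P h = fmap (rep1 A Hf) h • mstr H f m.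
Proof. by have := mstr_nat H (idm (f : rep_ob A B)) h; rewrite fmap_id. Qed.

Lemma free_act (m : rep_ob A A) (c : end_monoidal A) :
  mstr (rep1 A Hf) m c • mstr H f (m ◁ c)
  = bmap (act (rep_ob A B')) (mstr H f m) (idm c) • mstr P m c.
Proof.
apply: (iso_monic (f := asc Hf m c)); rewrite /= bwdKl.
have := mstr_asc H f m c; rewrite /= !compA => ->.
by rewrite -compA -fmap_comp bwdK fmap_id compm1.
Qed.

(** The structure map of [H] at [f] is itself the comparison: on the regular module, [H] after
    composition with [f] is composition with the 1-cell [H f]. *)
Definition free_fwd : modnat P (rep1 A Hf) :=
  @ModNat k _ _ _ P (rep1 A Hf) (fun c => fwd (mstr H f c)) free_nat free_act.

Lemma free_bnat (m m' : rep_ob A A) (h : hom (rep_ob A A) m m') :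
  (mstr H f m')⁻ • fmap (rep1 A Hf) h = fmap P h • (mstr H f m)⁻.
Proof.
apply: (iso_monic (f := mstr H f m')); rewrite bwdKl compA free_nat.
by rewrite bwdKr.
Qed.

Lemma free_bact (m : rep_ob A A) (c : end_monoidal A) :
  mstr P m c • (mstr H f (m ◁ c))⁻
  = bmap (act (rep_ob A B')) (mstr H f m)⁻ (idm c) • mstr (rep1 A Hf) m c.
Proof.
apply: (iso_epic (f := mstr H f (m ◁ c))); rewrite fwdKr -compA free_act.
by rewrite compA -bmap_compl fwdK bmap_id comp1m.
Qed.

Definition free_bwd : modnat (rep1 A Hf) P :=
  @ModNat k _ _ _ (rep1 A Hf) P (fun c => (mstr H f c)⁻) free_bnat free_bact.

Lemma free_retract :
  retract (P : mod_hom (rep_ob A A) (rep_ob A B')) (rep1 A Hf).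
Proof. by exists free_fwd, free_bwd; apply: modnat_eq => c /=; rewrite fwdK. Qed.

End EssSurj.

(** As the identity of [B] is a retract of [f ∘ h], the functor [H] is a retract of its composite
    with [rep (f ∘ h)]. By [free_retract] the latter is a retract of the image of [H f ∘ h], and
    [retract_reflect] finds the summand in [X]. *)
Lemma rep_surj (B B' : X) : locally_finite_semisimple X ->
  idem_complete_cat (hom1 X B B') -> ess_surj (rep_hom A B B').
Proof.
move=> lfs ic H; have [f [h fh]] := domA B.
pose Y := Mod (end_monoidal A); pose F := rep A lfs.
pose H' : hom1 Y (F B) (F B') := H.
apply: (retract_reflect (@rep_faithful B B') (@rep_full B B') (x := (H f : hom1 X A B') ∘ h) ic).
apply: (@retract_trans _ (hom1 Y (F B) (F B')) _ (H' ∘ id1 (F B))).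
  exact: retract_iso (iso_sym (run H')).
apply: (@retract_trans _ (hom1 Y (F B) (F B')) _ (H' ∘ fhom F (f ∘ h))).
  apply: retract_comp1 (retract_refl _) _.
  apply: retract_trans (retract_iso (fidn F B)) _.
  case: fh => i [r ri]; exists (fmap (fhom F) i), (fmap (fhom F) r).
  by rewrite -fmap_comp ri fmap_id.
apply: (@retract_trans _ (hom1 Y (F B) (F B')) _ (H' ∘ (fhom F f ∘ fhom F h))).
  exact: retract_comp1 (retract_refl _) (retract_iso (iso_sym (fcmp F f h))).
apply: (@retract_trans _ (hom1 Y (F B) (F B')) _ ((H' ∘ fhom F f) ∘ fhom F h)).
  exact: retract_iso (iso_sym (asc H' (fhom F f) (fhom F h))).
apply: (@retract_trans _ (hom1 Y (F B) (F B')) _ (fhom F (H f : hom1 X A B') ∘ fhom F h)).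
  apply: (@retract_comp1 k Y (F B) (F A) (F B') _ _ _ _ _ (retract_refl _)).
  exact: free_retract.
exact: retract_iso (fcmp F (H f : hom1 X A B') h).
Qed.

End LocalEquivalence.

(** * Module categories *)

Section ModTools.

Variables (k : fieldType) (C : monoidal k).

Section ComponentwiseIso.

Variables (M N : modcat C) (F G : modfun M N) (s : modnat F G).
Variable t : forall m : M, hom N (G m) (F m).
Hypotheses (ts : forall m, t m • s m = idm (F m))
  (st : forall m, s m • t m = idm (G m)).

Lemma inv_nat (m m' : M) (f : hom M m m') : t m' • fmap G f = fmap F f • t m.
Proof.
by rewrite -[RHS]comp1m -(ts m') -!compA (compA (s m')) mnat_nat -!compA st compm1.
Qed.

Lemma inv_act (m : M) (c : C) :
  mstr F m c • t (m ◁ c) = (t m ◂ idm c) • mstr G m c.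
Proof.
rewrite -[RHS]compm1 -(st (m ◁ c)) !compA -(compA _ _ (s _)) mnat_act compA.
by rewrite -bmap_compl ts bmap_id comp1m.
Qed.

Definition inv_modnat : modnat G F := ModNat inv_nat inv_act.

Definition modnat_iso : @iso k (mod_hom M N) F G.
Proof. by exists s inv_modnat; apply: modnat_eq => m /=. Defined.

End ComponentwiseIso.

Lemma modnat_sumE (M N : modcat C) (F G : modfun M N) I (l : seq I) (P : pred I)
    (t : I -> modnat F G) (m : M) :
  (\sum_(i <- l | P i) t i) m = \sum_(i <- l | P i) t i m.
Proof.
apply: (big_morph (fun s : modnat F G => s m)) => // s s'.
by have := mnat_linE 1 s s' m; rewrite !scale1r.
Qed.

Lemma modnat_scaleE (M N : modcat C) (F G : modfun M N) a (t : modnat F G) (m : M) :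
  (a *: t) m = a *: t m.
Proof. by have := mnat_linE a t 0 m; rewrite !addr0. Qed.

Section Splitting.

Variables (M N : modcat C) (F : modfun M N) (e : modnat F F) (G0 : M -> N).
Variables (r : forall m, hom N (F m) (G0 m)) (i : forall m, hom N (G0 m) (F m)).
Hypotheses (ri : forall m, r m • i m = idm (G0 m))
  (ir : forall m, i m • r m = e m).

Let ei m : e m • i m = i m.
Proof. by rewrite -ir -compA ri compm1. Qed.

Let re m : r m • e m = r m.
Proof. by rewrite -ir compA ri comp1m. Qed.

Lemma split_lin (m m' : M) :
  linear (fun f : hom M m m' => r m' • fmap F f • i m).
Proof. by move=> a f g; rewrite fmap_lin comp_linr comp_linl. Qed.

Lemma split_id (m : M) : r m • fmap F (idm m) • i m = idm (G0 m).
Proof. by rewrite fmap_id compm1 ri. Qed.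

Lemma split_comp (m m' m'' : M) (g : hom M m' m'') (f : hom M m m') :
  r m'' • fmap F (g • f) • i m
  = (r m'' • fmap F g • i m') • (r m' • fmap F f • i m).
Proof.
rewrite !compA -(compA _ (i m')) ir -!compA (compA (e m')) mnat_nat -!compA ei.
by rewrite fmap_comp !compA.
Qed.

Definition split_fun : lfunctor M N := LFunctor split_lin split_id split_comp.

Let str (m : M) (c : C) : hom N (G0 (m ◁ c)) (G0 m ◁ c) :=
  (r m ◂ idm c) • mstr F m c • i (m ◁ c).
Let bstr (m : M) (c : C) : hom N (G0 m ◁ c) (G0 (m ◁ c)) :=
  r (m ◁ c) • (mstr F m c)⁻ • (i m ◂ idm c).

Let strK m c : bstr m c • str m c = idm _.
Proof.
rewrite /bstr /str !compA -(compA _ (i m ◂ _)) -bmap_compl ir -(compA _ (_ ◂ _)).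
by rewrite -mnat_act !compA fwdKr re ri.
Qed.

Let bstrK m c : str m c • bstr m c = idm _.
Proof.
rewrite /bstr /str !compA -(compA _ (i (m ◁ c))) ir -(compA _ (mstr F m c)) mnat_act.
by rewrite !compA bwdKr -!bmap_compl re ri bmap_id.
Qed.

Definition split_str (m : M) (c : C) : iso (split_fun (m ◁ c)) (split_fun m ◁ c) :=
  @Iso k N (split_fun (m ◁ c)) (split_fun m ◁ c) (str m c) (bstr m c)
    (strK m c) (bstrK m c).

Lemma split_nat (m m' : M) (c c' : C) (f : hom M m m') (g : hom C c c') :
  split_str m' c' • fmap split_fun (f ◂ g)
  = (fmap split_fun f ◂ g) • split_str m c.
Proof.
have E : r m' • fmap F f • i m • r m = r m' • fmap F f.
  by rewrite -compA ir -compA -mnat_nat compA re.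
rewrite /= /str !compA -(compA _ (i _)) ir -(compA _ (mstr F m' c')) mnat_act.
rewrite !compA -bmap_compl re -(compA _ (mstr F m' c')) mstr_nat.
by rewrite !compA -!bmap_comp comp1m compm1 E.
Qed.

Lemma split_asc (m : M) (c d : C) :
  aasc (split_fun m) c d • (split_str m c ◂ idm d) • split_str (m ◁ c) d
  = split_str m (c ⊗ d) • fmap split_fun (aasc m c d).
Proof.
rewrite /= /str !bmap_compl !compA.
rewrite -(compA _ (i (m ◁ c) ◂ _)) -bmap_compl ir -(compA _ (_ ◂ _) (mstr F _ d)).
rewrite -mnat_act !compA -(compA _ _ (i _)) ei.
rewrite -(compA _ (i (m ◁ (c ⊗ d)))) ir -[in RHS](compA _ (mstr F m _) (e _)) mnat_act.
rewrite !compA -bmap_compl re aasc_nat bmap_id.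
rewrite -[in RHS](compA _ (mstr F m _)) -mstr_asc !compA.
by [].
Qed.

Lemma split_un (m : M) :
  aun (split_fun m) • split_str m (munit C) = fmap split_fun (aun m).
Proof. by rewrite /= /str !compA aun_nat -(compA (r m)) mstr_un. Qed.

Definition split_mod : modfun M N := ModFun split_nat split_asc split_un.

Lemma split_r_nat (m m' : M) (f : hom M m m') :
  r m' • fmap F f = fmap split_mod f • r m.
Proof. by rewrite /= -compA ir -compA -mnat_nat compA re. Qed.

Lemma split_r_act (m : M) (c : C) :
  mstr split_mod m c • r (m ◁ c) = (r m ◂ idm c) • mstr F m c.
Proof. by rewrite /= /str -compA ir -compA mnat_act compA -bmap_compl re. Qed.

Lemma split_i_nat (m m' : M) (f : hom M m m') :
  i m' • fmap split_mod f = fmap F f • i m.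
Proof. by rewrite /= !compA ir mnat_nat -compA ei. Qed.

Lemma split_i_act (m : M) (c : C) :
  mstr F m c • i (m ◁ c) = (i m ◂ idm c) • mstr split_mod m c.
Proof. by rewrite /= /str !compA -bmap_compl ir -mnat_act -compA ei. Qed.

Definition split_r : modnat F split_mod :=
  @ModNat k C M N F split_mod r split_r_nat split_r_act.
Definition split_i : modnat split_mod F :=
  @ModNat k C M N split_mod F i split_i_nat split_i_act.

End Splitting.

(** Splitting at each object is enough: functoriality and module structure of the image are those of
    [F], compressed by [r] and [i]. *)
Lemma mod_idem_complete (M N : modcat C) :
  idem_complete_cat N -> idem_complete_cat (mod_hom M N).
Proof.
move=> ic F e ee.
have spl (m : M) : exists y : {y : N & (hom N (F m) y * hom N y (F m))%type},
    (tagged y).1 • (tagged y).2 = idm (tag y) /\ (tagged y).2 • (tagged y).1 = (e : modnat F F) m.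
  have [|y [r [i [ri ir]]]] := ic (F m) ((e : modnat F F) m).
    exact: (congr1 (fun t : modnat F F => t m) ee).
  by exists (Tagged (fun y => (hom N (F m) y * hom N y (F m))%type) (r, i)).
pose T m := cid (spl m).
pose ri m := (svalP (T m)).1; pose ir m := (svalP (T m)).2.
exists (split_mod ri ir), (split_r ri ir), (split_i ri ir).
by split; apply: modnat_eq => m /=; [exact: ri | exact: ir].
Qed.

End ModTools.

Section Equivalences.

Variables (k : fieldType) (C D : lincat k) (F : lfunctor C D) (G : lfunctor D C).
Variables (a : forall x, iso (G (F x)) x) (b : forall y, iso (F (G y)) y).
Hypothesis a_nat : forall x x' (f : hom C x x'), a x' • fmap G (fmap F f) = f • a x.
Hypothesis b_nat : forall y y' (f : hom D y y'), b y' • fmap F (fmap G f) = f • b y.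

Lemma equivalence_faithful : faithful F.
Proof.
by move=> x x' f g e; apply: (iso_epic (f := a x)); rewrite -!a_nat e.
Qed.

Lemma equivalence_full : full F.
Proof.
have Gf : faithful G.
  by move=> y y' f g e; apply: (iso_epic (f := b y)); rewrite -!b_nat e.
move=> x x' g; exists (a x' • fmap G g • (a x)⁻); apply: Gf.
apply: (iso_monic (f := a x')).
by rewrite a_nat fwdKr.
Qed.

End Equivalences.

Section ModEquivalence.

Variables (k : fieldType) (C : monoidal k) (M N : fsmodcat C) (e : modfun M N).
Hypothesis e_equiv : @equivalence1 k (Mod C) M N e.

Definition iso_at (P Q : modcat C) (F G : modfun P Q)
    (t : @iso k (mod_hom P Q) F G) (m : P) : iso (F m) (G m) :=
  @Iso k Q (F m) (G m) ((fwd t : modnat F G) m) ((bwd t : modnat G F) m)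
    (congr1 (fun s : modnat F F => s m) (fwdK t))
    (congr1 (fun s : modnat G G => s m) (bwdK t)).

Lemma mod_equiv_faithful : faithful e.
Proof.
have [g [[a] [b]]] := e_equiv.
apply: (@equivalence_faithful _ _ _ e (g : modfun N M) (iso_at a)).
by move=> x x' f; exact: (mnat_nat (fwd a : modnat _ _) f).
Qed.

Lemma mod_equiv_full : full e.
Proof.
have [g [[a] [b]]] := e_equiv.
apply: (@equivalence_full _ _ _ e (g : modfun N M) (iso_at a) (iso_at b)).
  by move=> x x' f; exact: (mnat_nat (fwd a : modnat _ _) f).
by move=> x x' f; exact: (mnat_nat (fwd b : modnat _ _) f).
Qed.

End ModEquivalence.

Section PostWhisker.

Variables (k : fieldType) (C : monoidal k) (P Q : modcat C) (e : modfun P Q).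
Hypotheses (eF : faithful e) (eU : full e).

Lemma modnat_lift (M : modcat C) (u v : modfun M P)
    (t : modnat (mfun_comp e u) (mfun_comp e v)) :
  exists s : modnat u v, forall m, fmap e (s m) = t m.
Proof.
pose s m := sval (cid (eU (t m))).
have sE m : fmap e (s m) = t m by rewrite /s; case: cid.
have s_nat m m' (f : hom M m m') : s m' • fmap u f = fmap v f • s m.
  by apply: eF; rewrite !fmap_comp !sE; exact: (mnat_nat t f).
have s_act m c : mstr v m c • s (m ◁ c) = (s m ◂ idm c) • mstr u m c.
  apply: eF; rewrite !fmap_comp sE; apply: (iso_monic (f := mstr e (v m) c)).
  rewrite !compA mstr_nat sE; have := mnat_act t m c => /= ->.
  by rewrite compA.
by exists (ModNat s_nat s_act).
Qed.

End PostWhisker.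

(** * Inverting a 2-functor that is locally an equivalence and surjective up to equivalence *)

Section Whitehead.

Variables (k : fieldType) (X : lin2cat k) (A : X).
Hypothesis domA : forall B, dominated A B.

Notation C := (end_monoidal A).

Section Lift.

Variables (B B' : X) (N : modcat C) (e : modfun (rep_ob A B') N).
Hypotheses (eF : faithful e) (eU : full e).

Lemma whisker_lin (g g' : hom1 X B B') :
  linear (fun a : hom (hom1 X B B') g g' =>
    (mnat_hcomp (mnat_id e) (rep2 A a) : hom (mod_hom _ _) (mfun_comp e (rep1 A g)) (mfun_comp e (rep1 A g')))).
Proof.
move=> c a b; apply: modnat_eq => m; rewrite mnat_linE /=.
by rewrite !comp1m bmap_linl fmap_lin.
Qed.

Lemma whisker_id (g : hom1 X B B') :
  mnat_hcomp (mnat_id e) (rep2 A (idm g)) = mnat_id (mfun_comp e (rep1 A g)).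
Proof. by apply: modnat_eq => m /=; rewrite comp1m bmap_id fmap_id. Qed.

Lemma whisker_comp (g g' g'' : hom1 X B B') (b : hom (hom1 X B B') g' g'')
    (a : hom (hom1 X B B') g g') :
  mnat_hcomp (mnat_id e) (rep2 A (b • a))
  = mnat_comp (mnat_hcomp (mnat_id e) (rep2 A b)) (mnat_hcomp (mnat_id e) (rep2 A a)).
Proof. by apply: modnat_eq => m /=; rewrite !comp1m bmap_compl fmap_comp. Qed.

Definition whisker : lfunctor (hom1 X B B') (mod_hom (rep_ob A B) N) :=
  @LFunctor k (hom1 X B B') (mod_hom (rep_ob A B) N)
    (fun g => mfun_comp e (rep1 A g))
    (fun g g' a => mnat_hcomp (mnat_id e) (rep2 A a))
    whisker_lin whisker_id whisker_comp.

Lemma whisker_inj (g g' : hom1 X B B') (a b : hom (hom1 X B B') g g') :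
  (forall m : hom1 X A B, fmap e (a ∗ idm m : hom (rep_ob A B') (g ∘ m) (g' ∘ m))
    = fmap e (b ∗ idm m : hom (rep_ob A B') (g ∘ m) (g' ∘ m))) -> a = b.
Proof. by move=> ab; apply: (rep_inj domA) => m; apply: eF. Qed.

Lemma whisker_faithful : faithful whisker.
Proof.
move=> g g' a b ab; apply: whisker_inj => m.
have := congr1 (fun t : modnat (mfun_comp e (rep1 A g)) (mfun_comp e (rep1 A g')) => t m) ab.
by rewrite /= !comp1m.
Qed.

Lemma whisker_full : full whisker.
Proof.
move=> g g' t; have [s sE] := modnat_lift eF eU (t : modnat _ _).
have [a aE] := rep_full domA (s : hom (mod_hom _ _) (rep1 A g) (rep1 A g')).
exists a; apply: modnat_eq => m /=; rewrite comp1m -sE.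
by rewrite -aE.
Qed.

Lemma lift_exists (g g' : hom1 X B B')
    (t : hom (mod_hom (rep_ob A B) N) (mfun_comp e (rep1 A g)) (mfun_comp e (rep1 A g'))) :
  exists a : hom (hom1 X B B') g g', forall m : hom1 X A B,
    fmap e (a ∗ idm m : hom (rep_ob A B') (g ∘ m) (g' ∘ m)) = (t : modnat _ _) m.
Proof.
have [a <-] := whisker_full t; exists a => m /=.
by rewrite comp1m.
Qed.

Lemma lift_iso_exists (g g' : hom1 X B B')
    (t : @iso k (mod_hom (rep_ob A B) N) (mfun_comp e (rep1 A g)) (mfun_comp e (rep1 A g'))) :
  exists a : iso g g', forall m : hom1 X A B,
    fmap e (a ∗ idm m : hom (rep_ob A B') (g ∘ m) (g' ∘ m)) = (fwd t : modnat _ _) m.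
Proof.
have [a [<- _]] := iso_reflect whisker_faithful whisker_full t; exists a => m /=.
by rewrite comp1m.
Qed.

End Lift.

Variables (G0 : fsmodcat C -> X) (e : forall M : fsmodcat C, modfun (rep_ob A (G0 M)) M).
Hypotheses (eF : forall M, faithful (e M)) (eU : forall M, full (e M)).
Variable G1 : forall M N : fsmodcat C, modfun M N -> hom1 X (G0 M) (G0 N).
Variable theta : forall (M N : fsmodcat C) (h : modfun M N),
  @iso k (mod_hom (rep_ob A (G0 M)) N) (mfun_comp (e N) (rep1 A (G1 h)))
    (mfun_comp h (e M)).

(** A copy of [fmap (e M)] whose source is written as a hom category of [X], so that the coherence
    laws of [X] can be rewritten inside it. *)
Definition em (M : fsmodcat C) (m m' : hom1 X A (G0 M))
  (f : hom (hom1 X A (G0 M)) m m') : hom M (e M m) (e M m') := fmap (e M) f.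

Lemma emM (M : fsmodcat C) (m m' m'' : hom1 X A (G0 M))
    (g : hom (hom1 X A (G0 M)) m' m'') (f : hom (hom1 X A (G0 M)) m m') :
  em (g • f) = em g • em f.
Proof. exact: (fmap_comp (e M)). Qed.

Lemma em1 (M : fsmodcat C) (m : hom1 X A (G0 M)) : em (idm m) = idm (e M m).
Proof. exact: (fmap_id (e M)). Qed.

Lemma em_ext (M : fsmodcat C) (B : X) (g g' : hom1 X B (G0 M))
    (a b : hom (hom1 X B (G0 M)) g g') :
  (forall m : hom1 X A B, em (a ∗ idm m) = em (b ∗ idm m)) -> a = b.
Proof. exact: (whisker_inj (@eF M)). Qed.

Section Theta.

Variables (M N : fsmodcat C) (h : modfun M N).

Definition th (m : hom1 X A (G0 M)) : iso (e N (G1 h ∘ m)) (h (e M m)) :=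
  iso_at (theta h) m.

Lemma th_nat (m m' : hom1 X A (G0 M)) (f : hom (hom1 X A (G0 M)) m m') :
  th m' • em (idm (G1 h) ∗ f)
  = fmap h (em f) • th m.
Proof. exact: (mnat_nat (fwd (theta h) : modnat _ _) f). Qed.

End Theta.

Section G2.

Variables (M N : fsmodcat C).

Lemma G2_exists (h h' : modfun M N) (a : modnat h h') :
  exists b : hom (hom1 X (G0 M) (G0 N)) (G1 h) (G1 h'), forall m : hom1 X A (G0 M),
    th h' m • em (b ∗ idm m)
    = a (e M m) • th h m.
Proof.
pose t := (theta h')⁻ • mnat_hcomp a (mnat_id (e M)) • theta h.
have [b bE] := lift_exists (@eF N) (@eU N) t.
exists b => m; rewrite [em _]bE /t /= fmap_id compm1.
by rewrite -!compA (bwdKl (th h' m)).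
Qed.

Definition G2 (h h' : modfun M N) (a : modnat h h') := sval (cid (G2_exists a)).

Lemma G2E (h h' : modfun M N) (a : modnat h h') (m : hom1 X A (G0 M)) :
  th h' m • em (G2 a ∗ idm m)
  = a (e M m) • th h m.
Proof. by rewrite /G2; case: cid. Qed.

Lemma G2_lin (h h' : modfun M N) :
  linear (fun a : hom (mod_hom M N) h h' => G2 a).
Proof.
move=> c a b; apply: em_ext => m; apply: (iso_monic (f := th h' m)).
rewrite G2E mnat_linE comp_linl -!G2E bmap_linl /em fmap_lin comp_linr.
by [].
Qed.

Lemma G2_id (h : modfun M N) : G2 (mnat_id h) = idm (G1 h).
Proof.
apply: em_ext => m; apply: (iso_monic (f := th h m)).
by rewrite G2E /= comp1m bmap_id em1 compm1.
Qed.

Lemma G2_comp (h h' h'' : modfun M N) (b : modnat h' h'') (a : modnat h h') :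
  G2 (mnat_comp b a) = G2 b • G2 a.
Proof.
apply: em_ext => m; apply: (iso_monic (f := th h'' m)).
rewrite G2E /= bmap_compl emM compA G2E -!compA G2E.
by [].
Qed.

Definition G_hom : lfunctor (mod_hom M N) (hom1 X (G0 M) (G0 N)) :=
  @LFunctor k (mod_hom M N) (hom1 X (G0 M) (G0 N)) (@G1 M N) G2 G2_lin G2_id G2_comp.

End G2.

Section Gcmp.

Variables (M N P : fsmodcat C) (g : modfun N P) (f : modfun M N).

Lemma G_cmp_exists : exists a : iso (G1 g ∘ G1 f) (G1 (mfun_comp g f)),
  forall m : hom1 X A (G0 M),
    th (mfun_comp g f) m
      • em (a ∗ idm m)
    = fmap g (th f m) • th g (G1 f ∘ m)
      • em (asc (G1 g) (G1 f) m).
Proof.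
pose t := iso_trans (iso_sym (theta (mfun_comp g f)))
  (iso_trans (iso_sym (mod_asc g f (e M)))
  (iso_trans (iso_bmap (mod_comp _ _ _) (iso_refl (g : mod_hom _ _)) (theta f))
  (iso_trans (mod_asc g (e N) (rep1 A (G1 f)))
  (iso_trans (iso_bmap (mod_comp _ _ _) (theta g) (iso_refl (rep1 A (G1 f) : mod_hom _ _)))
  (iso_trans (iso_sym (mod_asc (e P) (rep1 A (G1 g)) (rep1 A (G1 f))))
  (iso_bmap (mod_comp _ _ _) (iso_refl (e P : mod_hom _ _)) (iso_sym (rep_cmp A (G1 g) (G1 f))))))))).
have [a aE] := lift_iso_exists (@eF P) (@eU P) t.
exists a => m; rewrite [em _]aE /= !comp1m ?fmap_id ?compm1 ?comp1m.
by rewrite (bwdKl (th (mfun_comp g f) m)) !compA bmap_id fmap_id compm1.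
Qed.

Definition G_cmp := sval (cid G_cmp_exists).

Lemma G_cmpE (m : hom1 X A (G0 M)) :
  th (mfun_comp g f) m
    • em (G_cmp ∗ idm m)
  = fmap g (th f m) • th g (G1 f ∘ m)
    • em (asc (G1 g) (G1 f) m).
Proof. by rewrite /G_cmp; case: cid. Qed.

End Gcmp.

Section Gidn.

Variable M : fsmodcat C.

Lemma G_idn_exists : exists a : iso (id1 (G0 M)) (G1 (mfun_id M)),
  forall m : hom1 X A (G0 M),
    th (mfun_id M) m
      • em (a ∗ idm m)
    = em (lun m).
Proof.
pose t := iso_trans (iso_sym (theta (mfun_id M)))
  (iso_trans (iso_sym (mod_lun (e M)))
  (iso_trans (mod_run (e M))
  (iso_bmap (mod_comp _ _ _) (iso_refl (e M : mod_hom _ _)) (iso_sym (rep_idn A (G0 M)))))).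
have [a aE] := lift_iso_exists (@eF M) (@eU M) t.
exists a => m; rewrite [em _]aE /= !comp1m.
by rewrite (bwdKl (th (mfun_id M) m)).
Qed.

Definition G_idn := sval (cid G_idn_exists).

Lemma G_idnE (m : hom1 X A (G0 M)) :
  th (mfun_id M) m
    • em (G_idn ∗ idm m)
  = em (lun m).
Proof. by rewrite /G_idn; case: cid. Qed.

End Gidn.

Lemma th_G2 (M N : fsmodcat C) (h h' : modfun M N) (a : modnat h h')
    (m m' : hom1 X A (G0 M)) (f : hom (hom1 X A (G0 M)) m m') :
  th h' m' • em (G2 a ∗ f) = a (e M m') • fmap h (em f) • th h m.
Proof. by rewrite bmap_lr emM compA G2E -!compA th_nat. Qed.

Lemma G_nat (M N P : fsmodcat C) (g g' : modfun N P) (f f' : modfun M N)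
    (b : modnat g g') (a : modnat f f') :
  G2 (mnat_hcomp b a) • G_cmp g f = G_cmp g' f' • (G2 b ∗ G2 a).
Proof.
apply: em_ext => m; apply: (iso_monic (f := th (mfun_comp g' f') m)).
rewrite !bmap_compl !emM compA G2E -compA G_cmpE [RHS]compA G_cmpE.
rewrite -(compA _ (em (asc _ _ _)) (em (_ ∗ _))) -emM asc_nat emM [in RHS]compA.
rewrite -[in RHS](compA _ (fwd (th g' _))) th_G2 /= !compA; congr (_ • _ • _).
rewrite -[in RHS](mnat_nat b) -!compA; congr (_ • _).
by rewrite -!fmap_comp G2E.
Qed.

Lemma G_asc (M N P Q : fsmodcat C) (h : modfun P Q) (g : modfun N P)
    (f : modfun M N) :
  G2 (mod_asc_fwd h g f) • G_cmp (mfun_comp h g) f • (G_cmp h g ∗ idm (G1 f))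
  = G_cmp h (mfun_comp g f) • (idm (G1 h) ∗ G_cmp g f) • asc (G1 h) (G1 g) (G1 f).
Proof.
apply: em_ext => m.
apply: (iso_monic (f := th (mfun_comp h (mfun_comp g f)) m)).
rewrite !bmap_compl !emM !compA G2E comp1m !G_cmpE.
rewrite -(compA _ _ (em ((G_cmp h g ∗ _) ∗ _))) -emM asc_natl emM.
rewrite compA -(compA _ _ (em (G_cmp h g ∗ _))) G_cmpE !compA.
rewrite -[in RHS](compA _ _ (em ((_ ∗ G_cmp g f) ∗ _))) -[in RHS]emM asc_natm emM.
rewrite [in RHS]compA -[in RHS](compA _ _ (em (_ ∗ (G_cmp g f ∗ _)))) th_nat.
rewrite !compA -[in RHS]fmap_comp G_cmpE !fmap_comp.
rewrite -[in RHS](compA _ _ (fwd (th h _))) -th_nat -!compA -!emM.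
by rewrite pentagon -!compA.
Qed.

Lemma G_lun (M N : fsmodcat C) (f : modfun M N) :
  G2 (mod_lun_fwd f) • G_cmp (mfun_id N) f • (G_idn N ∗ idm (G1 f)) = lun (G1 f).
Proof.
apply: em_ext => m; apply: (iso_monic (f := th f m)).
rewrite !bmap_compl !emM !compA G2E comp1m G_cmpE.
rewrite -(compA _ _ (em ((G_idn N ∗ _) ∗ _))) -emM asc_natl emM.
rewrite compA -(compA _ _ (em (G_idn N ∗ _))) G_idnE -compA -emM.
by rewrite lun_asc.
Qed.

Lemma G_run (M N : fsmodcat C) (f : modfun M N) :
  G2 (mod_run_fwd f) • G_cmp f (mfun_id M) • (idm (G1 f) ∗ G_idn M) = run (G1 f).
Proof.
apply: em_ext => m; apply: (iso_monic (f := th f m)).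
rewrite !bmap_compl !emM !compA G2E comp1m G_cmpE.
rewrite -(compA _ _ (em ((_ ∗ G_idn M) ∗ _))) -emM asc_natm emM.
rewrite compA -(compA _ _ (em (_ ∗ (G_idn M ∗ _)))) th_nat !compA -fmap_comp G_idnE.
by rewrite -th_nat -compA -emM triangle.
Qed.

Definition quasi_inverse : lin2functor (Mod C) X :=
  @Lin2Functor k (Mod C) X G0 (fun M N => G_hom M N)
    (fun M N P g f => G_cmp g f) (fun M => G_idn M)
    (fun M N P => @G_nat M N P) (fun M N P Q => @G_asc M N P Q)
    (fun M N => @G_lun M N) (fun M N => @G_run M N).

Hypothesis lfs : locally_finite_semisimple X.

Notation F := (rep A lfs).
Notation FG := (lin2functor_comp F quasi_inverse).
Notation GF := (lin2functor_comp quasi_inverse F).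

Definition counit_sq (M N : fsmodcat C) (f : modfun M N) :
    @iso k (hom1 (Mod C) (FG M) N) (mfun_comp f (e M)) (mfun_comp (e N) (rep1 A (G1 f))) :=
  iso_sym (theta f).

Lemma counit_nat (M N : fsmodcat C) (f f' : hom1 (Mod C) M N) (a : hom (hom1 (Mod C) M N) f f') :
  (idm (e N : hom1 (Mod C) (FG N) N) ∗ fmap (fhom FG) a) • counit_sq f
  = counit_sq f' • (a ∗ idm (e M : hom1 (Mod C) (FG M) M)).
Proof.
apply: modnat_eq => m; rewrite /= comp1m fmap_id compm1.
apply: (iso_monic (f := th f' m)); rewrite (bwdKl (th f' m)) compA.
by rewrite G2E (bwdKr (th f m)).
Qed.

Lemma counit_id (M : Mod C) :
  counit_sq (mfun_id M) • (fidn (lin2functor_id (Mod C)) M ∗ idm (e M : hom1 (Mod C) (FG M) M))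
  = (idm (e M : hom1 (Mod C) (FG M) M) ∗ fidn FG M)
    • (run (e M : hom1 (Mod C) (FG M) M))⁻ • lun (e M : hom1 (Mod C) (FG M) M).
Proof.
apply: modnat_eq => m; rewrite /= !comp1m !compm1.
apply: (iso_monic (f := th (mfun_id M) m)); rewrite (bwdK (th (mfun_id M) m)).
rewrite -/(em _) emM compA G_idnE -emM.
by rewrite bwdK em1.
Qed.

Lemma counit_comp (M N P : fsmodcat C) (g : hom1 (Mod C) N P) (f : hom1 (Mod C) M N) :
  counit_sq (g ∘ f) • (fcmp (lin2functor_id (Mod C)) g f ∗ idm (e M : hom1 (Mod C) (FG M) M))
  = (idm (e P : hom1 (Mod C) (FG P) P) ∗ fcmp FG g f)
    • asc (e P : hom1 (Mod C) (FG P) P) (fhom FG g) (fhom FG f)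
    • (counit_sq g ∗ idm (fhom FG f))
    • (asc g (e N : hom1 (Mod C) (FG N) N) (fhom FG f))⁻
    • (idm g ∗ counit_sq f) • asc g f (e M : hom1 (Mod C) (FG M) M).
Proof.
apply: modnat_eq => m; rewrite /= !comp1m !compm1 ?fmap_id ?bmap_id ?fmap_id ?compm1.
apply: (iso_monic (f := th (mfun_comp g f) m)); rewrite (bwdK (th (mfun_comp g f) m)).
rewrite -/(em _) emM !compA G_cmpE -!compA (compA (em _)) -emM.
rewrite bwdK em1 comp1m (bwdKl (th g (G1 f ∘ m))) -fmap_comp.
by rewrite (bwdK (th f m)) fmap_id.
Qed.

Definition counit : pseudonat FG (lin2functor_id (Mod C)) :=
  @PseudoNat k (Mod C) (Mod C) FG (lin2functor_id (Mod C)) (fun M => e M)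
    (fun M N f => counit_sq f) counit_nat counit_id counit_comp.

Variable t : forall B : X, hom1 X B (G0 (rep_fs A lfs B)).
Variable beta : forall B : X, @iso k (mod_hom (rep_ob A B) (rep_ob A B))
  (mfun_comp (e (rep_fs A lfs B)) (rep1 A (t B))) (mfun_id (rep_ob A B)).

Notation rep1' f := (rep1 A f : modfun (rep_fs A lfs _) (rep_fs A lfs _)).

(* [hom1 X A B] and [rep_ob A B] are convertible, but rewriting needs the
   statements to mention the former. *)
Definition eb (B : X) (m m' : hom1 X A (G0 (rep_fs A lfs B)))
    (f : hom (hom1 X A (G0 (rep_fs A lfs B))) m m') :
  hom (hom1 X A B) (e (rep_fs A lfs B) m) (e (rep_fs A lfs B) m') := em f.

Lemma ebM (B : X) (m m' m'' : hom1 X A (G0 (rep_fs A lfs B)))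
    (g : hom (hom1 X A (G0 (rep_fs A lfs B))) m' m'')
    (f : hom (hom1 X A (G0 (rep_fs A lfs B))) m m') :
  eb (g • f) = eb g • eb f.
Proof. exact: (emM (M := rep_fs A lfs B)). Qed.

Lemma eb1 (B : X) (m : hom1 X A (G0 (rep_fs A lfs B))) :
  eb (idm m) = idm (e (rep_fs A lfs B) m : hom1 X A B).
Proof. exact: (em1 (M := rep_fs A lfs B)). Qed.

Lemma eb_ext (B B' : X) (g g' : hom1 X B (G0 (rep_fs A lfs B')))
    (a b : hom (hom1 X B (G0 (rep_fs A lfs B'))) g g') :
  (forall m : hom1 X A B, eb (a ∗ idm m) = eb (b ∗ idm m)) -> a = b.
Proof. exact: (em_ext (M := rep_fs A lfs B')). Qed.

Definition thb (B B' : X) (f : hom1 X B B') (m : hom1 X A (G0 (rep_fs A lfs B))) :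
    @iso k (hom1 X A B') (e (rep_fs A lfs B') (G1 (rep1' f) ∘ m))
      (f ∘ (e (rep_fs A lfs B) m : hom1 X A B)) :=
  th (rep1' f) m.

Lemma thb_nat (B B' : X) (f : hom1 X B B') (m m' : hom1 X A (G0 (rep_fs A lfs B)))
    (h : hom (hom1 X A (G0 (rep_fs A lfs B))) m m') :
  thb f m' • eb (idm (G1 (rep1' f)) ∗ h) = (idm f ∗ eb h) • thb f m.
Proof. exact: (th_nat (rep1' f) h). Qed.

Lemma thb_rep2 (B B' : X) (f f' : hom1 X B B') (a : hom (hom1 X B B') f f')
    (m : hom1 X A (G0 (rep_fs A lfs B))) :
  thb f' m • eb (@G2 (rep_fs A lfs B) (rep_fs A lfs B') _ _ (rep2 A a) ∗ idm m)
  = (a ∗ idm (e (rep_fs A lfs B) m : hom1 X A B)) • thb f m.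
Proof. exact: (@G2E (rep_fs A lfs B) (rep_fs A lfs B') _ _ (rep2 A a)). Qed.

(** The unit constraint of the composite 2-functor, named so that a proof can forget its
    construction and keep only [thb_idn]. The same holds for [cmpb] and [thb_cmp]. *)
Definition idnb (B : X) := @G2 (rep_fs A lfs B) (rep_fs A lfs B) (mfun_id _)
  (rep1' (id1 B)) (rep_idn_fwd A B) • G_idn (rep_fs A lfs B).

Lemma thb_idn (B : X) (m : hom1 X A (G0 (rep_fs A lfs B))) :
  thb (id1 B) m • eb (idnb B ∗ idm m)
  = (lun (e (rep_fs A lfs B) m : hom1 X A B))⁻ • eb (lun m).
Proof.
rewrite /idnb bmap_compl ebM compA.
have := @G2E (rep_fs A lfs B) (rep_fs A lfs B) _ (rep1' (id1 B)) (rep_idn_fwd A B) m.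
rewrite -[th _ m]/(thb (id1 B) m) => E; rewrite [X in X • _]E.
by rewrite -compA; congr (_ • _); exact: (@G_idnE (rep_fs A lfs B)).
Qed.

Definition cmpb (B B' B'' : X) (g : hom1 X B' B'') (f : hom1 X B B') :=
  @G2 (rep_fs A lfs B) (rep_fs A lfs B'') (mfun_comp (rep1' g) (rep1' f))
    (rep1' (g ∘ f)) (rep_cmp_fwd A g f)
  • @G_cmp (rep_fs A lfs B) (rep_fs A lfs B') (rep_fs A lfs B'') (rep1' g) (rep1' f).

Lemma thb_cmp (B B' B'' : X) (g : hom1 X B' B'') (f : hom1 X B B')
    (m : hom1 X A (G0 (rep_fs A lfs B))) :
  thb (g ∘ f) m • eb (cmpb g f ∗ idm m)
  = (asc g f (e (rep_fs A lfs B) m))⁻ • (idm g ∗ thb f m)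
    • thb g (G1 (rep1' f) ∘ m) • eb (asc (G1 (rep1' g)) (G1 (rep1' f)) m).
Proof.
rewrite /cmpb bmap_compl ebM compA.
have := @G2E (rep_fs A lfs B) (rep_fs A lfs B'') _ (rep1' (g ∘ f)) (rep_cmp_fwd A g f) m.
rewrite -[th _ m]/(thb (g ∘ f) m) => E; rewrite [X in X • _]E.
rewrite -!compA; congr (_ • _); rewrite compA.
exact: (@G_cmpE (rep_fs A lfs B) (rep_fs A lfs B') (rep_fs A lfs B'') (rep1' g) (rep1' f)).
Qed.

Definition be (B : X) (m : hom1 X A B) :
    @iso k (hom1 X A B) (e (rep_fs A lfs B) (t B ∘ m)) m :=
  iso_at (beta B) m.

Lemma be_nat (B : X) (m m' : hom1 X A B) (f : hom (hom1 X A B) m m') :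
  be m' • eb (idm (t B) ∗ f) = f • be m.
Proof. exact: (mnat_nat (fwd (beta B) : modnat _ _) f). Qed.

Section UnitSquare.

Variables (B B' : X) (f : hom1 X B B').

(** After [e] is applied, [beta] cancels [e] against [t] on either side and [theta] moves [e] past
    [f]. The square is the preimage of the resulting isomorphism. *)
Lemma unit_sq_exists : exists a : iso (G1 (rep1' f) ∘ t B) (t B' ∘ f),
  forall m : hom1 X A B,
    be (f ∘ m) • eb (asc (t B') f m) • eb (a ∗ idm m)
    = (idm f ∗ be m) • thb f (t B ∘ m) • eb (asc (G1 (rep1' f)) (t B) m).
Proof.
pose f' : modfun (rep_fs A lfs B) (rep_fs A lfs B') := rep1 A f.
pose eB := e (rep_fs A lfs B); pose eB' := e (rep_fs A lfs B').
pose s1 := iso_trans (iso_bmap (mod_comp _ _ _) (iso_refl (f' : mod_hom _ _)) (beta B))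
  (iso_trans (mod_asc f' eB (rep1 A (t B)))
  (iso_trans (iso_bmap (mod_comp _ _ _) (theta f') (iso_refl (rep1 A (t B) : mod_hom _ _)))
  (iso_trans (iso_sym (mod_asc eB' (rep1 A (G1 f')) (rep1 A (t B))))
  (iso_bmap (mod_comp _ _ _) (iso_refl (eB' : mod_hom _ _)) (iso_sym (rep_cmp A (G1 f') (t B))))))).
pose s2 := iso_trans (iso_bmap (mod_comp _ _ _) (beta B') (iso_refl (f' : mod_hom _ _)))
  (iso_trans (iso_sym (mod_asc eB' (rep1 A (t B')) (rep1 A f)))
  (iso_bmap (mod_comp _ _ _) (iso_refl (eB' : mod_hom _ _)) (iso_sym (rep_cmp A (t B') f)))).
pose s := iso_trans (iso_sym s2) (iso_trans (iso_sym (mod_lun f')) (iso_trans (mod_run f') s1)).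
have [a aE] := lift_iso_exists (@eF (rep_fs A lfs B')) (@eU (rep_fs A lfs B')) s.
exists a => m; rewrite [eb (a ∗ idm m)]aE /= !comp1m ?bmap_id ?fmap_id ?compm1 ?comp1m.
rewrite /eb /em /eB' /f' -!compA (compA (fmap _ _) (fmap _ _)) -fmap_comp.
by rewrite bwdK fmap_id comp1m (bwdKl (be (f ∘ m))).
Qed.

Definition unit_sq := sval (cid unit_sq_exists).

Lemma unit_sqE (m : hom1 X A B) :
  be (f ∘ m) • eb (asc (t B') f m) • eb (unit_sq ∗ idm m)
  = (idm f ∗ be m) • thb f (t B ∘ m) • eb (asc (G1 (rep1' f)) (t B) m).
Proof. by rewrite /unit_sq; case: cid. Qed.

Lemma be_asc_inj (m : hom1 X A B) y
    (a b : hom (hom1 X A B') y (e (rep_fs A lfs B') ((t B' ∘ f) ∘ m))) :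
  be (f ∘ m) • eb (asc (t B') f m) • a = be (f ∘ m) • eb (asc (t B') f m) • b ->
  a = b.
Proof.
rewrite -!compA => /iso_monic E.
have eb_asc : eb (asc (t B') f m)⁻ • eb (asc (t B') f m) = idm _.
  by rewrite -ebM fwdK eb1.
by rewrite -(comp1m a) -(comp1m b) -eb_asc -!compA E.
Qed.

End UnitSquare.

Lemma unit_nat (B B' : X) (f f' : hom1 X B B') (a : hom (hom1 X B B') f f') :
  (idm (t B') ∗ a) • unit_sq f
  = unit_sq f' • (@G2 (rep_fs A lfs B) (rep_fs A lfs B') (rep1' f) (rep1' f') (rep2 A a) ∗ idm (t B)).
Proof.
apply: eb_ext => m; apply: be_asc_inj.
rewrite !bmap_compl !ebM !compA unit_sqE.
rewrite -(compA _ _ (eb ((_ ∗ a) ∗ _))) -ebM asc_natm ebM compA be_nat.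
rewrite -2!(compA (a ∗ _)) unit_sqE.
rewrite -[in RHS](compA _ _ (eb ((G2 _ ∗ _) ∗ _))) -[in RHS]ebM asc_natl ebM.
rewrite [in RHS]compA -[in RHS](compA _ _ (eb (G2 _ ∗ _))) thb_rep2 !compA.
by rewrite bmap_interchange.
Qed.

Lemma unit_id (B : X) :
  unit_sq (id1 B) • (idnb B ∗ idm (t B))
  = (idm (t B) ∗ idm (id1 B)) • (run (t B))⁻ • lun (t B).
Proof.
move: (idnb B) (@thb_idn B) => w wE; apply: eb_ext => m; apply: be_asc_inj.
rewrite bmap_id comp1m !bmap_compl !ebM !compA unit_sqE.
have -> : eb (asc (t B) (id1 B) m) = eb (idm (t B) ∗ (lun m)⁻) • eb (run (t B) ∗ idm m).
  rewrite -ebM -triangle compA -bmap_compr fwdK bmap_id comp1m.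
  by [].
rewrite [in RHS]compA be_nat -[in RHS](compA _ _ (eb ((run _)⁻ ∗ _))) -[in RHS]ebM -bmap_compl bwdK bmap_id eb1 compm1.
rewrite -(compA _ _ (eb ((w ∗ _) ∗ _))) -ebM asc_natl ebM.
rewrite compA -(compA _ _ (eb (w ∗ _))) wE.
rewrite !compA -(compA _ (eb _)) -ebM lun_asc /=; congr (_ • _).
apply: (iso_monic (f := lun m)); rewrite compA lun_nat bwdKr.
by rewrite bwdKl.
Qed.

(** Images under [e] are compared, where both sides are expressed by [thb] and [be]. The equations
    [e1] to [e6] are coherence and naturality in [X], carried over by [eb]. *)
Lemma unit_comp (B B' B'' : X) (g : hom1 X B' B'') (f : hom1 X B B') :
  unit_sq (g ∘ f) • (cmpb g f ∗ idm (t B))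
  = asc (t B'') g f • (unit_sq g ∗ idm f)
    • (asc (G1 (rep1' g)) (t B') f)⁻
    • (idm (G1 (rep1' g)) ∗ unit_sq f) • asc (G1 (rep1' g)) (G1 (rep1' f)) (t B).
Proof.
move: (cmpb g f) (thb_cmp g f) => w wE; apply: eb_ext => m; apply: be_asc_inj.
rewrite !bmap_compl !ebM !compA unit_sqE.
rewrite -(compA _ _ (eb ((w ∗ _) ∗ _))) -ebM asc_natl ebM.
rewrite compA -(compA _ _ (eb (w ∗ _))) wE.
have pre : (idm (g ∘ f) ∗ be m) • (asc g f (e (rep_fs A lfs B) (t B ∘ m)))⁻
    = (asc g f m)⁻ • (idm g ∗ (idm f ∗ be m)).
  apply: (iso_monic (f := asc g f m)); rewrite bwdKl compA asc_natr.
  by rewrite bwdKr.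
have e1 : eb (asc (t B'') (g ∘ f) m) • eb (asc (t B'') g f ∗ idm m)
    = eb (idm (t B'') ∗ (asc g f m)⁻) • eb (asc (t B'') g (f ∘ m))
      • eb (asc (t B'' ∘ g) f m).
  rewrite -!ebM -compA pentagon !compA -bmap_compr fwdK bmap_id comp1m.
  by [].
have e2 : eb (asc (G1 (rep1' g) ∘ t B') f m) • eb ((asc (G1 (rep1' g)) (t B') f)⁻ ∗ idm m)
    = eb (asc (G1 (rep1' g)) (t B') (f ∘ m))⁻ • eb (idm (G1 (rep1' g)) ∗ asc (t B') f m)
      • eb (asc (G1 (rep1' g)) (t B' ∘ f) m).
  rewrite -!ebM; congr eb; apply: (iso_monic (f := asc (G1 (rep1' g)) (t B') (f ∘ m))).
  rewrite !compA pentagon bwdK comp1m -!compA -bmap_compl bwdK bmap_id.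
  by rewrite compm1.
have e3 : eb (idm (G1 (rep1' g)) ∗ asc (G1 (rep1' f)) (t B) m)
      • eb (asc (G1 (rep1' g)) (G1 (rep1' f) ∘ t B) m)
      • eb (asc (G1 (rep1' g)) (G1 (rep1' f)) (t B) ∗ idm m)
    = eb (asc (G1 (rep1' g)) (G1 (rep1' f)) (t B ∘ m)) • eb (asc (G1 (rep1' g) ∘ G1 (rep1' f)) (t B) m).
  by rewrite -!ebM pentagon.
have e4 : eb (asc (t B'' ∘ g) f m) • eb (unit_sq g ∗ idm f ∗ idm m)
   = eb (unit_sq g ∗ idm (f ∘ m)) • eb (asc (G1 (rep1' g) ∘ t B') f m).
  by rewrite -!ebM asc_natl.
have e5 : eb (asc (G1 (rep1' g)) (t B' ∘ f) m) • eb (idm (G1 (rep1' g)) ∗ unit_sq f ∗ idm m)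
  = eb (idm (G1 (rep1' g)) ∗ (unit_sq f ∗ idm m)) • eb (asc (G1 (rep1' g)) (G1 (rep1' f) ∘ t B) m).
  by rewrite -!ebM asc_natm.
have e6 : eb (asc (G1 (rep1' g)) (t B') (f ∘ m)) • eb (asc (G1 (rep1' g)) (t B') (f ∘ m))⁻ = idm _.
  by rewrite -ebM bwdK eb1.
rewrite -[in RHS](compA _ (eb (asc _ (g ∘ f) m))) e1 !compA be_nat.
rewrite -[in RHS](compA _ (eb (asc (t B'' ∘ g) f m))) e4.
rewrite !compA -2![in RHS](compA (asc g f m)⁻) unit_sqE !compA.
rewrite -[in RHS](compA _ (eb (asc (G1 (rep1' g) ∘ t B') f m))) e2 !compA.
rewrite -[in RHS](compA _ _ (eb (asc (G1 (rep1' g)) (t B') (f ∘ m))⁻)) e6 compm1.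
rewrite -[in RHS](compA _ (eb (asc (G1 (rep1' g)) (t B' ∘ f) m))) e5 !compA.
rewrite -[in RHS](compA _ _ (eb (_ ∗ asc (t B') f m))) thb_nat !compA.
rewrite -[in RHS](compA _ _ (eb (_ ∗ (unit_sq f ∗ _)))) thb_nat !compA.
rewrite -2![in RHS](compA (asc g f m)⁻) -!bmap_compr unit_sqE !bmap_compr !compA.
rewrite -[in RHS](compA _ _ (fwd (thb g _))) -thb_nat !compA -pre.
rewrite -!compA; congr (_ • (_ • (_ • (_ • _)))); rewrite !compA.
by rewrite e3.
Qed.

Lemma unit_comp' (B B' B'' : X) (g : hom1 X B' B'') (f : hom1 X B B') :
  unit_sq (g ∘ f) • (cmpb g f ∗ idm (t B))
  = (idm (t B'') ∗ idm (g ∘ f)) • asc (t B'') g f • (unit_sq g ∗ idm f)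
    • (asc (G1 (rep1' g)) (t B') f)⁻
    • (idm (G1 (rep1' g)) ∗ unit_sq f) • asc (G1 (rep1' g)) (G1 (rep1' f)) (t B).
Proof. by rewrite bmap_id comp1m unit_comp. Qed.

Definition unit_pseudonat : pseudonat (lin2functor_id X) GF :=
  @PseudoNat k X X (lin2functor_id X) GF t (fun B B' f => unit_sq f)
    unit_nat unit_id unit_comp'.

End Whitehead.

Section IsomorphicCells.

Variables (k : fieldType) (X : lin2cat k).

Lemma isomorphic_refl (A B : X) (f : hom1 X A B) : isomorphic f f.
Proof. by split; exact: iso_refl. Qed.

Lemma isomorphic_comp1 (A B C : X) (g g' : hom1 X B C) (f f' : hom1 X A B) :
  isomorphic g g' -> isomorphic f f' -> isomorphic (g ∘ f) (g' ∘ f').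
Proof. by case=> a [b]; split; exact: iso_bmap. Qed.

Lemma isomorphic_asc (A B C D : X) (h : hom1 X C D) (g : hom1 X B C)
    (f : hom1 X A B) : isomorphic ((h ∘ g) ∘ f) (h ∘ (g ∘ f)).
Proof. by split; exact: asc. Qed.

Lemma isomorphic_lun (A B : X) (f : hom1 X A B) : isomorphic (id1 B ∘ f) f.
Proof. by split; exact: lun. Qed.

Lemma isomorphic_cancel (A B C : X) (g : hom1 X B C) (g' : hom1 X C B)
    (f : hom1 X A B) :
  isomorphic (g' ∘ g) (id1 B) -> isomorphic (g' ∘ (g ∘ f)) f.
Proof.
move=> gg; apply: isomorphic_trans (isomorphic_sym (isomorphic_asc g' g f)) _.
apply: isomorphic_trans (isomorphic_comp1 gg (isomorphic_refl f)) _.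
exact: isomorphic_lun.
Qed.

End IsomorphicCells.

Theorem rep_equivalent (k : fieldType) (X : lin2cat k) (A : X)
    (domA : forall B, dominated A B) (lfs : locally_finite_semisimple X)
    (ess : forall M : fsmodcat (end_monoidal A), exists (B : X)
      (e : modfun (rep_ob A B) M),
      @equivalence1 k (Mod (end_monoidal A)) (rep_fs A lfs B) M e) :
  equivalent2 X (Mod (end_monoidal A)).
Proof.
pose Y := Mod (end_monoidal A); pose F := rep A lfs.
have ic B B' : idem_complete_cat (hom1 X B B') by have [[]] := lfs B B'.
pose G0 M := sval (cid (ess M)).
pose e M : modfun (rep_ob A (G0 M)) M := sval (cid (svalP (cid (ess M)))).
have eP M : @equivalence1 k Y (F (G0 M)) M (e M) := svalP (cid (svalP (cid (ess M)))).
have eF M : faithful (e M) by exact: (@mod_equiv_faithful _ _ (F (G0 M)) M _ (eP M)).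
have eU M : full (e M) by exact: (@mod_equiv_full _ _ (F (G0 M)) M _ (eP M)).
(* Conjugate [h] by [e M] and a quasi-inverse of [e N]. Local essential surjectivity replaces the
   conjugate by a 1-cell of [X]. *)
have G1P (M N : Y) (h : modfun (M : fsmodcat _) (N : fsmodcat _)) : exists g : hom1 X (G0 M) (G0 N),
    @isomorphic k (hom1 Y (F (G0 M)) N) (mfun_comp (e N) (rep1 A g)) (mfun_comp h (e M)).
  have [e' [e'e ee']] := eP N.
  pose u : hom1 Y (F (G0 M)) (F (G0 N)) := e' ∘ ((h : hom1 Y M N) ∘ (e M : hom1 Y (F (G0 M)) M)).
  have [g gu] := rep_surj domA lfs (ic (G0 M) (G0 N)) u.
  exists g; exact: (isomorphic_trans (@isomorphic_comp1 k Y (F (G0 M)) (F (G0 N)) N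
    (e N) (e N) (rep1 A g) u (isomorphic_refl (X := Y) _) gu) (isomorphic_cancel _ ee')).
pose G1 M N h := sval (cid (G1P M N h)).
have theta M N (h : modfun (M : fsmodcat _) (N : fsmodcat _)) :
    @iso k (mod_hom (rep_ob A (G0 M)) N) (mfun_comp (e N) (rep1 A (G1 _ _ h))) (mfun_comp h (e M)).
  have := svalP (cid (G1P M N h)); rewrite -/(G1 _ _ h) => i.
  by have /cid[] : exists f : @iso k (mod_hom (rep_ob A (G0 M)) N) (mfun_comp (e N) (rep1 A (G1 _ _ h))) (mfun_comp h (e M)), True by case: i => f; exists f.
have tP B : exists t : hom1 X B (G0 (F B)),
    @isomorphic k (hom1 Y (F B) (F B)) (mfun_comp (e (F B)) (rep1 A t)) (mfun_id (rep_ob A B)).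
  have [e' [e'e ee']] := eP (F B).
  have [t te] := rep_surj domA lfs (ic B (G0 (F B))) e'.
  exists t; exact: (isomorphic_trans (@isomorphic_comp1 k Y (F B) (F (G0 (F B))) (F B)
    (e (F B)) (e (F B)) (rep1 A t) e' (isomorphic_refl (X := Y) _) te) ee').
pose t B := sval (cid (tP B)).
have tE B : @isomorphic k (hom1 Y (F B) (F B)) (mfun_comp (e (F B)) (rep1 A (t B))) (mfun_id (rep_ob A B)) := svalP (cid (tP B)).
have beta B : @iso k (mod_hom (rep_ob A B) (rep_ob A B)) (mfun_comp (e (F B)) (rep1 A (t B))) (mfun_id (rep_ob A B)).
  by have /cid[] : exists f : @iso k (mod_hom (rep_ob A B) (rep_ob A B)) (mfun_comp (e (F B)) (rep1 A (t B))) (mfun_id (rep_ob A B)), True by case: (tE B) => f; exists f.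
exists F, (quasi_inverse domA eF eU theta); split.
  exists (unit_pseudonat domA eF eU theta beta) => B.
  pose eb : hom1 Y (F (G0 (F B))) (F B) := e (F B).
  pose tb : hom1 Y (F B) (F (G0 (F B))) := rep1 A (t B).
  have etb : isomorphic (eb ∘ tb) (id1 (F B)) := tE B.
  have [e' [e'e ee']] : @equivalence1 k Y _ _ eb := eP (F B).
  (* The inverse of [t B] is a preimage [s] of [eb]. Both composites are compared with identities in
     the target, and [rep] reflects the isomorphisms. *)
  have [s se] := rep_surj domA lfs (ic (G0 (F B)) B) eb.
  pose sb : hom1 Y (F (G0 (F B))) (F B) := rep1 A s.
  have {}se : isomorphic sb eb := se.
  have fid B' : @isomorphic k (hom1 Y (F B') (F B')) (id1 (F B')) (rep1 A (id1 B')).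
    by split; exact: (fidn F B').
  have tbe : isomorphic (tb ∘ eb) (id1 (F (G0 (F B)))).
    apply: isomorphic_trans (isomorphic_sym (isomorphic_cancel (tb ∘ eb) e'e)) _.
    apply: isomorphic_trans (isomorphic_comp1 (isomorphic_refl e') (isomorphic_sym (isomorphic_asc eb tb eb))) _.
    apply: isomorphic_trans (isomorphic_comp1 (isomorphic_refl e') (isomorphic_comp1 etb (isomorphic_refl eb))) _.
    exact: isomorphic_trans (isomorphic_comp1 (isomorphic_refl e') (isomorphic_lun eb)) e'e.
  have st : @isomorphic k (hom1 Y (F B) (F B)) (sb ∘ tb) (rep1 A (s ∘ t B)).
    by split; exact: (fcmp F s (t B)).
  have ts : @isomorphic k (hom1 Y (F (G0 (F B))) (F (G0 (F B)))) (tb ∘ sb) (rep1 A (t B ∘ s)).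
    by split; exact: (fcmp F (t B) s).
  exists s; split; apply: (isomorphic_reflect (@rep_faithful _ _ _ domA _ _) (@rep_full _ _ _ domA _ _)).
    apply: (isomorphic_trans (isomorphic_sym st)).
    apply: (isomorphic_trans (isomorphic_comp1 se (isomorphic_refl tb))).
    exact: (isomorphic_trans etb (fid B)).
  apply: (isomorphic_trans (isomorphic_sym ts)).
  apply: (isomorphic_trans (isomorphic_comp1 (isomorphic_refl tb) se)).
  exact: (isomorphic_trans tbe (fid _)).
by exists (counit domA eF eU theta lfs) => M; exact: eP.
Qed.

(** * Separable splittings *)

Section SplittingCalculus.

Variables (k : fieldType) (Z P Q : lincat k).
Variables (i1 : lfunctor P Z) (r1 : lfunctor Z P) (i2 : lfunctor Q Z) (r2 : lfunctor Z Q).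
Variables (e1 : forall p, hom P (r1 (i1 p)) p) (f1 : forall p, hom P p (r1 (i1 p))).
Variables (e2 : forall q, hom Q (r2 (i2 q)) q) (f2 : forall q, hom Q q (r2 (i2 q))).
Hypothesis e1_nat : forall p p' (h : hom P p p'),
  e1 p' • fmap r1 (fmap i1 h) = h • e1 p.
Hypothesis f1_nat : forall p p' (h : hom P p p'),
  f1 p' • h = fmap r1 (fmap i1 h) • f1 p.
Hypothesis e2_nat : forall q q' (h : hom Q q q'),
  e2 q' • fmap r2 (fmap i2 h) = h • e2 q.
Hypothesis f2_nat : forall q q' (h : hom Q q q'),
  f2 q' • h = fmap r2 (fmap i2 h) • f2 q.
Hypotheses (ef1 : forall p, e1 p • f1 p = idm p) (ef2 : forall q, e2 q • f2 q = idm q).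
Variables (t : forall z, hom Z (i1 (r1 z)) (i2 (r2 z)))
  (s : forall z, hom Z (i2 (r2 z)) (i1 (r1 z))).
Hypothesis t_nat : forall z z' (h : hom Z z z'),
  t z' • fmap i1 (fmap r1 h) = fmap i2 (fmap r2 h) • t z.
Hypotheses (st : forall z, s z • t z = idm _) (ts : forall z, t z • s z = idm _).

Let T1 z z' (h : hom Z z z') := fmap i1 (fmap r1 h).
Let T2 z z' (h : hom Z z z') := fmap i2 (fmap r2 h).
Let m1 z := fmap i1 (e1 (r1 z)).
Let m2 z := fmap i2 (e2 (r2 z)).

Hypothesis t_mult : forall z, t z • m1 z = m2 z • t (i2 (r2 z)) • T1 (t z).

Lemma s_nat z z' (h : hom Z z z') : s z' • T2 h = T1 h • s z.
Proof.
rewrite -[LHS]compm1 -(ts z) !compA -(compA (s z')) -t_nat compA st comp1m.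
by [].
Qed.

Let T1M z z' z'' (g : hom Z z' z'') (h : hom Z z z') : T1 (g • h) = T1 g • T1 h.
Proof. by rewrite /T1 !fmap_comp. Qed.

Let T2M z z' z'' (g : hom Z z' z'') (h : hom Z z z') : T2 (g • h) = T2 g • T2 h.
Proof. by rewrite /T2 !fmap_comp. Qed.

Let T1_1 z : T1 (idm z) = idm _. Proof. by rewrite /T1 !fmap_id. Qed.
Lemma s_mult z : s z • m2 z = m1 z • T1 (s z) • s (i2 (r2 z)).
Proof.
have E : t (i2 (r2 z)) • T1 (t z) • (T1 (s z) • s (i2 (r2 z))) = idm _.
  by rewrite !compA -(compA (t _)) -T1M ts T1_1 compm1 ts.
by rewrite -[LHS]compm1 -E !compA -(compA (s z)) -(compA (s z)) -t_mult compA st comp1m.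
Qed.

Let m1_nat z z' (h : hom Z z z') : m1 z' • T1 (T1 h) = T1 h • m1 z.
Proof. by rewrite /m1 /T1 -!fmap_comp e1_nat. Qed.

Let d2 z := fmap i2 (f2 (r2 z)).

Let d2_nat z z' (h : hom Z z z') : d2 z' • T2 h = T2 (T2 h) • d2 z.
Proof. by rewrite /d2 /T2 -!fmap_comp f2_nat. Qed.

Let d2_left z : d2 z • m2 z = m2 (i2 (r2 z)) • T2 (d2 z).
Proof. by rewrite /d2 /m2 /T2 -!fmap_comp e2_nat. Qed.

Let d2_right z : d2 z • m2 z = T2 (m2 z) • d2 (i2 (r2 z)).
Proof. by rewrite /d2 /m2 /T2 -!fmap_comp f2_nat. Qed.

(* The comultiplication of the second monad, carried over to the first. *)
Variable d : forall z, hom Z (i1 (r1 z)) (i1 (r1 (i1 (r1 z)))).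
Hypothesis dE : forall z, d z = T1 (s z) • s (i2 (r2 z)) • d2 z • t z.

Let d_nat z z' (h : hom Z z z') : d z' • T1 h = T1 (T1 h) • d z.
Proof.
rewrite !dE -(compA _ (t z')) t_nat compA -(compA _ (d2 z')) d2_nat.
by rewrite !compA -(compA _ (s _)) s_nat !compA -!T1M s_nat.
Qed.

Let d_sec z : m1 z • d z = idm _.
Proof.
rewrite dE !compA -s_mult -(compA _ (m2 z)) /m2 /d2 -fmap_comp ef2.
by rewrite fmap_id compm1 st.
Qed.

Let d_left z : d z • m1 z = m1 (i1 (r1 z)) • T1 (d z).
Proof.
rewrite !dE -(compA _ (t z)) t_mult !compA -(compA _ (d2 z)) d2_left.
rewrite !compA -(compA _ (s _)) s_mult !T1M !compA m1_nat.
by rewrite -(compA _ (s _)) s_nat !compA -(compA _ (s _)) st compm1.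
Qed.

Let d_right z : d z • m1 z = T1 (m1 z) • d (i1 (r1 z)).
Proof.
rewrite !dE -(compA _ (t z)) t_mult !compA -(compA _ (d2 z)) d2_right.
rewrite !compA -(compA _ (s _)) s_nat -(compA _ (t _)) t_nat.
rewrite !compA -(compA _ (d2 _)) d2_nat !compA -(compA _ (s _)) s_nat.
rewrite !compA -!T1M; congr (T1 _ • _ • _ • _).
rewrite s_mult -(compA _ (s _)) s_nat !compA -(compA _ (T1 (s z))) -T1M st.
by rewrite T1_1 compm1.
Qed.

(** The separability idempotent of a relative tensor product: its image is the coequalizer of the
    two actions of the common monad on [r2] and on [i1 p]. [bridge'] is the same with the two
    splittings exchanged. *)
Definition bridge p : hom Q (r2 (i1 p)) (r2 (i1 p)) :=
  fmap r2 (fmap i1 (e1 p) • s (i1 p)) • f2 (r2 (i1 p)).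

Definition bridge' q : hom P (r1 (i2 q)) (r1 (i2 q)) :=
  fmap r1 (fmap i2 (e2 q) • t (i2 q)) • f1 (r1 (i2 q)).

(** Up to the change of monad, [join] applies the counit [e1] twice and [fork] its section [f1]
    twice. *)
Definition join p : hom P (r1 (i2 (r2 (i1 p)))) p :=
  e1 p • e1 (r1 (i1 p)) • fmap r1 (s (i1 p)).

Definition fork p : hom P p (r1 (i2 (r2 (i1 p)))) :=
  fmap r1 (t (i1 p)) • f1 (r1 (i1 p)) • f1 p.

Lemma join_fork p : join p • fork p = idm p.
Proof.
rewrite /join /fork !compA -(compA _ (fmap r1 (s _))) -fmap_comp st fmap_id compm1.
by rewrite -(compA _ (e1 (r1 _))) ef1 compm1 ef1.
Qed.

Let ee p : e1 p • e1 (r1 (i1 p)) = e1 p • fmap r1 (fmap i1 (e1 p)).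
Proof. by rewrite e1_nat. Qed.

Let bridge'_conj p :
  bridge' (r2 (i1 p)) • fmap r1 (t (i1 p))
  = fmap r1 (t (i1 p)) • f1 (r1 (i1 p)) • e1 (r1 (i1 p)).
Proof.
rewrite /bridge' -(compA _ (f1 _)) f1_nat compA -fmap_comp.
rewrite -[fmap i1 _]/(T1 _) -[fmap i2 _]/(m2 _) -t_mult fmap_comp -!compA.
by rewrite f1_nat.
Qed.

Lemma join_bridge' p : join p • bridge' (r2 (i1 p)) = join p.
Proof.
have tsr : fmap r1 (t (i1 p)) • fmap r1 (s (i1 p)) = idm _.
  by rewrite -fmap_comp ts fmap_id.
rewrite -[bridge' _]compm1 -tsr (compA _ _ (fmap r1 (s _))) bridge'_conj.
rewrite /join !compA -(compA _ (fmap r1 (s _))) -fmap_comp st fmap_id compm1.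
by rewrite -(compA _ (e1 (r1 _)) (f1 _)) ef1 compm1.
Qed.

Let K p := T1 (fmap i1 (e1 p)) • d (i1 p).

Let bridge_conj p :
  fmap i2 (bridge p) • t (i1 p) = t (i1 p) • K p.
Proof.
rewrite /bridge /K dE fmap_comp -[fmap i2 (fmap r2 _)]/(T2 _) -[fmap i2 (f2 _)]/(d2 _).
rewrite !compA -(compA _ (T1 (fmap _ _))) -T1M t_nat -[fmap i2 (fmap r2 _)]/(T2 _).
by rewrite -(compA _ (t _) (s _)) ts compm1.
Qed.

Let ee_K p : e1 p • e1 (r1 (i1 p)) • fmap r1 (K p) = e1 p • e1 (r1 (i1 p)).
Proof.
rewrite /K fmap_comp compA -(compA (e1 p) (e1 _)) e1_nat compA -ee.
rewrite -(compA (e1 p) (e1 _)) -e1_nat compA -(compA _ (fmap r1 _)) -fmap_comp.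
by rewrite -[fmap i1 _]/(m1 _) d_sec fmap_id compm1.
Qed.

Lemma join_bridge p : join p • fmap r1 (fmap i2 (bridge p)) = join p.
Proof.
have tsr : fmap i2 (bridge p) = t (i1 p) • (K p • s (i1 p)).
  by rewrite compA -bridge_conj -compA ts compm1.
rewrite tsr /join -(compA _ (fmap r1 _)) -fmap_comp (compA (s _)) st comp1m.
by rewrite fmap_comp compA ee_K.
Qed.

Let psi z := e1 (r1 (i1 (r1 z))) • fmap r1 (d z).

Let psi_left z : psi z • fmap r1 (m1 z) = psi z • e1 (r1 (i1 (r1 z))).
Proof.
rewrite /psi -compA -fmap_comp d_left fmap_comp compA e1_nat.
by rewrite -!compA e1_nat.
Qed.

Let psi_nat z z' (h : hom Z z z') : psi z' • fmap r1 (T1 h) = fmap r1 (T1 h) • psi z.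
Proof. by rewrite /psi -compA -fmap_comp d_nat fmap_comp compA e1_nat compA. Qed.

Let psi_right z : psi z • fmap r1 (m1 z) = fmap r1 (m1 z) • psi (i1 (r1 z)).
Proof. by rewrite /psi -compA -fmap_comp d_right fmap_comp compA e1_nat compA. Qed.

Let hh p := fmap r1 (fmap i1 (e1 p)) • psi (i1 p).

Let hh_bal p : hh p • fmap r1 (T1 (fmap i1 (e1 p))) = hh p • e1 (r1 (i1 (r1 (i1 p)))).
Proof.
have E : fmap r1 (fmap i1 (e1 p)) • fmap r1 (T1 (fmap i1 (e1 p)))
    = fmap r1 (fmap i1 (e1 p)) • fmap r1 (m1 (i1 p)).
  by rewrite /T1 /m1 -!fmap_comp -ee.
by rewrite /hh -compA psi_nat compA E -compA -psi_right psi_left compA.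
Qed.

Let hh_m1 p : hh p • fmap r1 (m1 (i1 p)) = hh p • e1 (r1 (i1 (r1 (i1 p)))).
Proof. by rewrite /hh -compA psi_left compA. Qed.

Let absorb p w (h : hom P (r1 (i1 (r1 (i1 p)))) w) :
  h • fmap r1 (T1 (fmap i1 (e1 p))) = h • e1 (r1 (i1 (r1 (i1 p)))) ->
  h • fmap r1 (m1 (i1 p)) = h • e1 (r1 (i1 (r1 (i1 p)))) ->
  h • f1 (r1 (i1 p)) • f1 p • (e1 p • e1 (r1 (i1 p))) = h.
Proof.
move=> h1 h2; rewrite compA -(compA _ (f1 p)) f1_nat compA -(compA h (f1 _)) f1_nat.
rewrite -[fmap i1 (fmap r1 _)]/(T1 _) compA h1 -(compA h (e1 _)) ef1 compm1.
rewrite -compA f1_nat compA -[fmap i1 _]/(m1 (i1 p)) h2.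
by rewrite -compA ef1 compm1.
Qed.

Let both p : hom P _ _ := bridge' (r2 (i1 p)) • fmap r1 (fmap i2 (bridge p)).

Let both_conj p : both p • fmap r1 (t (i1 p))
  = fmap r1 (t (i1 p)) • f1 (r1 (i1 p)) • hh p.
Proof.
rewrite /both -compA -fmap_comp bridge_conj fmap_comp compA bridge'_conj.
rewrite -compA; congr (_ • _); rewrite /hh /psi /K fmap_comp !compA.
by rewrite e1_nat.
Qed.

(** Conjugated by [t], the product of the two bridges ends in [hh], which is balanced: it does not
    distinguish the three ways of collapsing a layer by a counit ([hh_bal], [hh_m1]). For balanced
    maps [absorb] cancels both copies of [f1] against those of [e1]. *)
Lemma both_split p : bridge' (r2 (i1 p)) • fmap r1 (fmap i2 (bridge p)) • fork p • join p
  = bridge' (r2 (i1 p)) • fmap r1 (fmap i2 (bridge p)).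
Proof.
rewrite -/(both p); have stb : both p = fmap r1 (t (i1 p)) • f1 (r1 (i1 p)) • hh p • fmap r1 (s (i1 p)).
  by rewrite -both_conj -compA -fmap_comp ts fmap_id compm1.
rewrite stb /fork /join; move: (hh p) (@absorb p _ _ (hh_bal p) (hh_m1 p)) => h hE.
rewrite !compA; congr (_ • _); rewrite -(compA _ (fmap r1 (s _))) -fmap_comp st.
rewrite fmap_id compm1 -[RHS]compA -[in RHS]hE !compA.
by [].
Qed.

(** Naturality of [f2] brings the two actions together. Associativity of the action ([E]) turns them
    into one action after a multiplication, which is undone by one of the two sections [f2]. *)
Lemma bridge_idem p : bridge p • bridge p = bridge p.
Proof.
have E : fmap i1 (e1 p) • s (i1 p) • T2 (fmap i1 (e1 p) • s (i1 p))
    = fmap i1 (e1 p) • s (i1 p) • m2 (i1 p).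
  rewrite -[RHS]compA s_mult T2M !compA.
  rewrite -(compA _ (s _) (T2 (fmap _ _))) s_nat !compA -(compA _ (s _) (T2 (s _))) s_nat.
  by rewrite !compA /T1 /m1 -fmap_comp -ee fmap_comp.
have bE : bridge p = fmap r2 (fmap i1 (e1 p) • s (i1 p)) • f2 (r2 (i1 p)) by [].
rewrite {1 2}bE -compA (compA (f2 _)) f2_nat !compA -fmap_comp.
rewrite -[fmap i2 (fmap r2 _)]/(T2 _) E fmap_comp -!compA; rewrite (compA (fmap r2 (m2 _))).
by rewrite -f2_nat -compA ef2 compm1.
Qed.

End SplittingCalculus.

Section Whiskering.

Variables (k : fieldType) (C : monoidal k).

Definition wl (M N P : modcat C) (G : modfun N P) (F F' : modfun M N)
  (s : modnat F F') : modnat (mfun_comp G F) (mfun_comp G F') :=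
  mnat_hcomp (mnat_id G) s.

Definition wr (M N P : modcat C) (G G' : modfun N P) (s : modnat G G')
  (F : modfun M N) : modnat (mfun_comp G F) (mfun_comp G' F) :=
  mnat_hcomp s (mnat_id F).

Lemma wlE (M N P : modcat C) (G : modfun N P) (F F' : modfun M N)
  (s : modnat F F') (m : M) : wl G s m = fmap G (s m).
Proof. by rewrite /= comp1m. Qed.

Lemma wrE (M N P : modcat C) (G G' : modfun N P) (s : modnat G G')
  (F : modfun M N) (m : M) : wr s F m = s (F m).
Proof. by rewrite /= fmap_id compm1. Qed.

End Whiskering.

Section ModSplitting.

Variables (k : fieldType) (C : monoidal k) (Z P Q : modcat C).
Variables (i1 : modfun P Z) (r1 : modfun Z P) (i2 : modfun Q Z) (r2 : modfun Z Q).
Variables (e1 : modnat (mfun_comp r1 i1) (mfun_id P))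
  (f2 : modnat (mfun_id Q) (mfun_comp r2 i2)).
Variable s : modnat (mfun_comp i2 r2) (mfun_comp i1 r1).

Lemma bridge_modnat :
  exists b : modnat (mfun_comp r2 i1) (mfun_comp r2 i1),
    forall p, b p = @bridge k Z P Q i1 r1 i2 r2 e1 f2 s p.
Proof.
exists (mnat_comp (wl r2 (mnat_comp (mod_run_fwd i1)
    (mnat_comp (wl i1 e1) (mnat_comp (mod_asc_fwd i1 r1 i1) (wr s i1)))))
  (mnat_comp (wl r2 (mod_asc_bwd i2 r2 i1)) (mnat_comp (mod_asc_fwd r2 i2 (mfun_comp r2 i1))
    (mnat_comp (wr f2 (mfun_comp r2 i1)) (mod_lun_bwd (mfun_comp r2 i1)))))).
by move=> p; rewrite /= !fmap_id !comp1m !compm1.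
Qed.

End ModSplitting.

(* The equivalence is the image of the idempotent [bridge]. *)
Section SplittingUnique.

Variables (k : fieldType) (C : monoidal k) (Z P Q : fsmodcat C).
Variables (i1 : modfun P Z) (r1 : modfun Z P) (i2 : modfun Q Z) (r2 : modfun Z Q).
Variables (e1 : modnat (mfun_comp r1 i1) (mfun_id P))
  (f1 : modnat (mfun_id P) (mfun_comp r1 i1)).
Variables (e2 : modnat (mfun_comp r2 i2) (mfun_id Q))
  (f2 : modnat (mfun_id Q) (mfun_comp r2 i2)).
Hypotheses (ef1 : forall p, e1 p • f1 p = idm p) (ef2 : forall q, e2 q • f2 q = idm q).
Variables (t : modnat (mfun_comp i1 r1) (mfun_comp i2 r2))
  (s : modnat (mfun_comp i2 r2) (mfun_comp i1 r1)).
Hypotheses (st : forall z, s z • t z = idm _) (ts : forall z, t z • s z = idm _).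
Hypothesis t_mult : forall z,
  t z • fmap i1 (e1 (r1 z))
  = fmap i2 (e2 (r2 z)) • t (i2 (r2 z)) • fmap i1 (fmap r1 (t z)).

Let e1_nat p p' (h : hom P p p') : e1 p' • fmap r1 (fmap i1 h) = h • e1 p := mnat_nat e1 h.
Let f1_nat p p' (h : hom P p p') : f1 p' • h = fmap r1 (fmap i1 h) • f1 p := mnat_nat f1 h.
Let e2_nat p p' (h : hom Q p p') : e2 p' • fmap r2 (fmap i2 h) = h • e2 p := mnat_nat e2 h.
Let f2_nat p p' (h : hom Q p p') : f2 p' • h = fmap r2 (fmap i2 h) • f2 p := mnat_nat f2 h.
Let t_nat z z' (h : hom Z z z') : t z' • fmap i1 (fmap r1 h) = fmap i2 (fmap r2 h) • t z := mnat_nat t h.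

(** [I] and [R] present [g (f p)] as the image of the product of both bridges. On this image [join]
    is invertible, with inverse induced by [fork]. *)
Lemma half_inverse (f : modfun P Q) (g : modfun Q P)
    (rf : modnat (mfun_comp r2 i1) f) (jf : modnat f (mfun_comp r2 i1))
    (rg : modnat (mfun_comp r1 i2) g) (jg : modnat g (mfun_comp r1 i2)) :
  (forall p, rf p • jf p = idm _) -> (forall q, rg q • jg q = idm _) ->
  (forall p, jf p • rf p = @bridge k Z P Q i1 r1 i2 r2 e1 f2 s p) ->
  (forall q, jg q • rg q = @bridge k Z Q P i2 r2 i1 r1 e2 f1 t q) ->
  @isomorphic k (mod_hom P P) (mfun_comp g f) (mfun_id P).
Proof.
move=> rjf rjg jrf jrg.
have J : exists a : modnat (mfun_comp (mfun_comp r1 i2) (mfun_comp r2 i1)) (mfun_id P),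
    forall p, a p = @join k Z P Q i1 r1 i2 r2 e1 s p.
  exists (mnat_comp e1 (mnat_comp (mod_lun_fwd (mfun_comp r1 i1)) (mnat_comp (wr e1 (mfun_comp r1 i1))
    (mnat_comp (mod_asc_bwd r1 i1 (mfun_comp r1 i1))
    (mnat_comp (wl r1 (mnat_comp (mod_asc_fwd i1 r1 i1) (mnat_comp (wr s i1) (mod_asc_bwd i2 r2 i1))))
    (mod_asc_fwd r1 i2 (mfun_comp r2 i1))))))).
  by move=> p; rewrite /join /= !fmap_id !comp1m !compm1 compA.
have [jn jnE] := J.
have bridge_nat' p p' (h : hom Q p p') :
    @bridge k Z Q P i2 r2 i1 r1 e2 f1 t p' • fmap r1 (fmap i2 h)
    = fmap r1 (fmap i2 h) • @bridge k Z Q P i2 r2 i1 r1 e2 f1 t p.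
  rewrite -!jrg -compA.
  have -> : rg p' • fmap r1 (fmap i2 h) = fmap g h • rg p := mnat_nat rg h.
  rewrite compA; have -> : jg p' • fmap g h = fmap r1 (fmap i2 h) • jg p := mnat_nat jg h.
  by rewrite compA.
pose I p := fmap r1 (fmap i2 (jf p)) • jg (f p).
pose R p := rg (f p) • fmap r1 (fmap i2 (rf p)).
pose dd z := fmap i1 (fmap r1 (s z)) • s (i2 (r2 z)) • fmap i2 (f2 (r2 z)) • t z.
have RI p : R p • I p = idm _.
  rewrite /R /I !compA -(compA (rg _)) -!fmap_comp rjf !fmap_id compm1.
  by rewrite rjg.
have IR p : I p • R p = @bridge k Z Q P i2 r2 i1 r1 e2 f1 t (r2 (i1 p))
    • fmap r1 (fmap i2 (@bridge k Z P Q i1 r1 i2 r2 e1 f2 s p)).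
  rewrite /R /I !compA -(compA _ (jg _)) jrg -bridge_nat' -compA -!fmap_comp.
  by rewrite jrf.
have jb' p : jn p • @bridge k Z Q P i2 r2 i1 r1 e2 f1 t (r2 (i1 p)) = jn p.
  rewrite jnE; exact: (join_bridge' f1_nat ef1 st ts t_mult p).
have jb p : jn p • fmap r1 (fmap i2 (@bridge k Z P Q i1 r1 i2 r2 e1 f2 s p)) = jn p.
  rewrite jnE; exact: (join_bridge e1_nat ef2 t_nat st ts t_mult (d := dd) (fun z => erefl) p).
have bs p : I p • R p • @fork k Z P Q i1 r1 i2 r2 f1 t p • jn p = I p • R p.
  rewrite IR jnE.
  exact: (both_split e1_nat f1_nat e2_nat f2_nat ef1 t_nat st ts t_mult (d := dd) (fun z => erefl) p).
have jf1 p : jn p • @fork k Z P Q i1 r1 i2 r2 f1 t p = idm p.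
  rewrite jnE; exact: join_fork.
pose a := mnat_comp jn (mnat_comp (mod_asc_bwd r1 i2 (mfun_comp r2 i1))
  (mnat_comp (wl r1 (wl i2 jf)) (mnat_comp (mod_asc_fwd r1 i2 f) (wr jg f)))).
have aE p : a p = jn p • I p.
  by rewrite /a /I /= !comp1m fmap_id compm1.
split; apply: (@modnat_iso k C P P (mfun_comp g f) (mfun_id P) a
  (fun p => R p • @fork k Z P Q i1 r1 i2 r2 f1 t p)) => p; rewrite aE.
  move: (I p) (R p) (RI p) (@fork k Z P Q i1 r1 i2 r2 f1 t p) (bs p) => I' R' RI' a0 bs'.
  have := congr1 (fun x => R' • x) bs'; rewrite !compA RI' !comp1m => E.
  by rewrite E RI'.
move: (I p) (R p) (IR p) (@fork k Z P Q i1 r1 i2 r2 f1 t p) (jf1 p) => I' R' IR' a0 ja0.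
by rewrite !compA -(compA _ I') IR' compA jb' jb.
Qed.

End SplittingUnique.

Theorem splitting_unique (k : fieldType) (C : monoidal k) (Z P Q : fsmodcat C)
    (i1 : modfun P Z) (r1 : modfun Z P) (i2 : modfun Q Z) (r2 : modfun Z Q)
    (e1 : modnat (mfun_comp r1 i1) (mfun_id P))
    (f1 : modnat (mfun_id P) (mfun_comp r1 i1))
    (e2 : modnat (mfun_comp r2 i2) (mfun_id Q))
    (f2 : modnat (mfun_id Q) (mfun_comp r2 i2))
    (t : modnat (mfun_comp i1 r1) (mfun_comp i2 r2))
    (s : modnat (mfun_comp i2 r2) (mfun_comp i1 r1)) :
  (forall p, e1 p • f1 p = idm p) -> (forall q, e2 q • f2 q = idm q) ->
  (forall z, s z • t z = idm _) -> (forall z, t z • s z = idm _) ->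
  (forall z, t z • fmap i1 (e1 (r1 z))
    = fmap i2 (e2 (r2 z)) • t (i2 (r2 z)) • fmap i1 (fmap r1 (t z))) ->
  exists g : modfun Q P, @equivalence1 k (Mod C) Q P g.
Proof.
move=> ef1 ef2 st ts t_mult.
(* Compatibility of [s] with the multiplications, so that the calculus also applies with the two
   splittings exchanged. *)
have s_mult' z : s z • fmap i2 (e2 (r2 z))
    = fmap i1 (e1 (r1 z)) • s (i1 (r1 z)) • fmap i2 (fmap r2 (s z)).
  have := @s_mult k Z P Q i1 r1 i2 r2 e1 e2 t s st ts t_mult z.
  have := @s_nat k Z P Q i1 r1 i2 r2 t s (fun z z' h => mnat_nat t h) st ts _ _ (s z).
  by move=> /= E ->; rewrite -!compA E.
have [b bE] := bridge_modnat e1 f2 s; have [c cE] := bridge_modnat e2 f1 t.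
have bb : mnat_comp b b = b.
  apply: modnat_eq => p /=; rewrite bE.
  exact: (@bridge_idem k Z P Q i1 r1 i2 r2 e1 e2 f2 (fun z z' h => mnat_nat e1 h)
    (fun z z' h => mnat_nat f2 h) ef2 t s (fun z z' h => mnat_nat t h) st ts t_mult).
have cc : mnat_comp c c = c.
  apply: modnat_eq => p /=; rewrite cE.
  exact: (@bridge_idem k Z Q P i2 r2 i1 r1 e2 e1 f1 (fun z z' h => mnat_nat e2 h)
    (fun z z' h => mnat_nat f1 h) ef1 s t (fun z z' h => mnat_nat s h) ts st s_mult').
have icP : idem_complete_cat P by have [[]] := fsmodP P.
have icQ : idem_complete_cat Q by have [[]] := fsmodP Q.
have [f [rf [jf [rjf jrf]]]] := mod_idem_complete icQ bb.
have [g [rg [jg [rjg jrg]]]] := mod_idem_complete icP cc.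
have at_ (F G : modcat C) (u v : modfun F G) (x y : modnat u v) (m : F) : x = y -> x m = y m by move=> ->.
have rjf' p := at_ _ _ _ _ _ _ p rjf; have rjg' p := at_ _ _ _ _ _ _ p rjg.
have jrf' p := at_ _ _ _ _ _ _ p jrf; have jrg' p := at_ _ _ _ _ _ _ p jrg.
exists g, f; split.
  apply: (half_inverse (i1 := i2) (r1 := r2) (i2 := i1) (r2 := r1) (e1 := e2) (f1 := f2)
    (e2 := e1) (f2 := f1) ef2 ef1 ts st s_mult' rjg' rjf').
    by move=> q; rewrite -cE -jrg'.
  by move=> p; rewrite -bE -jrf'.
apply: (half_inverse ef1 ef2 st ts t_mult rjf' rjg').
  by move=> p; rewrite -bE -jrf'.
by move=> q; rewrite -cE -jrg'.
Qed.

(** * From the monad of an adjunction to a splitting in the 2-category *)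

Section TransportMonad.

Variables (k : fieldType) (X : lin2cat k) (A : X).
Hypotheses (domA : forall B, dominated A B) (lfs : locally_finite_semisimple X).

Notation H := (hom1 X A A).

Variables (T : lfunctor H H) (mu : forall z, hom H (T (T z)) (T z))
  (eta : forall z, hom H z (T z)) (dl : forall z, hom H (T z) (T (T z))).
Variables (E : H) (th : forall z : H, iso (E ∘ z) (T z)).
Hypothesis th_nat : forall (z z' : H) (f : hom H z z'),
  th z' • (idm E ∗ f) = fmap T f • th z.
Hypothesis eta_nat : forall (z z' : H) (f : hom H z z'), eta z' • f = fmap T f • eta z.
Hypothesis mu_nat : forall (z z' : H) (f : hom H z z'),
  mu z' • fmap T (fmap T f) = fmap T f • mu z.
Hypothesis dl_nat : forall (z z' : H) (f : hom H z z'),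
  dl z' • fmap T f = fmap T (fmap T f) • dl z.
Hypothesis mu_assoc : forall z, mu z • mu (T z) = mu z • fmap T (mu z).
Hypothesis mu_etal : forall z, mu z • eta (T z) = idm _.
Hypothesis mu_etar : forall z, mu z • fmap T (eta z) = idm _.
Hypothesis dl_left : forall z, dl z • mu z = mu (T z) • fmap T (dl z).
Hypothesis dl_right : forall z, dl z • mu z = fmap T (mu z) • dl (T z).
Hypothesis mu_dl : forall z, mu z • dl z = idm _.

Variables (m : hom H (E ∘ E) E) (u : hom H (id1 A) E) (c : hom H E (E ∘ E)).
Hypothesis mE : forall z : H,
  th z • (m ∗ idm z) = mu z • fmap T (th z) • th (E ∘ z) • asc E E z.
Hypothesis uE : forall z : H, th z • (u ∗ idm z) = eta z • lun z.
Hypothesis cE : forall z : H,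
  fmap T (th z) • th (E ∘ z) • asc E E z • (c ∗ idm z) = dl z • th z.

(** 2-cells are determined by their action on all [z] ([rep_inj]), and [th] identifies [E ∘ z] with
    [T z]. Each law for [E] is thereby the corresponding law for [T] at [z], up to coherence. *)
Lemma transport_monad : is_monad m u.
Proof.
split; apply: (rep_inj domA) => z; apply: (iso_monic (f := th z)).
- rewrite !bmap_compl !compA !mE -!(compA _ _ ((_ ∗ _) ∗ _)).
  rewrite asc_natl asc_natm !compA -(compA _ (fwd (th _)) (m ∗ _)) mE.
  rewrite -(compA _ (fwd (th _)) (idm E ∗ _)) th_nat !compA.
  rewrite -[in RHS](compA _ (fmap T _) (fmap T (m ∗ _))) -fmap_comp mE.
  rewrite !fmap_comp !compA -mu_assoc -(compA (mu z) (mu _)) mu_nat !compA.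
  rewrite -(compA _ (fmap T (fwd (asc _ _ _)))) -th_nat -!compA; do !congr (_ • _).
  by rewrite pentagon !compA.
- rewrite !bmap_compl !compA mE -!(compA _ _ ((_ ∗ _) ∗ _)) asc_natl.
  rewrite !compA -(compA _ (fwd (th _))) uE !compA -(compA _ (fmap T _)) -eta_nat.
  by rewrite !compA mu_etal comp1m -!compA lun_asc.
rewrite !bmap_compl !compA mE -!(compA _ _ ((_ ∗ _) ∗ _)) asc_natm.
rewrite !compA -(compA _ (fwd (th _))) th_nat !compA -(compA (mu z)) -fmap_comp uE.
rewrite fmap_comp !compA mu_etar comp1m -th_nat -!compA triangle.
by [].
Qed.

Let mult_iso z : iso ((E ∘ E) ∘ z) (T (T z)) :=
  iso_trans (iso_trans (iso_fmap T (th z)) (th (E ∘ z))) (asc E E z).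

Lemma transport_separable : separable m.
Proof.
exists c; split; apply: (rep_inj domA) => z.
- apply: (iso_monic (f := mult_iso z)); rewrite /= !bmap_compl !compA cE.
  rewrite -(compA (dl z)) mE !compA dl_left.
  rewrite -[in RHS](compA _ (fwd (asc E E z))) asc_natl !compA.
  rewrite -[in RHS](compA _ (fwd (th _)) (m ∗ _)) mE !compA -mu_nat.
  have p : asc E E (E ∘ z) • asc (E ∘ E) E z • ((asc E E E)⁻ ∗ idm z)
      = (idm E ∗ asc E E z) • asc E (E ∘ E) z.
    by rewrite pentagon -compA -bmap_compl bwdK bmap_id compm1.
  rewrite -[in RHS](compA _ (fwd (asc E E (E ∘ z)))) -[in RHS](compA _ (_ • _) (_ ∗ idm z)) p.
  rewrite !compA -[in RHS](compA _ _ ((_ ∗ c) ∗ _)) asc_natm !compA.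
  rewrite -[in RHS](compA _ (fwd (th _)) (idm E ∗ _)) th_nat !compA.
  rewrite -[in RHS](compA _ (fwd (th _)) (idm E ∗ _)) th_nat !compA.
  rewrite -![in RHS](compA (mu _)) -!fmap_comp cE.
  by rewrite fmap_comp !compA.
- apply: (iso_monic (f := mult_iso z)); rewrite /= !bmap_compl !compA cE.
  rewrite -(compA (dl z)) mE !compA dl_right.
  rewrite -[in RHS](compA _ (fwd (asc E E z))) asc_natm !compA.
  rewrite -[in RHS](compA _ (fwd (th _)) (idm E ∗ _)) th_nat !compA -fmap_comp mE.
  rewrite !fmap_comp -[in RHS](compA _ (fmap T (fwd (asc _ _ _)))) -th_nat !compA.
  rewrite -[in RHS](compA _ (idm E ∗ _) (asc E (E ∘ E) z)).
  rewrite -[in RHS](compA _ _ (asc E E E ∗ _)) -pentagon !compA -[in RHS](compA _ _ ((c ∗ _) ∗ _)) asc_natl !compA.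
  have cE' w x (y : hom H w (E ∘ x)) : fmap T (th x) • (th (E ∘ x) • (asc E E x
      • ((c ∗ idm x) • y))) = dl x • (th x • y).
    by rewrite !compA cE.
  rewrite -!compA cE' !compA -[in RHS](compA (fmap T (mu z))) -dl_nat.
  by rewrite !compA.
apply: (iso_monic (f := th z)); rewrite bmap_compl compA mE -!compA.
rewrite (compA (fwd (th _))) (compA (fmap T _)) (compA (fmap T _)) cE !compA mu_dl.
by rewrite bmap_id comp1m compm1.
Qed.

End TransportMonad.

Section AdjunctionSplits.

Variables (k : fieldType) (X : lin2cat k) (A : X).
Hypotheses (domA : forall B, dominated A B) (lfs : locally_finite_semisimple X).
Hypothesis X_ic : idem_complete2 X.

Notation C := (end_monoidal A).
Notation H := (hom1 X A A).

Lemma rep_full_at (B B' : X) (g g' : hom1 X B B')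
    (s : modnat (rep1 A g) (rep1 A g')) :
  exists a : hom (hom1 X B B') g g', forall z : hom1 X A B, a ∗ idm z = s z.
Proof.
have [a aE] := rep_full domA (s : hom (mod_hom _ _) (rep1 A g) (rep1 A g')).
by exists a => z; rewrite -aE.
Qed.

(** Acting on [z], the multiplication of the splitting becomes [i] applied to the counit at [r ∘ z],
    the shape in which [splitting_unique] meets it. *)
Lemma adj_mult_rep (B : X) (i : hom1 X B A) (r : hom1 X A B)
    (eps : hom (hom1 X B B) (r ∘ i) (id1 B)) (z : H) :
  asc i r z • (adj_mult eps ∗ idm z)
  = (idm i ∗ (lun (r ∘ z) • (eps ∗ idm (r ∘ z)) • (asc r i (r ∘ z))⁻))
    • asc i r (i ∘ (r ∘ z)) • (idm (i ∘ r) ∗ asc i r z)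
    • asc (i ∘ r) (i ∘ r) z.
Proof.
have wz : (lun r • (eps ∗ idm r) • (asc r i r)⁻) ∗ idm z
    = lun (r ∘ z) • (eps ∗ idm (r ∘ z)) • (asc r i (r ∘ z))⁻
      • (idm r ∗ asc i r z) • asc r (i ∘ r) z.
  have p : asc (r ∘ i) r z • ((asc r i r)⁻ ∗ idm z)
      = (asc r i (r ∘ z))⁻ • (idm r ∗ asc i r z) • asc r (i ∘ r) z.
    apply: (iso_monic (f := asc r i (r ∘ z))); rewrite !compA pentagon bwdK comp1m.
    by rewrite -compA -bmap_compl bwdK bmap_id compm1.
  rewrite !bmap_compl -lun_asc -(compA _ _ ((eps ∗ _) ∗ _)) asc_natl.
  by rewrite -!compA p !compA.
rewrite /adj_mult bmap_compl compA asc_natm wz !bmap_compr.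
rewrite -(compA _ _ (asc i _ z)) -(compA _ _ (asc i r (i ∘ r) ∗ idm z)).
rewrite -[X in _ • X]pentagon !compA -[in RHS](compA _ (asc i r _) (idm (i ∘ r) ∗ _)).
by rewrite asc_natr !compA.
Qed.

Lemma transported_square (T : lfunctor H H) (E : H) (B : X) (i : hom1 X B A)
    (r : hom1 X A B) (t : hom H E (i ∘ r)) (th : forall z : H, hom H (E ∘ z) (T z))
    (tt : forall z : H, hom H (T z) (i ∘ (r ∘ z))) :
  (forall (z z' : H) (f : hom H z z'), th z' • (idm E ∗ f) = fmap T f • th z) ->
  (forall z, tt z • th z = asc i r z • (t ∗ idm z)) ->
  forall z, tt (i ∘ (r ∘ z)) • fmap T (tt z)
      • (fmap T (th z) • th (E ∘ z) • asc E E z)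
    = asc i r (i ∘ (r ∘ z)) • (idm (i ∘ r) ∗ asc i r z) • asc (i ∘ r) (i ∘ r) z
      • ((t ∗ t) ∗ idm z).
Proof.
move=> th_nat tt_th z.
rewrite -!compA (compA (fmap T _)) -fmap_comp tt_th.
rewrite (compA (fmap T _)) -th_nat -compA (compA (tt _)) tt_th -!compA.
rewrite asc_nat (compA (t ∗ _)) -bmap_comp comp1m compm1.
by rewrite (compA (idm (i ∘ r) ∗ _)) -bmap_comp comp1m.
Qed.

Variables (M : fsmodcat C) (L : modfun (rep_ob A A) M) (R : modfun M (rep_ob A A)).
Variables (eta : modnat (mfun_id (rep_ob A A)) (mfun_comp R L))
  (eps : modnat (mfun_comp L R) (mfun_id M)) (phi : modnat (mfun_id M) (mfun_comp L R)).
Hypothesis tri_l : forall z, eps (L z) • fmap L (eta z) = idm (L z).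
Hypothesis tri_r : forall n, fmap R (eps n) • eta (R n) = idm (R n).
Hypothesis eps_phi : forall n, eps n • phi n = idm n.

(** The composite [R L] is a module endofunctor of the regular module, hence composition with a
    1-cell [E], and [phi] makes its monad separable. The splitting through [B] in [X] and the
    adjunction through [M] are two separable splittings of this monad, so [splitting_unique]
    compares them. *)
Theorem adjunction_splits :
  exists (B : X) (e : modfun (rep_ob A B) M),
    @equivalence1 k (Mod C) (rep_fs A lfs B) M e.
Proof.
have ic : idem_complete_cat H by have [[]] := lfs A A.
have [E [thE]] := rep_surj domA lfs ic (mfun_comp R L : mod_hom (rep_ob A A) (rep_ob A A)).
pose T : lfunctor H H := mfun_comp R L.
pose th z : @iso k H (E ∘ z) (T z) := iso_at thE z.
have th_nat (z z' : H) (f : hom H z z') : th z' • (idm E ∗ f) = fmap T f • th z.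
  exact: (mnat_nat (fwd thE : modnat _ _) f).
pose mu z : hom H (T (T z)) (T z) := fmap R (eps (L z)).
pose dl z : hom H (T z) (T (T z)) := fmap R (phi (L z)).
pose et z : hom H z (T z) := eta z.
have et_nat (z z' : H) (f : hom H z z') : et z' • f = fmap T f • et z.
  exact: (mnat_nat eta f).
have eps_nat n n' (f : hom M n n') : eps n' • fmap L (fmap R f) = f • eps n.
  exact: (mnat_nat eps f).
have phi_nat n n' (f : hom M n n') : phi n' • f = fmap L (fmap R f) • phi n.
  exact: (mnat_nat phi f).
have RM n n' n'' (g : hom M n' n'') (f : hom M n n') :
  (fmap R g : hom H (R n') (R n'')) • (fmap R f : hom H (R n) (R n')) = fmap R (g • f).
  by rewrite fmap_comp.
have TE (z z' : H) (f : hom H z z') : fmap T f = fmap R (fmap L f) by [].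
have mu_nat (z z' : H) (f : hom H z z') : mu z' • fmap T (fmap T f) = fmap T f • mu z.
  by rewrite !TE /mu !RM eps_nat.
have dl_nat (z z' : H) (f : hom H z z') : dl z' • fmap T f = fmap T (fmap T f) • dl z.
  by rewrite !TE /dl !RM phi_nat.
have mu_assoc (z : H) : mu z • mu (T z) = mu z • fmap T (mu z).
  by rewrite TE /mu !RM eps_nat.
have mu_etal (z : H) : mu z • et (T z) = idm _ := tri_r (L z).
have mu_etar (z : H) : mu z • fmap T (et z) = idm _.
  by rewrite TE /mu RM tri_l fmap_id.
have dl_left (z : H) : dl z • mu z = mu (T z) • fmap T (dl z).
  by rewrite TE /mu /dl !RM eps_nat.
have dl_right (z : H) : dl z • mu z = fmap T (mu z) • dl (T z).
  by rewrite TE /mu /dl !RM phi_nat.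
have mu_dl (z : H) : mu z • dl z = idm _.
  by rewrite /mu /dl RM eps_phi fmap_id.
pose s := (bwd thE : modnat _ _).
have sth (z : H) : s z • (th z : hom H _ _) = idm _ := fwdK (th z).
have ths (z : H) : (th z : hom H _ _) • s z = idm _ := bwdK (th z).
pose t0 := (fwd thE : modnat (rep1 A E) (mfun_comp R L)).
have [m mP] := rep_full_at (mnat_comp s (mnat_comp (wl R (mod_lun_fwd L))
  (mnat_comp (wl R (wr eps L)) (mnat_comp (wl R (mod_asc_bwd L R L))
  (mnat_comp (mod_asc_fwd R L (mfun_comp R L)) (mnat_comp (mnat_hcomp t0 t0) (rep_cmp_bwd A E E))))))).
have mE (z : H) : th z • (m ∗ idm z) = mu z • fmap T (th z) • th (E ∘ z) • asc E E z.
  rewrite mP /= !fmap_id !comp1m !compm1 (bwdKl (th z)) -!compA; congr (_ • _).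
  by rewrite !compA; congr (_ • _); exact: th_nat.
have [u uP] := rep_full_at (mnat_comp s (mnat_comp eta (rep_idn_bwd A A))).
have uE (z : H) : th z • (u ∗ idm z) = et z • lun z.
  by rewrite uP /= (bwdKl (th z)).
have [c cP] := rep_full_at (mnat_comp (rep_cmp_fwd A E E) (mnat_comp (mnat_hcomp s s)
  (mnat_comp (mod_asc_bwd R L (mfun_comp R L)) (mnat_comp (wl R (mod_asc_fwd L R L))
  (mnat_comp (wl R (wr phi L)) (mnat_comp (wl R (mod_lun_bwd L)) t0)))))).
have cE (z : H) : fmap T (th z) • th (E ∘ z) • asc E E z • (c ∗ idm z) = dl z • th z.
  rewrite cP /= !fmap_id !comp1m ?compm1 -!compA bwdKl.
  rewrite (compA (fwd (th (E ∘ z)))).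
  have -> : (th (E ∘ z) : hom H _ _) • s (E ∘ z) = idm _ := ths (E ∘ z).
  rewrite comp1m.
  by rewrite compA -!fmap_comp ths !fmap_id comp1m.
have mon := transport_monad domA th_nat et_nat mu_nat mu_assoc mu_etal mu_etar mE uE.
have sep := transport_separable domA th_nat mu_nat dl_nat dl_left dl_right mu_dl mE cE.
have [B [i0 [r0 [eta' [eps' [_ [phi' ephi'] [t [tm _]]]]]]]] := X_ic.2 _ _ _ _ mon sep.
pose e2 := mnat_comp (rep_idn_bwd A B) (mnat_comp (rep2 A eps') (rep_cmp_fwd A r0 i0)).
pose f2 := mnat_comp (rep_cmp_bwd A r0 i0) (mnat_comp (rep2 A phi') (rep_idn_fwd A B)).
pose tt := mnat_comp (rep_cmp_bwd A i0 r0) (mnat_comp (rep2 A t) s).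
pose tb := mnat_comp t0 (mnat_comp (rep2 A t⁻) (rep_cmp_fwd A i0 r0)).
exists B; apply: (@splitting_unique k C (rep_fs A lfs A) M (rep_fs A lfs B)
  R L (rep1 A i0) (rep1 A r0) eps phi e2 f2 tt tb) => //.
- move=> q; rewrite /e2 /f2 /= -!compA fwdKl (compA (eps' ∗ _)) -bmap_compl ephi'.
  by rewrite bmap_id comp1m bwdK.
- move=> z; rewrite /tt /tb /= -!compA fwdKl (compA (t⁻ ∗ _)) -bmap_compl fwdK.
  by rewrite bmap_id comp1m; exact: ths.
- move=> z; rewrite /tt /tb /= -!compA.
  rewrite (compA (s z)); have -> : s z • (t0 z : hom H _ _) = idm _ := sth z.
  by rewrite comp1m (compA (t ∗ _)) -bmap_compl bwdK bmap_id comp1m bwdK.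
move=> z.
have tt_th (x : H) : (tt x : hom H _ _) • (th x : hom H _ _) = asc i0 r0 x • (t ∗ idm x).
  have -> : tt x = asc i0 r0 x • ((t ∗ idm x) • s x) :> hom H _ _ by [].
  by rewrite -!compA sth compm1.
pose K : iso ((E ∘ E) ∘ z) (T (T z)) :=
  iso_trans (iso_trans (iso_fmap T (th z)) (th (E ∘ z))) (asc E E z).
(* Precomposition with [K] moves the question to [(E ∘ E) ∘ z], where it is the compatibility [tm]
   of [t] with the multiplications. *)
apply: (iso_epic (C := H) (f := K)).
transitivity (asc i0 r0 z • ((t • m) ∗ idm z)).
  have -> : tt z = asc i0 r0 z • ((t ∗ idm z) • s z) :> hom H _ _ by [].
  rewrite bmap_compl -!compA; congr (_ • (_ • _)).
  rewrite -[m ∗ idm z](fwdKl (th z)) mE -!(compA (mu z)).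
  by [].
rewrite tm bmap_compl compA adj_mult_rep.
have := @transported_square T E B i0 r0 t th tt th_nat tt_th z.
move/(congr1 (fun f => (idm i0 ∗ (lun (r0 ∘ z) • (eps' ∗ idm (r0 ∘ z)) • (asc r0 i0 (r0 ∘ z))⁻)) • f)).
rewrite !compA => <-; rewrite -!compA.
by [].
Qed.

End AdjunctionSplits.

(** * Duality and partial traces *)

(* [U] is left adjoint to [W], with counit [U W -> 1] and unit [1 -> W U]. *)
Record dual (k : fieldType) (C : monoidal k) (Z : modcat C) (W U : modfun Z Z) :=
  Dual {
    dual_ev : modnat (mfun_comp U W) (mfun_id Z);
    dual_cv : modnat (mfun_id Z) (mfun_comp W U);
    dual_snakeW : forall n,
      (fmap W (dual_ev n) : hom Z (W (U (W n))) (W n)) • dual_cv (W n) = idm (W n);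
    dual_snakeU : forall n,
      (dual_ev (U n) : hom Z (U (W (U n))) (U n)) • fmap U (dual_cv n) = idm (U n)
  }.

Section Duals.

Variables (k : fieldType) (C : monoidal k) (Z : modcat C).

Section OneDual.

Variables (W U : modfun Z Z) (d : dual W U).

Definition ev (n : Z) : hom Z (U (W n)) n := dual_ev d n.
Definition cv (n : Z) : hom Z n (W (U n)) := dual_cv d n.

Lemma ev_nat n n' (f : hom Z n n') : ev n' • fmap U (fmap W f) = f • ev n.
Proof. exact: (mnat_nat (dual_ev d)). Qed.

Lemma cv_nat n n' (f : hom Z n n') : cv n' • f = fmap W (fmap U f) • cv n.
Proof. exact: (mnat_nat (dual_cv d)). Qed.

Lemma snakeW n : fmap W (ev n) • cv (W n) = idm (W n).
Proof. exact: dual_snakeW. Qed.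

Lemma snakeU n : ev (U n) • fmap U (cv n) = idm (U n).
Proof. exact: dual_snakeU. Qed.

End OneDual.

Lemma dual_comp (W U W' U' : modfun Z Z) (d : dual W U) (d' : dual W' U') :
  exists D : dual (mfun_comp W W') (mfun_comp U' U),
    (forall n, ev D n = ev d' n • fmap U' (ev d (W' n))) /\
    (forall n, cv D n = fmap W (cv d' (U n)) • cv d n).
Proof.
have [e eE] : exists e : modnat (mfun_comp (mfun_comp U' U) (mfun_comp W W')) (mfun_id Z),
    forall n, e n = ev d' n • fmap U' (ev d (W' n)).
  exists (mnat_comp (dual_ev d') (mnat_comp (wl U' (mod_lun_fwd W'))
    (mnat_comp (wl U' (wr (dual_ev d) W')) (mnat_comp (wl U' (mod_asc_bwd U W W'))
      (mod_asc_fwd U' U (mfun_comp W W')))))).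
  by move=> n; rewrite /= !fmap_id !comp1m !compm1.
have [c cE] : exists c : modnat (mfun_id Z) (mfun_comp (mfun_comp W W') (mfun_comp U' U)),
    forall n, c n = fmap W (cv d' (U n)) • cv d n.
  exists (mnat_comp (mod_asc_bwd W W' (mfun_comp U' U))
    (mnat_comp (wl W (mod_asc_fwd W' U' U)) (mnat_comp (wl W (wr (dual_cv d') U))
      (mnat_comp (wl W (mod_lun_bwd U)) (dual_cv d))))).
  by move=> n; rewrite /= !fmap_id !comp1m !compm1.
unshelve eexists (@Dual _ _ _ _ _ e c _ _); last by split.
- move=> n; change (fmap W (fmap W' (e n)) • c (W (W' n)) = idm _).
  rewrite eE cE !fmap_comp -compA (compA (fmap W (fmap W' (fmap U' _)))).
  rewrite -(fmap_comp W (fmap W' (fmap U' _))) -cv_nat fmap_comp.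
  rewrite -(compA (fmap W (cv d' _))) (snakeW d (W' n)) compm1 -(fmap_comp W (fmap W' _)).
  by rewrite (snakeW d' n) fmap_id.
move=> n; change (e (U' (U n)) • fmap U' (fmap U (c n)) = idm _).
rewrite eE cE !fmap_comp -compA (compA (fmap U' (ev d _))) -(fmap_comp U' (ev d _)) ev_nat.
rewrite fmap_comp -!compA -(fmap_comp U' (ev d (U n))) (snakeU d n) fmap_id compm1.
by rewrite (snakeU d' (U n)).
Qed.

(* [p] and [q] are mates: each of the two equations determines one from the other. *)
Definition mates (W U W' U' : modfun Z Z) (d : dual W U) (d' : dual W' U')
    (p : modnat W W') (q : modnat U' U) : Prop :=
  (forall n, ev d n • q (W n) = ev d' n • fmap U' (p n)) /\
  (forall n, p (U n) • cv d n = fmap W' (q n) • cv d' n).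

Section Mates.

Variables (W U W' U' : modfun Z Z) (d : dual W U) (d' : dual W' U').

Lemma mate_of (p : modnat W W') : exists q, mates d d' p q.
Proof.
exists (mnat_comp (mod_lun_fwd U) (mnat_comp (wr (dual_ev d') U)
  (mnat_comp (mod_asc_bwd U' W' U) (mnat_comp (wl U' (wr p U))
  (mnat_comp (wl U' (dual_cv d)) (mod_run_bwd U')))))).
split=> n; rewrite /= !fmap_id !comp1m !compm1.
  rewrite compA -[dual_ev d' _]/(ev d' _) -ev_nat -compA; congr (_ • _).
  rewrite -!fmap_comp; congr fmap; rewrite compA.
  have -> : fmap W' (ev d n) • p (U (W n)) = p n • fmap W (ev d n) by rewrite mnat_nat.
  by rewrite -compA snakeW compm1.
rewrite !fmap_comp -!compA (compA (fmap W' (fmap U' (p _)))).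
rewrite -(fmap_comp W' (fmap U' (p _))) -(fmap_comp U' (p _)) -cv_nat compA.
by rewrite (snakeW d' (U n)) comp1m.
Qed.

Lemma comate_of (q : modnat U' U) : exists p, mates d d' p q.
Proof.
exists (mnat_comp (mod_run_fwd W') (mnat_comp (wl W' (dual_ev d))
  (mnat_comp (wl W' (wr q W)) (mnat_comp (mod_asc_fwd W' U' W)
  (mnat_comp (wr (dual_cv d') W) (mod_lun_bwd W)))))).
split=> n; rewrite /= !fmap_id !comp1m !compm1; last first.
  rewrite -!compA -[dual_cv d' _]/(cv d' _) cv_nat.
  rewrite (compA (fmap W' (q _))) (compA (fmap W' (dual_ev d _))) -!fmap_comp; congr (fmap _ _ • _).
  have -> : q (W (U n)) • fmap U' (cv d n) = fmap U (cv d n) • q n by rewrite mnat_nat.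
  by rewrite compA snakeU comp1m.
rewrite !fmap_comp !compA -[dual_ev d _]/(ev d _) ev_nat -(compA (ev d n)).
rewrite ev_nat -!compA; congr (_ • _).
by rewrite (snakeU d' (W n)) compm1.
Qed.

Lemma mates_inj (p p' : modnat W W') (q : modnat U' U) :
  mates d d' p q -> mates d d' p' q -> p = p'.
Proof.
move=> [_ pE] [_ pE']; apply: modnat_eq => n.
have aux (s : modnat W W') : s n = s n • fmap W (ev d n) • cv d (W n).
  by rewrite -compA snakeW compm1.
by rewrite aux [RHS]aux (mnat_nat p) (mnat_nat p') -!compA pE pE'.
Qed.

Lemma mates_uniq (p : modnat W W') (q q' : modnat U' U) :
  mates d d' p q -> mates d d' p q' -> q = q'.
Proof.
move=> [pE _] [pE' _]; apply: modnat_eq => n.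
have aux (s : modnat U' U) : s n = ev d (U n) • (fmap U (cv d n) • s n).
  by rewrite compA snakeU comp1m.
by rewrite aux [RHS]aux -(mnat_nat q) -(mnat_nat q') !compA pE pE'.
Qed.

Lemma mates_lin a (p p' : modnat W W') (q q' : modnat U' U) :
  mates d d' p q -> mates d d' p' q' -> mates d d' (a *: p + p') (a *: q + q').
Proof.
move=> [p1 p2] [q1 q2]; split=> n; rewrite !mnat_linE.
  by rewrite comp_linr fmap_lin comp_linr p1 q1.
by rewrite comp_linl fmap_lin comp_linl p2 q2.
Qed.

End Mates.

Lemma mates_id (W U : modfun Z Z) (d : dual W U) :
  mates d d (mnat_id W) (mnat_id U).
Proof. by split=> n /=; rewrite fmap_id ?compm1 ?comp1m. Qed.

Lemma mates_comp (W U W' U' W2 U2 : modfun Z Z) (d : dual W U) (d' : dual W' U')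
    (d2 : dual W2 U2) (p : modnat W W') (q : modnat U' U) (p' : modnat W' W2)
    (q' : modnat U2 U') :
  mates d d' p q -> mates d' d2 p' q' ->
  mates d d2 (mnat_comp p' p) (mnat_comp q q').
Proof.
move=> [e1 e2] [f1 f2]; split=> n /=.
  by rewrite compA e1 -compA -mnat_nat compA f1 -compA -fmap_comp.
by rewrite -compA e2 compA mnat_nat -compA f2 compA -fmap_comp.
Qed.

Lemma mates0 (W U W' U' : modfun Z Z) (d : dual W U) (d' : dual W' U') :
  mates d d' 0 0.
Proof. by split=> n; rewrite /= ?fmap0 ?comp0m ?compm0. Qed.

Lemma matesZ (W U W' U' : modfun Z Z) (d : dual W U) (d' : dual W' U') a p q :
  mates d d' p q -> mates d d' (a *: p) (a *: q).
Proof.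
by move=> /(mates_lin a)/(_ (mates0 d d')); rewrite !addr0.
Qed.

(** Taking mates is a linear bijection between the endomorphisms of [W] and those of [U], and it
    matches the identities. *)
Lemma brick_dual (W U : modfun Z Z) (d : dual W U) :
  @brick k (mod_hom Z Z) W -> @brick k (mod_hom Z Z) U.
Proof.
move=> [nz sc]; split.
  move=> U0; apply: nz; apply: (mates_inj (mates_id d)).
  by rewrite -[mnat_id U]/(idm (U : mod_hom Z Z)) U0; exact: mates0.
move=> f; have [p pf] := comate_of d d f; have [a pa] := sc p.
exists a; apply: (mates_uniq pf); rewrite pa; exact: matesZ (mates_id d).
Qed.

End Duals.

(** As in [nonzero_post], take a nonzero coefficient [t = q • f • j] and [g = j • q]: then
    [t • t = q • (f • g • f) • j], which cannot vanish. *)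
Lemma nonzero_sandwich (k : fieldType) (C : lincat k) (r : nat) (s : 'I_r -> C)
    (S : simples s) (x y : C) (f : hom C x y) :
  f <> 0 -> exists g : hom C y x, f • g • f <> 0.
Proof.
move=> f0; have [g gf0] := nonzero_post S f0; have [h hgf] := nonzero_post S gf0.
have [i [q [j ne]]] : exists i (q : hom C y (s i)) (j : hom C (s i) x),
    q • f • j <> 0.
  apply: contrapT => e; apply: f0; apply: (hom_ext_inc S) => i j.
  apply: (hom_ext_prj S) => i' q; rewrite comp0m compm0 compA.
  case: (eqVneq i i') => [ii|/eqP ii]; last exact: (simple_hom S ii).
  by subst i'; apply: contrapT => ne; apply: e; exists i, q, j.
exists (j • q) => fjqf; apply: ne.
set t := q • f • j; have tt : t • t = 0.
  by rewrite /t -!compA (compA j) (compA f) (compA (f • _)) fjqf comp0m compm0.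
apply: (coef_eq (S := S)); rewrite coef0; apply/eqP; move: (congr1 (coef S) tt).
by rewrite coefM coef0 => /eqP; rewrite mulf_eq0 orbb.
Qed.

(** * Loops and the normalization of dualities *)

Section NormalizedDuals.

Variables (k : fieldType) (C : monoidal k) (Z : modcat C).
Notation E := (mod_hom Z Z).

Lemma dual_iso (W U U' : modfun Z Z) (d : dual W U') (t : @iso k E U U') :
  exists d' : dual W U, forall n, cv d' n = fmap W ((bwd t : modnat _ _) n) • cv d n.
Proof.
pose f := (fwd t : modnat _ _); pose b := (bwd t : modnat _ _).
have bf n : b n • f n = idm _ by have := congr1 (fun s : modnat _ _ => s n) (fwdK t).
have fb n : f n • b n = idm _ by have := congr1 (fun s : modnat _ _ => s n) (bwdK t).
pose e := mnat_comp (dual_ev d) (wr f W); pose c := mnat_comp (wl W b) (dual_cv d).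
have eE n : e n = ev d n • f (W n) by rewrite /e /= fmap_id compm1.
have cE n : c n = fmap W (b n) • cv d n by rewrite /c /= comp1m.
unshelve eexists (@Dual _ _ _ _ _ e c _ _).
- move=> n; rewrite eE cE fmap_comp -!compA (compA (fmap W (f _))) -(fmap_comp W (f _)).
  by rewrite fb fmap_id comp1m (snakeW d n).
- move=> n; rewrite eE cE.
  have -> : ev d (U n) • f (W (U n)) • fmap U (fmap W (b n) • cv d n)
      = ev d (U n) • fmap U' (fmap W (b n)) • (f (W (U' n)) • fmap U (cv d n)).
    by rewrite fmap_comp -!compA (compA (f _)) (mnat_nat f) -!compA.
  rewrite ev_nat (mnat_nat f) -!compA (compA (ev d _)) (snakeU d n) comp1m.
  by rewrite bf.
exact: cE.
Qed.

Section Uniqueness.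

Variables (r : nat) (X : 'I_r -> modfun Z Z) (S : @simples k E r X).
Variables (i : 'I_r) (Y : modfun Z Z) (d2 : dual Y (X i)).

(** By adjunction such maps [e] correspond to endomorphisms of [X i], which are scalars; [s] is the
    endomorphism corresponding to [e]. *)
Lemma ev_unique (e : modnat (mfun_comp (X i) Y) (mfun_id Z)) :
  exists a, forall n, e n = a *: ev d2 n.
Proof.
have [s sE] : exists s : modnat (X i) (X i),
    forall n, s n = e (X i n) • fmap (X i) (cv d2 n).
  exists (mnat_comp (mod_lun_fwd (X i)) (mnat_comp (wr e (X i))
    (mnat_comp (mod_asc_bwd (X i) Y (X i)) (mnat_comp (wl (X i) (dual_cv d2))
    (mod_run_bwd (X i)))))).
  by move=> n; rewrite /= !fmap_id !comp1m !compm1.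
have [a sa] := simple_end S (s : hom E _ _); exists a => n.
have {}sa n' : s n' = a *: idm _ by rewrite sa modnat_scaleE.
have eE : e n = ev d2 n • s (Y n).
  rewrite sE compA -[RHS]compm1.
  have -> : ev d2 n • e (X i (Y n)) = e n • fmap (X i) (fmap Y (ev d2 n)).
    by have := mnat_nat e (ev d2 n).
  by rewrite compm1 -compA -fmap_comp (snakeW d2 n) fmap_id compm1.
by rewrite eE sa compZr compm1.
Qed.

Lemma cv_unique (c : modnat (mfun_id Z) (mfun_comp Y (X i))) :
  exists a, forall n, c n = a *: cv d2 n.
Proof.
have [s sE] : exists s : modnat (X i) (X i),
    forall n, s n = ev d2 (X i n) • fmap (X i) (c n).
  exists (mnat_comp (mod_lun_fwd (X i)) (mnat_comp (wr (dual_ev d2) (X i))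
    (mnat_comp (mod_asc_bwd (X i) Y (X i)) (mnat_comp (wl (X i) c)
    (mod_run_bwd (X i)))))).
  by move=> n; rewrite /= !fmap_id !comp1m !compm1.
have [a sa] := simple_end S (s : hom E _ _); exists a => n.
have {}sa n' : s n' = a *: idm _ by rewrite sa modnat_scaleE.
have cE : c n = fmap Y (s n) • cv d2 n.
  rewrite sE fmap_comp -compA -(cv_nat d2 (c n)) compA.
  by rewrite (snakeW d2 (X i n)) comp1m.
by rewrite cE sa fmapZ fmap_id compZl comp1m.
Qed.

End Uniqueness.

(** A dimension of [W] with values in the endomorphisms of the unit, which need not be scalars. *)
Definition loop (W U : modfun Z Z) (d : dual W U) (d' : dual U W) :
  modnat (mfun_id Z) (mfun_id Z) := mnat_comp (dual_ev d) (dual_cv d').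

Lemma loopE (W U : modfun Z Z) (d : dual W U) (d' : dual U W) n :
  loop d d' n = ev d n • cv d' n.
Proof. by []. Qed.

Lemma loop_comm (z w : modnat (mfun_id Z) (mfun_id Z)) n : z n • w n = w n • z n.
Proof. exact: (mnat_nat z (w n)). Qed.

Section Existence.

Variables (r : nat) (X : 'I_r -> modfun Z Z) (S : @simples k E r X).

Lemma end_act (i : 'I_r) (w : modnat (mfun_id Z) (mfun_id Z)) n :
  w (X i n) = coef S (mnat_comp (mod_lun_fwd (X i)) (mnat_comp (wr w (X i)) (mod_lun_bwd (X i)))
     : hom E (X i) (X i)) *: idm (X i n).
Proof.
have := coefE S (mnat_comp (mod_lun_fwd (X i)) (mnat_comp (wr w (X i)) (mod_lun_bwd (X i)))
     : hom E (X i) (X i)).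
move/(congr1 (fun s : modnat _ _ => s n)); rewrite modnat_scaleE => <- /=.
by rewrite ?fmap_id ?comp1m ?compm1.
Qed.

Lemma end_ract (i : 'I_r) (w : modnat (mfun_id Z) (mfun_id Z)) :
  exists a, forall n, fmap (X i) (w n) = a *: idm (X i n).
Proof.
have [a aE] := simple_end S (mnat_comp (mod_run_fwd (X i)) (mnat_comp (wl (X i) w)
  (mod_run_bwd (X i))) : hom E (X i) (X i)).
exists a => n; have := congr1 (fun s : modnat _ _ => s n) aE.
by rewrite modnat_scaleE => <- /=; rewrite ?fmap_id ?comp1m ?compm1.
Qed.

(** An endomorphism of the unit slides by naturality into the loop and onto the strand [X i], where
    it acts by a scalar. *)
Lemma loop_ract (i : 'I_r) (Y : modfun Z Z) (d1 : dual (X i) Y) (d2 : dual Y (X i))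
    (w : modnat (mfun_id Z) (mfun_id Z)) a :
  (forall n, fmap (X i) (w n) = a *: idm (X i n)) ->
  mnat_comp w (loop d1 d2) = a *: loop d1 d2.
Proof.
move=> wa; apply: modnat_eq => n; rewrite modnat_scaleE.
rewrite [LHS]compA -(ev_nat d1 (w n)) wa fmapZ fmap_id compZr compm1.
by rewrite compZl.
Qed.

Lemma loop_lact (i : 'I_r) (Y : modfun Z Z) (d1 : dual (X i) Y) (d2 : dual Y (X i))
    (w : modnat (mfun_id Z) (mfun_id Z)) a :
  (forall n, w (X i n) = a *: idm (X i n)) ->
  mnat_comp w (loop d2 d1) = a *: loop d2 d1.
Proof.
move=> wa; apply: modnat_eq => n; rewrite modnat_scaleE [LHS]compA.
have -> : w n • ev d2 n = ev d2 n • w (X i (Y n)) by have := mnat_nat w (ev d2 n).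
by rewrite wa compZr compm1 compZl.
Qed.

(** If the factor were 0, then [z • g • z] would vanish for every [g], against
    [nonzero_sandwich]. *)
Lemma scalar_square (z : modnat (mfun_id Z) (mfun_id Z)) :
  (forall w : modnat (mfun_id Z) (mfun_id Z), exists a, mnat_comp w z = a *: z) -> z <> 0 ->
  exists2 c, c != 0 & mnat_comp z z = c *: z.
Proof.
move=> zP z0; have [c zz] := zP z; exists c => //; apply/eqP => c0.
have [g gz] := nonzero_sandwich S (f := z : hom E (mfun_id Z) (mfun_id Z)) z0.
apply: gz; have [a ga] := zP g; rewrite -compA [_ • _ as X in _ • X]ga compZr.
by rewrite [_ • _]zz c0 scale0r scaler0.
Qed.

(** A map [e] with [e • cv] nonzero has a nonzero mate [s] from [X i] to its double dual. Both are
    bricks, so they are isomorphic, and [Y] is a dual of [X i] on either side. Evaluations and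
    coevaluations being unique up to a scalar, neither loop vanishes. *)
Lemma normalized_duals (i : 'I_r) :
  (exists (Y : modfun Z Z) (d : dual (X i) Y) (X' : modfun Z Z) (d' : dual Y X'), True) ->
  exists (Y : modfun Z Z) (d1 : dual (X i) Y) (d2 : dual Y (X i)) (m : k),
    [/\ loop d1 d2 <> 0, mnat_comp (loop d1 d2) (loop d1 d2) = loop d1 d2, m != 0,
      mnat_comp (loop d2 d1) (loop d2 d1) = m *: loop d2 d1 & loop d2 d1 <> 0].
Proof.
move=> [Y [d1 [X' [d' _]]]].
have nzX : idm (X i : E) <> 0 := simple_nz S (i := i).
have bX' : @brick k E X' := brick_dual d' (brick_dual d1 (simple_brick S i)).
have ev0 : dual_ev d1 <> 0.
  move=> e0; apply: nzX; apply: modnat_eq => n; rewrite [LHS]/= -(snakeW d1 n).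
  by rewrite /ev e0 fmap0 comp0m.
have cv0 : dual_cv d1 <> 0.
  move=> e0; apply: nzX; apply: modnat_eq => n; rewrite [LHS]/= -(snakeW d1 n).
  by rewrite /cv e0 compm0.
have [e eP] := nonzero_sandwich S (f := dual_cv d1 : hom E _ _) cv0.
have [c cP] := nonzero_sandwich S (f := dual_ev d1 : hom E _ _) ev0.
have {eP} e0 : mnat_comp e (dual_cv d1) <> 0.
  by move=> e0; apply: eP; rewrite -compA [_ • _ as X in _ • X]e0 compm0.
have {cP} c0 : mnat_comp (dual_ev d1) c <> 0.
  by move=> c0; apply: cP; rewrite [_ • _ as X in X • _]c0 comp0m.
have [s sE] : exists s : modnat (X i) X',
    forall n, s n = e (X' n) • fmap (X i) (cv d' n).
  exists (mnat_comp (mod_lun_fwd X') (mnat_comp (wr e X')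
    (mnat_comp (mod_asc_bwd (X i) Y X') (mnat_comp (wl (X i) (dual_cv d'))
    (mod_run_bwd (X i)))))).
  by move=> n; rewrite /= !fmap_id !comp1m !compm1.
have s0 : s <> 0.
  move=> s0; apply: e0; apply: modnat_eq => n; rewrite [RHS]/=.
  suff -> : mnat_comp e (dual_cv d1) n = ev d' n • s (Y n) • cv d1 n.
    by rewrite s0 compm0 comp0m.
  congr (_ • _); rewrite sE compA -[LHS]compm1.
  have -> : ev d' n • e (X' (Y n)) = e n • fmap (X i) (fmap Y (ev d' n)).
    by have := mnat_nat e (ev d' n).
  by rewrite -compA -fmap_comp (snakeW d' n) fmap_id.
have [t] := brick_iso S (simple_brick S i) bX' s0.
have [d2 _] := dual_iso d' t.
have l1 : loop d1 d2 <> 0.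
  move=> l1; apply: c0; have [a ca] := cv_unique S d2 c.
  apply: modnat_eq => n; rewrite [LHS]/= ca compZr.
  have := congr1 (fun z : modnat _ _ => z n) l1; rewrite loopE /ev => ->.
  by rewrite scaler0.
have l2 : loop d2 d1 <> 0.
  move=> l2; apply: e0; have [a ca] := ev_unique S d2 e.
  apply: modnat_eq => n; rewrite [LHS]/= ca compZl.
  have := congr1 (fun z : modnat _ _ => z n) l2; rewrite loopE /cv => ->.
  by rewrite scaler0.
have [a a0 l1a] : exists2 c, c != 0 & mnat_comp (loop d1 d2) (loop d1 d2) = c *: loop d1 d2.
  apply: scalar_square l1 => w; have [b wb] := end_ract i w.
  by exists b; exact: loop_ract.
have [b b0 l2b] : exists2 c, c != 0 & mnat_comp (loop d2 d1) (loop d2 d1) = c *: loop d2 d1.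
  apply: scalar_square l2 => w; eexists; apply: loop_lact => n; exact: end_act.
(* Rescaling the second duality by [a] makes the first loop idempotent. The scalar of the other loop
   becomes [a * b], which does not depend on the initial scale of [d2]. *)
have [d3 [evE cvE]] : exists d3 : dual Y (X i),
    (dual_ev d3 = a *: dual_ev d2) /\ (dual_cv d3 = a^-1 *: dual_cv d2).
  unshelve eexists (@Dual _ _ _ _ _ (a *: dual_ev d2) (a^-1 *: dual_cv d2) _ _) => //.
    move=> n; rewrite !modnat_scaleE fmapZ compZl compZr scalerA mulfV // scale1r.
    exact: (snakeW d2 n).
  move=> n; rewrite !modnat_scaleE fmapZ compZl compZr scalerA mulfV // scale1r.
  exact: (snakeU d2 n).
have L1 : loop d1 d3 = a^-1 *: loop d1 d2.
  by apply: modnat_eq => n; rewrite modnat_scaleE !loopE /cv cvE modnat_scaleE compZr.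
have L2 : loop d3 d1 = a *: loop d2 d1.
  by apply: modnat_eq => n; rewrite modnat_scaleE !loopE /ev evE modnat_scaleE compZl.
have sq c' (z : modnat (mfun_id Z) (mfun_id Z)) : mnat_comp (c' *: z) (c' *: z) = (c' * c') *: mnat_comp z z.
  apply: modnat_eq => n; change ((c' *: z) n • (c' *: z) n = ((c' * c') *: mnat_comp z z) n).
  by rewrite !modnat_scaleE compZl compZr scalerA.
exists Y, d1, d3, (a * b); split.
- rewrite L1 => /eqP; rewrite scaler_eq0 invr_eq0 (negbTE a0) /= => /eqP; exact: l1.
- by rewrite L1 sq l1a scalerA mulfVK.
- by rewrite mulf_neq0.
- by rewrite L2 sq l2b !scalerA mulrAC.
rewrite L2 => /eqP; rewrite scaler_eq0 (negbTE a0) /= => /eqP; exact: l2.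
Qed.

End Existence.

End NormalizedDuals.

(* Both dualities [Y i -| X i -| Y i], normalized so that [loop (d1 i) (d2 i)]
   is idempotent; then [m i] plays the role of the squared norm of [X i]. *)
Record balanced (k : fieldType) (C : monoidal k) (Z : modcat C) (r : nat)
    (X : 'I_r -> modfun Z Z) := Balanced {
  bal_dual : 'I_r -> modfun Z Z;
  bal1 : forall i, dual (X i) (bal_dual i);
  bal2 : forall i, dual (bal_dual i) (X i);
  bal_norm : 'I_r -> k;
  bal_loop1_nz : forall i, loop (bal1 i) (bal2 i) <> 0;
  bal_loop1_sq : forall i, mnat_comp (loop (bal1 i) (bal2 i)) (loop (bal1 i) (bal2 i))
    = loop (bal1 i) (bal2 i);
  bal_norm_nz : forall i, bal_norm i != 0;
  bal_loop2_sq : forall i, mnat_comp (loop (bal2 i) (bal1 i)) (loop (bal2 i) (bal1 i))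
    = bal_norm i *: loop (bal2 i) (bal1 i);
  bal_loop2_nz : forall i, loop (bal2 i) (bal1 i) <> 0
}.

(** * Partial traces and rotation *)

Section Fusion.

Variables (k : fieldType) (C : monoidal k) (Z : modcat C).
Notation E := (mod_hom Z Z).
Notation "F ⊙ G" := (mfun_comp F G) (at level 39, left associativity).
Variables (r : nat) (X : 'I_r -> modfun Z Z) (S : @simples k E r X) (B : balanced X).
Notation Y := (bal_dual B).
Notation d1 := (bal1 B).
Notation d2 := (bal2 B).
Notation m := (bal_norm B).

Let loop1_nz i : loop (d1 i) (d2 i) <> 0 := bal_loop1_nz (i := i).
Let loop1_sq i := bal_loop1_sq B i.
Let m_nz i : m i != 0 := bal_norm_nz B i.
Let loop2_sq i := bal_loop2_sq B i.
Let loop2_nz i : loop (d2 i) (d1 i) <> 0 := bal_loop2_nz (i := i).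

(** Squaring the common value [a *: z] of both sides multiplies it by [a * c] and by [b * c']. If
    that value is 0, so are [a] and [b]. *)
Lemma scalar_compare (z z' : modnat (mfun_id Z) (mfun_id Z)) (c c' a b : k) :
  z <> 0 -> z' <> 0 -> mnat_comp z z = c *: z -> mnat_comp z' z' = c' *: z' ->
  a *: z = b *: z' -> a * c = b * c'.
Proof.
move=> z0 z'0 zz zz' ab.
have sq c0 (w : modnat (mfun_id Z) (mfun_id Z)) :
    mnat_comp (c0 *: w) (c0 *: w) = (c0 * c0) *: mnat_comp w w.
  apply: modnat_eq => n; change ((c0 *: w) n • (c0 *: w) n = ((c0 * c0) *: mnat_comp w w) n).
  by rewrite !modnat_scaleE compZl compZr scalerA.
have : (a * (a * c)) *: z = (a * (b * c')) *: z.
  rewrite mulrA -scalerA -zz -sq ab sq zz' scalerA.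
  rewrite [a * _]mulrC -[RHS]scalerA ab scalerA; congr (_ *: _).
  by rewrite mulrAC.
have nz (w : modnat (mfun_id Z) (mfun_id Z)) x y : w <> 0 -> x *: w = y *: w -> x = y.
  move=> w0 /eqP; rewrite -subr_eq0 -scalerBl scaler_eq0 => /orP[|/eqP //].
  by rewrite subr_eq0 => /eqP.
move/(nz _ _ _ z0); case: (eqVneq a 0) => [a0 _|a0 /(mulfI a0) //].
rewrite a0 mul0r; move: ab; rewrite a0 scale0r -(scale0r z') => /(nz _ _ _ z'0) <-.
by rewrite mul0r.
Qed.

Lemma scal_at (i : 'I_r) (f : modnat (X i) (X i)) n :
  f n = coef S (f : hom E _ _) *: idm (X i n).
Proof.
by have := congr1 (fun s : modnat _ _ => s n) (coefE S (f : hom E _ _)); rewrite modnat_scaleE.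
Qed.

Lemma scal_of (i : 'I_r) (f : modnat (X i) (X i)) a :
  (forall n, f n = a *: idm (X i n)) -> coef S (f : hom E _ _) = a.
Proof.
move=> fa; rewrite -[RHS](@coef_scal _ _ _ _ S i); congr coef.
by apply: modnat_eq => n; rewrite modnat_scaleE fa.
Qed.

(** The partial trace closing the left strand [X i]; [rtr] closes the right strand. *)
Definition ltr (i : 'I_r) (V : modfun Z Z) (f : modnat (X i ⊙ V) (X i ⊙ V)) : modnat V V :=
  mnat_comp (mod_lun_fwd V) (mnat_comp (wr (dual_ev (d1 i)) V)
   (mnat_comp (mod_asc_bwd (Y i) (X i) V) (mnat_comp (wl (Y i) f)
   (mnat_comp (mod_asc_fwd (Y i) (X i) V) (mnat_comp (wr (dual_cv (d2 i)) V)
   (mod_lun_bwd V)))))).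

Lemma ltrE i V f n :
  @ltr i V f n = ev (d1 i) (V n) • fmap (Y i) (f n) • cv (d2 i) (V n).
Proof. by rewrite /= !fmap_id !comp1m !compm1 compA. Qed.

Definition rtr (V : modfun Z Z) (j : 'I_r) (f : modnat (V ⊙ X j) (V ⊙ X j)) : modnat V V :=
  mnat_comp (mod_run_fwd V) (mnat_comp (wl V (dual_ev (d2 j)))
   (mnat_comp (mod_asc_fwd V (X j) (Y j)) (mnat_comp (wr f (Y j))
   (mnat_comp (mod_asc_bwd V (X j) (Y j)) (mnat_comp (wl V (dual_cv (d1 j)))
   (mod_run_bwd V)))))).

Lemma rtrE V j f n :
  @rtr V j f n = fmap V (ev (d2 j) n) • f (Y j n) • fmap V (cv (d1 j) n).
Proof. by rewrite /= !fmap_id !comp1m !compm1 compA. Qed.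

Definition lam (i j : 'I_r) (f : modnat (X i ⊙ X j) (X i ⊙ X j)) : k :=
  coef S (ltr f : hom E _ _).

Lemma lam_at i j (f : modnat (X i ⊙ X j) (X i ⊙ X j)) n :
  ev (d1 i) (X j n) • fmap (Y i) (f n) • cv (d2 i) (X j n) = lam f *: idm (X j n).
Proof. by rewrite -ltrE scal_at. Qed.

Lemma lam_lin i j a (f g : modnat (X i ⊙ X j) (X i ⊙ X j)) :
  lam (a *: f + g) = a * lam f + lam g.
Proof.
rewrite /lam -coefZ -coefD; congr coef; apply: modnat_eq => n.
rewrite ltrE -[X in _ = mnat X n]/(a *: ltr f + ltr g) !mnat_linE !ltrE.
by rewrite fmap_lin comp_linr comp_linl.
Qed.

(* Both sides compute the full trace. *)
Lemma rtr_lam i j (f : modnat (X i ⊙ X j) (X i ⊙ X j)) n :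
  rtr f n = (m j * lam f) *: idm (X i n).
Proof.
rewrite scal_at; congr (_ *: _); set rho := coef S _.
rewrite mulrC -[LHS]mulr1.
apply: (scalar_compare (loop1_nz (i := i)) (loop2_nz (i := j)) _ (loop2_sq j)).
  by rewrite scale1r loop1_sq.
apply: modnat_eq => q; rewrite !modnat_scaleE !loopE.
transitivity (ev (d1 i) q • fmap (Y i) (rtr f q) • cv (d2 i) q).
  by rewrite scal_at fmapZ fmap_id compZr compZl compm1.
rewrite rtrE !fmap_comp !compA (ev_nat (d1 i) (ev (d2 j) q)) -!compA -cv_nat.
rewrite (compA (fmap (Y i) (f _))) (compA (ev (d1 i) _)) compA (compA (ev (d1 i) _)).
by rewrite lam_at compZr compm1 compZl.
Qed.

Section Rotation.

Variables (i j l : 'I_r).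
Notation W := (X i ⊙ X j).

(* [p'] is obtained from [p] by taking mates twice, once for each of the two
   dualities; it need not be a multiple of [p], as no pivotal structure is given. *)
Lemma rotation (p : modnat (X l) W) : exists p' : modnat (X l) W,
  forall F : modnat W (X l),
    coef S (mnat_comp F p : hom E _ _) = lam (mnat_comp p' F) /\
    m l * coef S (mnat_comp F p' : hom E _ _) = m i * m j * lam (mnat_comp p F).
Proof.
have [D1 [ev1 cv1]] := dual_comp (d1 i) (d1 j).
have [D2 [ev2 cv2]] := dual_comp (d2 j) (d2 i).
(* Dualizing [p] with one duality and undoing this with the other amounts to a full turn. *)
have [ps [psE1 psE2]] := comate_of D2 (d2 l) p.
have [p' [p'E1 p'E2]] := comate_of (d1 l) D1 ps.
exists p' => F.
have [Fd [FdE1 FdE2]] := comate_of (d2 l) D2 F.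
have [Fs [FsE1 FsE2]] := mate_of D1 (d1 l) F.
split.
  (* On the loop of [X l], the dual of [F • p] is moved back piece by piece: [ps] becomes [p']
     across the evaluation and [Fd] becomes [F] across the coevaluation. What remains is the trace
     of [p' • F] over both strands. *)
  have Fp := mates_comp (conj FdE1 FdE2) (conj psE1 psE2).
  have pF : mnat_comp ps Fd = coef S (mnat_comp F p : hom E _ _) *: mnat_id (Y l).
    apply: (mates_inj Fp).
    have := matesZ (coef S (mnat_comp F p : hom E _ _)) (mates_id (d2 l)).
    by rewrite -[X in mates _ _ _ X -> _](coefE S (mnat_comp F p : hom E _ _)).
  rewrite -[LHS]mulr1 -[RHS]mulr1.
  apply: (scalar_compare (loop1_nz (i := l)) (loop1_nz (i := j))).
  - by rewrite scale1r loop1_sq.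
  - by rewrite scale1r loop1_sq.
  apply: modnat_eq => n; rewrite !modnat_scaleE !loopE.
  transitivity (ev (d1 l) n • (mnat_comp ps Fd) (X l n) • cv (d2 l) n).
    by rewrite pF modnat_scaleE compZr compZl compm1.
  rewrite [mnat_comp ps Fd _]/= -!compA FdE2 compA p'E1 ev1 cv2 /=.
  rewrite -!compA (compA (fmap (Y j) (fmap (Y i) (p' n)))) -!fmap_comp.
  rewrite (compA (fmap (Y j) _)) (compA (fmap (Y j) _)) -!fmap_comp.
  rewrite (compA (ev (d1 i) _)).
  have := lam_at (mnat_comp p' F) n; rewrite [mnat_comp p' F n]/= => ->.
  by rewrite fmapZ fmap_id compZl comp1m compZr.
have Fp := mates_comp (conj p'E1 p'E2) (conj FsE1 FsE2).
have pF : mnat_comp ps Fs = coef S (mnat_comp F p' : hom E _ _) *: mnat_id (Y l).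
  apply: (mates_uniq Fp).
  have := matesZ (coef S (mnat_comp F p' : hom E _ _)) (mates_id (d1 l)).
  by rewrite -[X in mates _ _ X _ -> _](coefE S (mnat_comp F p' : hom E _ _)).
rewrite mulrC (_ : m i * m j * _ = m j * lam (mnat_comp p F) * m i); last first.
  by rewrite -mulrA mulrC.
apply: (scalar_compare (loop2_nz (i := l)) (loop2_nz (i := i))) => //.
apply: modnat_eq => n; rewrite !modnat_scaleE !loopE.
transitivity (ev (d2 l) n • fmap (X l) ((mnat_comp ps Fs) n) • cv (d1 l) n).
  by rewrite pF modnat_scaleE fmapZ fmap_id compZr compZl compm1.
rewrite [mnat_comp ps Fs _]/= fmap_comp compA -psE1 -!compA -FsE2 ev2 cv1.
rewrite -!compA.
have := rtr_lam (mnat_comp p F) (Y i n); rewrite rtrE [mnat_comp p F _]/=.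
rewrite -!compA => H.
transitivity (ev (d2 i) n • (fmap (X i) (ev (d2 j) (Y i n)) • (p (Y j (Y i n)) •
  (F (Y j (Y i n)) • fmap (X i) (cv (d1 j) (Y i n))))) • cv (d1 i) n).
  by rewrite -!compA.
by rewrite H compZr compm1 compZl.
Qed.

End Rotation.

Section Lambda.

Variables (i j l : 'I_r).
Notation W := (X i ⊙ X j).
Notation D := (simple_dec S (W : E)).

Definition inm (a : 'I_(mult D l)) : modnat (X l) W := inc a.
Definition prm (a : 'I_(mult D l)) : modnat W (X l) := prj a.

Lemma lam_comp_lin (F : modnat W (X l)) :
  linear (fun p : modnat (X l) W => lam (mnat_comp p F) : k^o).
Proof.
move=> x p q; rewrite -lam_lin; congr lam; exact: (comp_linl (F : hom E W (X l))).
Qed.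

Definition Lam : 'M[k]_(mult D l) := \matrix_(a, b) lam (mnat_comp (inm a) (prm b)).

(** Let [p'] be the rotation of the basis vector [inm a]. The first equation of [rotation] says that
    tracing [p'] against [prm b] gives the Kronecker delta; the second says that the coordinates of
    [p'] are, up to [m i * m j / m l], the row [a] of [Lam]. *)
Lemma Lam_square : Lam *m Lam = (m l / (m i * m j))%:M.
Proof.
apply/matrixP=> a b; rewrite !mxE; under eq_bigr do rewrite !mxE.
have [p' pP] := rotation (inm a).
have [e _] := pP (prm b); move: e.
have -> : coef S (mnat_comp (prm b) (inm a) : hom E _ _) = (a == b)%:R.
  have := prj_inc b a; rewrite eq_sym => e; rewrite -[RHS](@coef_scal _ _ _ _ S l).
  by congr coef; exact: e.
move=> e; rewrite -mulr_natr -[(a == b)%:R]/((a == b)%:R) e.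
have pE := expand_inc S (p' : hom E _ _).
have mij : m i * m j != 0 by rewrite mulf_neq0.
have cE c : lam (mnat_comp (inm a) (prm c)) =
    (m l / (m i * m j)) * coef S ((prm c : hom E _ _) • (p' : hom E _ _)).
  have [_ e'] := pP (prm c).
  rewrite -[LHS](mulKf mij) -e' mulrA; congr (_ * _); exact: mulrC.
under eq_bigr do rewrite cE -mulrA.
rewrite -mulr_sumr; congr (_ * _).
rewrite [in RHS]pE (lin_sum (lam_comp_lin (prm b))); apply: eq_bigr => c _.
by rewrite (linZ (lam_comp_lin (prm b))).
Qed.

End Lambda.

End Fusion.

(** * Averaging *)

Section Averaging.

Variables (k : fieldType) (C : monoidal k) (Z : modcat C).
Notation E := (mod_hom Z Z).
Notation "F ⊙ G" := (mfun_comp F G) (at level 39, left associativity).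
Variables (r : nat) (X : 'I_r -> modfun Z Z) (S : @simples k E r X) (B : balanced X).
Notation Y := (bal_dual B).
Notation d1 := (bal1 B).
Notation d2 := (bal2 B).
Notation m := (bal_norm B).

Lemma dual_hom0 i j : i <> j -> forall f : modnat (Y i) (Y j), f = 0.
Proof.
move=> ij f; have [p pf] := comate_of (d1 j) (d1 i) f.
apply: (mates_uniq pf); have -> : p = 0 := simple_hom S (nesym ij) p.
exact: mates0.
Qed.

Lemma dual_end i (f : modnat (Y i) (Y i)) : exists a, forall n, f n = a *: idm (Y i n).
Proof.
have [_ e] := brick_dual (d1 i) (simple_brick S i).
have [a fa] := e f; exists a => n; have := congr1 (fun s : modnat _ _ => s n) fa.
by rewrite modnat_scaleE.
Qed.

(** Duality is injective on the finitely many classes of simple objects, hence surjective. *)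
Lemma dual_cover j : exists i, @isomorphic k E (Y i) (X j).
Proof.
have /choice[st stP] i : exists j, @isomorphic k E (Y i) (X j).
  exact: (@brick_simple k E r X S (Y i : E) (brick_dual (d1 i) (simple_brick S i))).
have st_inj : injective st.
  move=> i i' e; apply: contrapT => ii'; have := stP i'; rewrite -e => ii.
  have [f] := isomorphic_trans (stP i) (isomorphic_sym ii).
  have [nz _] := brick_dual (d1 i) (simple_brick S i).
  by apply: nz; rewrite -(fwdK f) [fwd f](dual_hom0 ii') compm0.
have /codomP[i ->] := injF_onto st_inj j; by exists i.
Qed.

Lemma hom_ext_dual (U V : modfun Z Z) (f g : modnat U V) :
  (forall j (q : modnat V (Y j)), mnat_comp q f = mnat_comp q g) -> f = g.
Proof.
move=> fg; apply: (hom_ext_prj S (f := f : hom E U V)) => j q.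
have [i [t]] := dual_cover j.
apply: (iso_monic (f := iso_sym t)); rewrite !compA.
exact: (fg i (t⁻ • q)).
Qed.

Section HalfMates.

Variables (W : modfun Z Z) (i j : 'I_r).

(** The bijection that bends both [X] strands and leaves [W] in place. [half_comates] does the same
    for maps in the opposite direction, with the other duality. *)
Definition half_mates (f : modnat (W ⊙ X j) (X i)) (h : modnat (Y i ⊙ W) (Y j)) :=
  (forall n, ev (d1 j) n • h (X j n) = ev (d1 i) n • fmap (Y i) (f n)) /\
  (forall n, f (Y j n) • fmap W (cv (d1 j) n) = fmap (X i) (h n) • cv (d1 i) (W n)).

Lemma half_mate_of f : exists h, half_mates f h.
Proof.
exists (mnat_comp (mod_lun_fwd (Y j)) (mnat_comp (wr (dual_ev (d1 i)) (Y j))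
  (mnat_comp (mod_asc_bwd (Y i) (X i) (Y j)) (mnat_comp (wl (Y i) (wr f (Y j)))
  (mnat_comp (wl (Y i) (mod_asc_bwd W (X j) (Y j))) (mnat_comp (wl (Y i) (wl W (dual_cv (d1 j))))
  (wl (Y i) (mod_run_bwd W)))))))).
split=> n; rewrite /= !fmap_id !comp1m !compm1 -!/(ev _ _) -!/(cv _ _).
  rewrite compA -ev_nat -compA; congr (_ • _); rewrite -!fmap_comp; congr fmap.
  rewrite compA; have -> : fmap (X i) (ev (d1 j) n) • f (Y j (X j n))
      = f n • fmap W (fmap (X j) (ev (d1 j) n)) by rewrite (mnat_nat f).
  by rewrite -compA -fmap_comp (snakeW (d1 j) n) fmap_id compm1.
rewrite !fmap_comp -!compA (compA (fmap (X i) (fmap (Y i) (f _)))).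
rewrite -(fmap_comp (X i) (fmap (Y i) (f _))) -(fmap_comp (Y i) (f _)) -cv_nat compA.
by rewrite (snakeW (d1 i) (Y j n)) comp1m.
Qed.

Lemma half_comate_of h : exists f, half_mates f h.
Proof.
exists (mnat_comp (mod_run_fwd (X i)) (mnat_comp (wl (X i) (dual_ev (d1 j)))
  (mnat_comp (wl (X i) (wr h (X j))) (mnat_comp (wl (X i) (mod_asc_bwd (Y i) W (X j)))
  (mnat_comp (mod_asc_fwd (X i) (Y i) (W ⊙ X j)) (mnat_comp (wr (dual_cv (d1 i)) (W ⊙ X j))
  (mod_lun_bwd (W ⊙ X j)))))))).
split=> n; rewrite /= !fmap_id !comp1m !compm1 -!/(ev _ _) -!/(cv _ _); last first.
  rewrite -!compA cv_nat.
  rewrite (compA (fmap (X i) (h _))) (compA (fmap (X i) (ev _ _))) -!fmap_comp; congr (fmap _ _ • _).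
  have -> : h (X j (Y j n)) • fmap (Y i) (fmap W (cv (d1 j) n)) = fmap (Y j) (cv (d1 j) n) • h n.
    by rewrite -(mnat_nat h).
  by rewrite compA (snakeU (d1 j) n) comp1m.
rewrite !fmap_comp !compA (ev_nat (d1 i) (ev (d1 j) n)) -(compA (ev (d1 j) n)).
rewrite ev_nat -!compA; congr (_ • _).
by rewrite (snakeU (d1 i) (W (X j n))) compm1.
Qed.

Lemma half_mates_uniq f h h' : half_mates f h -> half_mates f h' -> h = h'.
Proof.
move=> [hE _] [hE' _]; apply: modnat_eq => n.
have aux (s : modnat (Y i ⊙ W) (Y j)) :
    s n = ev (d1 j) (Y j n) • s (X j (Y j n)) • fmap (Y i) (fmap W (cv (d1 j) n)).
  by rewrite -compA (mnat_nat s) compA (snakeU (d1 j) n) comp1m.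
by rewrite aux [RHS]aux hE hE'.
Qed.

Lemma half_mates0 : half_mates 0 0.
Proof. by split=> n; rewrite /= ?fmap0 ?compm0 ?comp0m. Qed.

Lemma half_mates_lin a f f' h h' :
  half_mates f h -> half_mates f' h' -> half_mates (a *: f + f') (a *: h + h').
Proof.
move=> [p1 p2] [q1 q2]; split=> n; rewrite !mnat_linE.
  by rewrite comp_linr fmap_lin comp_linr p1 q1.
by rewrite comp_linl fmap_lin comp_linl p2 q2.
Qed.

Definition half_comates (p : modnat (X i) (W ⊙ X j)) (g : modnat (Y j) (Y i ⊙ W)) :=
  (forall n, fmap W (ev (d2 j) n) • p (Y j n) = ev (d2 i) (W n) • fmap (X i) (g n)) /\
  (forall n, g (X j n) • cv (d2 j) n = fmap (Y i) (p n) • cv (d2 i) n).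

Lemma coev_mate_of p : exists g, half_comates p g.
Proof.
exists (mnat_comp (wl (Y i) (mod_run_fwd W)) (mnat_comp (wl (Y i) (wl W (dual_ev (d2 j))))
  (mnat_comp (wl (Y i) (mod_asc_fwd W (X j) (Y j))) (mnat_comp (wl (Y i) (wr p (Y j)))
  (mnat_comp (mod_asc_fwd (Y i) (X i) (Y j)) (mnat_comp (wr (dual_cv (d2 i)) (Y j))
  (mod_lun_bwd (Y j)))))))).
split=> n; rewrite /= !fmap_id !comp1m !compm1 -!/(ev _ _) -!/(cv _ _).
  rewrite !fmap_comp !compA (ev_nat (d2 i) (fmap W _)) -!compA; congr (_ • _).
  by rewrite (compA (ev _ _)) ev_nat -compA (snakeU (d2 i) (Y j n)) compm1.
rewrite -!compA (cv_nat (d2 i) (cv (d2 j) n)) (compA (fmap (Y i) (p _))).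
rewrite (compA (fmap (Y i) _)) -!fmap_comp; congr (fmap _ _ • _).
have -> : p (Y j (X j n)) • fmap (X i) (cv (d2 j) n) = fmap W (fmap (X j) (cv (d2 j) n)) • p n.
  by rewrite (mnat_nat p).
by rewrite compA -fmap_comp (snakeU (d2 j) n) fmap_id comp1m.
Qed.

End HalfMates.

Section Resolution.

Variables (W : modfun Z Z) (i : 'I_r).
Notation D j := (simple_dec S (W ⊙ X j : E)).

Variables (h : forall j, 'I_(mult (D j) i) -> modnat (Y i ⊙ W) (Y j))
  (g : forall j, 'I_(mult (D j) i) -> modnat (Y j) (Y i ⊙ W)).
Hypothesis hP : forall j (a : 'I_(mult (D j) i)), half_mates (prj a) (h a).
Hypothesis gP : forall j (a : 'I_(mult (D j) i)), half_comates (inc a) (g a).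

(** Placed on the loop of [X j], the composite turns by the half mates into [prj a • inc b] on the
    loop of [X i]. Both loops are idempotent, so comparing them introduces no factor. *)
Lemma hg_scal j (a b : 'I_(mult (D j) i)) :
  mnat_comp (h a) (g b) = (a == b)%:R *: mnat_id (Y j).
Proof.
have [x xE] := dual_end (mnat_comp (h a) (g b)).
have [h1 _] := hP a; have [_ g2] := gP b.
have -> : (a == b)%:R = x.
  rewrite -[LHS]mulr1 -[RHS]mulr1.
  apply: (@scalar_compare k C Z (loop (d1 i) (d2 i)) (loop (d1 j) (d2 j))).
  - exact: bal_loop1_nz.
  - exact: bal_loop1_nz.
  - by rewrite scale1r bal_loop1_sq.
  - by rewrite scale1r bal_loop1_sq.
  apply: modnat_eq => n; rewrite !modnat_scaleE !loopE.
  transitivity (ev (d1 j) n • (mnat_comp (h a) (g b)) (X j n) • cv (d2 j) n); last first.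
    by rewrite xE compZr compm1 compZl.
  rewrite [mnat_comp (h a) (g b) _]/= -!compA g2 compA h1 -!compA (compA (fmap _ _)) -fmap_comp.
  have e := congr1 (fun s : modnat _ _ => s n) (prj_inc a b); rewrite modnat_scaleE in e.
  by rewrite [(prj a : modnat _ _) n • _]e fmapZ fmap_id compZl comp1m compZr.
by apply: modnat_eq => n; rewrite xE modnat_scaleE.
Qed.

(** It suffices to compose with maps to the objects [Y j] ([hom_ext_dual]). Those are combinations
    of the [h a], being half mates of combinations of the [prj a], and the [g a] are dual to
    them. *)
Lemma resolution n :
  \sum_(j < r) \sum_(a < mult (D j) i) g a n • h a n = idm (Y i (W n)).
Proof.
suff e : \sum_(j < r) \sum_(a < mult (D j) i) (g a : hom E _ _) • (h a : hom E (Y i ⊙ W) _) = idm (Y i ⊙ W : E).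
  have := congr1 (fun s : modnat _ _ => s n) e; rewrite modnat_sumE [RHS]/= => <-.
  by apply: eq_bigr => j _; rewrite modnat_sumE.
apply: hom_ext_dual => j q; have [f fq] := half_comate_of q.
have qE : (q : hom E _ _) = \sum_(a < mult (D j) i) coef S ((f : hom E _ _) • inc a) *: (h a : hom E _ _).
  apply: (half_mates_uniq fq).
  rewrite [X in half_mates X](expand_prj S (f : hom E (W ⊙ X j) (X i))).
  elim/big_rec2 : _ => [|a y y' _ H]; first exact: half_mates0.
  exact: half_mates_lin.
have e l (a : 'I_(mult (D j) i)) (b : 'I_(mult (D l) i)) :
    j <> l -> mnat_comp (h a) (g b) = 0.
  by move=> /nesym jl; exact: dual_hom0 jl _.
transitivity q; last by apply: modnat_eq => n' /=; rewrite compm1.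
rewrite -[LHS]/((q : hom E (Y i ⊙ W) (Y j)) • _) comp_sumr (big_only1 j) //; last first.
  move=> l /eqP jl _; rewrite comp_sumr big1 // => b _; rewrite qE comp_suml big1 // => a _.
  rewrite compZl compA; have -> : (h a : hom E _ _) • (g b : hom E _ _) = 0 := e l a b (nesym jl).
  by rewrite comp0m scaler0.
rewrite comp_sumr [RHS]qE; apply: eq_bigr => b _; rewrite {1}qE comp_suml.
rewrite (big_only1 b) // => [|a ab _].
  rewrite compZl compA; congr (_ *: _).
  have -> : (h b : hom E _ _) • (g b : hom E _ _) = idm _.
    by have := hg_scal b b; rewrite eqxx scale1r.
  by rewrite comp1m.
rewrite compZl compA.
have -> : (h a : hom E _ _) • (g b : hom E _ _) = 0.
  by have := hg_scal a b; rewrite (negbTE ab) scale0r.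
by rewrite comp0m scaler0.
Qed.

End Resolution.

Section Average.

Variables (M : modcat C) (P : modfun M M).
Variable theta : forall v : modfun Z M, modnat v (P ⊙ v).
Hypothesis theta_nat : forall (v v' : modfun Z M) (s : modnat v v') n,
  fmap P (s n) • theta v n = theta v' n • s n.

(** Each term creates a pair [X i], [Y i], applies [theta] with the strand [X i] absorbed into the
    functor, and annihilates the pair. *)
Definition avg (v : modfun Z M) : modnat v (P ⊙ v) :=
  \sum_(i < r) mnat_comp (wl P (mnat_comp (mod_run_fwd v)
      (mnat_comp (wl v (dual_ev (d2 i))) (mod_asc_fwd v (X i) (Y i)))))
    (mnat_comp (mod_asc_fwd P (v ⊙ X i) (Y i)) (mnat_comp (wr (theta (v ⊙ X i)) (Y i))
    (mnat_comp (mod_asc_bwd v (X i) (Y i)) (mnat_comp (wl v (dual_cv (d1 i)))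
    (mod_run_bwd v))))).

Lemma avgE v n : avg v n = \sum_(i < r)
  fmap P (fmap v (ev (d2 i) n)) • theta (v ⊙ X i) (Y i n) • fmap v (cv (d1 i) n).
Proof.
rewrite modnat_sumE; apply: eq_bigr => i _.
by rewrite /= !fmap_id !comp1m !compm1 compA.
Qed.

Lemma avg_nat (v v' : modfun Z M) (s : modnat v v') n :
  fmap P (s n) • avg v n = avg v' n • s n.
Proof.
rewrite !avgE comp_sumr comp_suml; apply: eq_bigr => i _.
rewrite -(compA _ _ (s n)) -(mnat_nat s) !compA -fmap_comp (mnat_nat s) fmap_comp.
rewrite -(compA _ _ (theta _ _)) -!(compA (fmap P _)).
rewrite (compA (fmap P (s _))); have := theta_nat (wr s (X i)) (Y i n); rewrite wrE => ->.
by [].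
Qed.

Lemma theta_asc (v : modfun Z M) (W W' : modfun Z Z) n :
  theta ((v ⊙ W) ⊙ W') n = theta (v ⊙ (W ⊙ W')) n.
Proof.
have := theta_nat (mod_asc_fwd v W W') n; rewrite /= fmap_id comp1m compm1.
by [].
Qed.

(** The strand [W] slides through the created pair. On the left [Y i ⊙ W] is resolved into the
    [Y j], on the right [W ⊙ X j] into the [X i]; the half mates and the naturality of [theta] match
    the summands. *)
Lemma avg_shift (v : modfun Z M) (W : modfun Z Z) n : avg v (W n) = avg (v ⊙ W) n.
Proof.
pose hh j i (a : 'I_(mult (simple_dec S (W ⊙ X j : E)) i)) : modnat (Y i ⊙ W) (Y j) :=
  sval (cid (half_mate_of (prj a : modnat (W ⊙ X j) (X i)))).
pose gg j i (a : 'I_(mult (simple_dec S (W ⊙ X j : E)) i)) : modnat (Y j) (Y i ⊙ W) :=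
  sval (cid (coev_mate_of (inc a : modnat (X i) (W ⊙ X j)))).
have hhP j i (a : 'I_(mult (simple_dec S (W ⊙ X j : E)) i)) : half_mates (prj a) (hh j i a).
  exact: svalP.
have ggP j i (a : 'I_(mult (simple_dec S (W ⊙ X j : E)) i)) : half_comates (inc a) (gg j i a).
  exact: svalP.
move: hh gg hhP ggP => hh gg hhP ggP.
rewrite !avgE.
transitivity (\sum_(j < r) \sum_(i < r) \sum_(a < mult (simple_dec S (W ⊙ X j : E)) i)
   fmap P (fmap v (ev (d2 i) (W n))) • theta (v ⊙ X i) (Y i (W n))
   • fmap v (fmap (X i) (gg j i a n • hh j i a n) • cv (d1 i) (W n))); last first.
  apply: eq_bigr => j _; rewrite theta_asc.
  set V := W ⊙ X j.
  have -> : theta (v ⊙ V) (Y j n) = \sum_(i < r) \sum_(a < mult (simple_dec S (V : E)) i)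
     fmap P (fmap v ((inc a : modnat _ V) (Y j n))) • theta (v ⊙ X i) (Y j n)
     • fmap v ((prj a : modnat V _) (Y j n)).
    have := congr1 (fun s : modnat _ _ => s (Y j n)) (inc_prj (simple_dec S (V : E))).
    rewrite modnat_sumE => e.
    rewrite -[LHS]comp1m -[X in X • _](fmap_id (P ⊙ v)) -[idm _]e fmap_sum comp_suml.
    apply: eq_bigr => i _; rewrite modnat_sumE fmap_sum comp_suml; apply: eq_bigr => a _.
    have := theta_nat (wl v (prj a : modnat V (X i))) (Y j n); rewrite wlE.
    rewrite -(compA _ (theta (v ⊙ X i) _)) => <-; rewrite compA; congr (_ • _).
    exact: (fmap_comp (P ⊙ v)).
  rewrite comp_sumr comp_suml; apply: eq_bigr => i _.
  rewrite comp_sumr comp_suml; apply: eq_bigr => a _.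
  have [_ h2] := hhP j i a; have [g1 _] := ggP j i a.
  transitivity (fmap P (fmap v (fmap W (ev (d2 j) n) • (inc a : modnat _ V) (Y j n))) •
    theta (v ⊙ X i) (Y j n) • fmap v ((prj a : modnat V _) (Y j n) • fmap W (cv (d1 j) n))); last first.
    by rewrite !fmap_comp -!compA.
  rewrite g1 h2 !fmap_comp -!compA; congr (_ • _); rewrite !compA; congr (_ • _).
  congr (_ • _); exact: (mnat_nat (theta (v ⊙ X i)) (gg j i a n)).
rewrite exchange_big; apply: eq_bigr => i _ /=.
have e : fmap v (cv (d1 i) (W n)) = \sum_(j < r) \sum_(a < mult (simple_dec S (W ⊙ X j : E)) i)
    fmap v (fmap (X i) (gg j i a n • hh j i a n) • cv (d1 i) (W n)).
  rewrite -[cv _ _ in LHS]comp1m -fmap_id.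
  rewrite -(resolution (fun j a => hhP j i a) (fun j a => ggP j i a) n).
  rewrite fmap_sum comp_suml fmap_sum; apply: eq_bigr => j _.
  by rewrite fmap_sum comp_suml fmap_sum.
rewrite {1}e comp_sumr; apply: eq_bigr => j _; rewrite comp_sumr.
by [].
Qed.

End Average.

End Averaging.

(** * The global dimension *)

(** A rank factorization [A = K R] of an idempotent satisfies [R K = 1], and the trace is cyclic. *)
Lemma idem_trace (F : fieldType) n (A : 'M[F]_n) :
  A *m A = A -> \tr A = (\rank A)%:R.
Proof.
move=> AA; have := mulmx_base A.
move: (row_base A) (row_base_free A) (col_base A) (col_base_full A) => R Rfree K Kfull E.
have RK : R *m K = 1%:M.
  apply: (row_free_inj Rfree); rewrite mul1mx; apply: (row_full_inj Kfull).
  by rewrite /= !mulmxA E -mulmxA E AA.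
by rewrite -{1}E mxtrace_mulC RK mxtrace1.
Qed.

Lemma intr_neq0 (k : fieldType) : [pchar k] =i pred0 ->
  forall z : int, z != 0 -> z%:~R != 0 :> k.
Proof.
move=> /pcharf0P h z z0; rewrite (intEsign z) rmorphM rmorph_sign /=.
by rewrite mulf_neq0 ?signr_eq0 // -pmulrn h absz_eq0.
Qed.

(** The matrix [Q = (1 + J) / 2] is idempotent, so its trace is its rank. *)
Lemma involution_trace (k : fieldType) : [pchar k] =i pred0 ->
  forall n (J : 'M[k]_n), J *m J = 1%:M -> exists z : int, \tr J = z%:~R.
Proof.
move=> k_char0 n J JJ; have two : 2%:R != 0 :> k by exact: (intr_neq0 k_char0 (z := 2)).
pose Q := (2%:R)^-1 *: (1%:M + J).
have QQ : Q *m Q = Q.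
  have e : (1%:M + J) *m (1%:M + J) = 2%:R *: (1%:M + J).
    by rewrite mulmxDl !mulmxDr !mul1mx !mulmx1 JJ (addrC J) scaler_nat mulr2n.
  by rewrite /Q -scalemxAl -scalemxAr e !scalerA mulfVK.
exists (2 * (\rank Q)%:Z - n%:Z).
have trQ := idem_trace QQ; rewrite /Q mxtraceZ mxtraceD mxtrace1 in trQ.
rewrite rmorphB rmorphM /= -[in RHS]pmulrn -trQ mulrA mulfV // mul1r.
by rewrite -pmulrn addrC addKr.
Qed.

(** The integral Gram matrix [G] is positive definite: a kernel vector is orthogonal to every [a i],
    and each coordinate is isolated by one of them. Its determinant is a nonzero integer, hence
    nonzero in [k]. *)
Lemma sum_squares_nonsingular (k : fieldType) (k_char0 : [pchar k] =i pred0)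
    (I : finType) (r : nat) (a : I -> 'I_r -> int) (x : 'I_r -> k) :
  (forall c, exists i, a i c != 0 /\ forall c', c' != c -> a i c' = 0) ->
  (forall c, \sum_i (a i c)%:~R * \sum_c' (a i c')%:~R * x c' = 0) ->
  forall c, x c = 0.
Proof.
move=> aP xS.
pose G : 'M[int]_r := \matrix_(c, c') \sum_i a i c * a i c'.
have detG : \det G != 0.
  apply/negP => /det0P[v v0 vG].
  have vG0 i : \sum_c v 0 c * a i c = 0.
    have sq : \sum_i (\sum_c v 0 c * a i c) ^+ 2 = 0.
      transitivity ((v *m G *m v^T) 0 0); last by rewrite vG mul0mx mxE.
      rewrite mxE; under [RHS]eq_bigr do rewrite !mxE mulr_suml.
      rewrite exchange_big /=; under [RHS]eq_bigr => c _.
        under eq_bigr do rewrite mxE mulr_sumr mulr_suml.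
        over.
      rewrite [RHS](eq_bigr (fun c => \sum_i \sum_c' (v 0 c * a i c) * (v 0 c' * a i c'))).
        rewrite [RHS]exchange_big; apply: eq_bigr => i' _ /=; rewrite expr2 mulr_suml.
        by apply: eq_bigr => c _; rewrite mulr_sumr.
      move=> c _; rewrite exchange_big; apply: eq_bigr => i' _; apply: eq_bigr => c' _.
      by rewrite -!mulrA; congr (_ * _); congr (_ * _); rewrite mulrC.
    have := @Num.Theory.psumr_eq0P _ _ xpredT _ (fun i' _ => Num.Theory.sqr_ge0 (\sum_c v 0 c * a i' c)) sq i isT.
    by move/eqP; rewrite sqrf_eq0 => /eqP.
  move/eqP: v0; apply; apply/rowP => c; rewrite mxE.
  have [i [ac ac']] := aP c; have := vG0 i.
  rewrite (big_only1 c) // => [|c' cc' _]; last by rewrite ac' ?mulr0.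
  by move/eqP; rewrite mulf_eq0 (negbTE ac) orbF => /eqP.
have {}detG := intr_neq0 k_char0 detG.
pose y : 'cV[k]_r := \col_c x c.
have Gy : map_mx intr G *m y = 0.
  apply/colP => c; rewrite !mxE -[RHS](xS c); under eq_bigr do rewrite !mxE rmorph_sum mulr_suml.
  rewrite exchange_big; apply: eq_bigr => i _ /=; rewrite mulr_sumr.
  by apply: eq_bigr => c' _; rewrite rmorphM mulrA.
have : (\det G)%:~R *: y = 0.
  by rewrite -det_map_mx -mul_scalar_mx -mul_adj_mx -mulmxA Gy mulmx0.
move/eqP; rewrite scaler_eq0 (negbTE detG) /= => /eqP y0 c.
by have := congr1 (fun M : 'cV_r => M c 0) y0; rewrite !mxE.
Qed.

Section GlobalDimension.

Variables (k : closedFieldType) (k_char0 : [pchar k] =i pred0).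
Variables (C : monoidal k) (Z : modcat C).
Notation E := (mod_hom Z Z).
Notation "F ⊙ G" := (mfun_comp F G) (at level 39, left associativity).
Variables (r : nat) (X : 'I_r -> modfun Z Z) (S : @simples k E r X) (B : balanced X).
Notation Y := (bal_dual B).
Notation d1 := (bal1 B).
Notation d2 := (bal2 B).
Notation m := (bal_norm B).
Notation End1 := (modnat (mfun_id Z) (mfun_id Z)).
Notation L1 i := (loop (d1 i) (d2 i)).
Notation L2 i := (loop (d2 i) (d1 i)).
Notation D i l := (simple_dec S (X i ⊙ X l : E)).

(** The character of the endomorphism ring of the unit by which it acts on the left of [X i].
    Different characters can occur when the unit is not simple. *)
Definition om (i : 'I_r) (w : End1) : k :=
  coef S (mnat_comp (mod_lun_fwd (X i)) (mnat_comp (wr w (X i)) (mod_lun_bwd (X i)))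
     : hom E (X i) (X i)).

Lemma omE i (w : End1) n : w (X i n) = om i w *: idm (X i n).
Proof. exact: end_act. Qed.

Lemma om_eq i (w : End1) x : (forall n, w (X i n) = x *: idm (X i n)) -> om i w = x.
Proof.
move=> wx; apply: scal_of => n; rewrite /= ?fmap_id ?comp1m ?compm1; exact: wx.
Qed.

Lemma omM i w w' : om i (mnat_comp w w') = om i w * om i w'.
Proof.
by apply: om_eq => n; rewrite [LHS]/= !omE compZl comp1m scalerA.
Qed.

Lemma omZ i a w : om i (a *: w) = a * om i w.
Proof. by apply: om_eq => n; rewrite modnat_scaleE omE scalerA. Qed.

Lemma om_sum i I (s : seq I) (w : I -> End1) :
  om i (\sum_(j <- s) w j) = \sum_(j <- s) om i (w j).
Proof.
apply: om_eq => n; rewrite modnat_sumE scaler_suml; apply: eq_bigr => j _.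
exact: omE.
Qed.

Lemma om_loop2 i w : mnat_comp w (L2 i) = om i w *: L2 i.
Proof. apply: loop_lact => n; exact: omE. Qed.

(** Loops commute, and the product of two of them is a multiple of either one. *)
Lemma om_sym i c : om i (L2 c) * m i = om c (L2 i) * m c.
Proof.
apply: (scalar_compare (bal_loop2_nz (b := B) (i := i)) (bal_loop2_nz (b := B) (i := c))).
- exact: bal_loop2_sq.
- exact: bal_loop2_sq.
rewrite -!om_loop2; apply: modnat_eq => n; exact: loop_comm.
Qed.

Section Constituent.

Variables (i l c : 'I_r) (p : modnat (X c) (X i ⊙ X l)).
Hypothesis p_nz : p <> 0.

Let cancel x y : (forall n, x *: p n = y *: p n) -> x = y.
Proof.
move=> e; apply/eqP; rewrite -subr_eq0; apply/negP => xy; apply: p_nz.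
have : (x - y) *: p = 0.
  by apply: modnat_eq => n; rewrite modnat_scaleE scalerBl e subrr.
by move/eqP; rewrite scaler_eq0 => /orP[/xy|/eqP].
Qed.

Lemma om_constituent (w : End1) : om c w = om i w.
Proof.
apply: cancel => n.
have := mnat_nat w (p n); rewrite /= omE compZl comp1m => ->.
by rewrite omE compZr compm1.
Qed.

(** Being idempotent, [L1 i] acts as 1 on the right of [X i], and this is also its action on the
    left of [X l], as [X i ⊙ X l] is nonzero. *)
Lemma om_unit : om l (L1 i) = 1.
Proof.
have [a aE] := end_ract S i (L1 i).
have a1 : a = 1.
  have := loop_ract (d1 i) (d2 i) aE; rewrite bal_loop1_sq => e.
  have : (1 - a) *: L1 i = 0 by rewrite scalerBl scale1r -e subrr.
  move/eqP; rewrite scaler_eq0 subr_eq0 => /orP[/eqP -> //|/eqP /bal_loop1_nz].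
  by [].
apply: cancel => n; have := aE (X l n); rewrite omE a1 fmapZ fmap_id => e.
transitivity ((om l (L1 i) *: idm (X i (X l n))) • p n).
  by rewrite compZl comp1m.
by rewrite e compZl comp1m.
Qed.

End Constituent.

Definition isoproj (c : 'I_r) (V : modfun Z Z) : modnat V V :=
  \sum_(a < mult (simple_dec S (V : E)) c) mnat_comp (inc a) (prj a).

Lemma isoproj_post c V j (q : modnat V (X j)) :
  mnat_comp q (isoproj c V) = (j == c)%:R *: q.
Proof.
rewrite -[LHS]/((q : hom E V (X j)) • \sum_(a < mult (simple_dec S (V : E)) c) (inc a • prj a)).
case: eqVneq => [jc|/eqP jc]; last first.
  rewrite scale0r comp_sumr big1 // => a _; rewrite compA.
  by rewrite (simple_hom S (nesym jc) ((q : hom E V (X j)) • inc a)) comp0m.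
subst c; rewrite scale1r [RHS](expand_prj S (q : hom E V (X j))) comp_sumr.
apply: eq_bigr => a _; rewrite compA {1}(coefE S ((q : hom E V (X j)) • inc a)).
by rewrite compZl comp1m.
Qed.

Lemma isoproj_nat c (V V' : modfun Z Z) (s : modnat V V') :
  mnat_comp s (isoproj c V) = mnat_comp (isoproj c V') s.
Proof.
apply: (hom_ext_prj S (f := (mnat_comp s (isoproj c V) : hom E V V'))) => j q.
transitivity (mnat_comp (mnat_comp q s) (isoproj c V)).
  by rewrite -[RHS]/(((q : hom E V' (X j)) • (s : hom E V V')) • _) -compA.
rewrite isoproj_post; transitivity (mnat_comp (mnat_comp q (isoproj c V')) s).
  rewrite isoproj_post; apply: modnat_eq => n.
  by rewrite -[RHS]/(((_ *: q) : modnat _ _) n • s n) !modnat_scaleE compZl.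
by rewrite -[LHS]/(((q : hom E V' (X j)) • _) • (s : hom E V V')) -compA.
Qed.

Lemma isoproj_simple c j n : isoproj c (X j) n = (j == c)%:R *: idm (X j n).
Proof.
have := isoproj_post c (mnat_id (X j)) => e.
have := congr1 (fun s : modnat _ _ => s n) e; rewrite modnat_scaleE => <-.
by rewrite /= comp1m.
Qed.

Lemma isoproj_unit c j n : isoproj c (mfun_id Z ⊙ X j) n = (j == c)%:R *: idm (X j n).
Proof.
have e := congr1 (fun s : modnat _ _ => s n) (isoproj_nat c (mod_lun_bwd (X j))).
rewrite -isoproj_simple -[RHS]comp1m -[LHS]compm1; exact: esym e.
Qed.

Definition theta c (V : modfun Z Z) : modnat V (mfun_id Z ⊙ V) :=
  mnat_comp (mod_lun_bwd V) (isoproj c V).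

Lemma thetaE c V n : theta c V n = isoproj c V n.
Proof. by rewrite /= comp1m. Qed.

Lemma theta_natural c (V V' : modfun Z Z) (s : modnat V V') n :
  fmap (mfun_id Z) (s n) • theta c V n = theta c V' n • s n.
Proof.
by rewrite !thetaE; have := congr1 (fun s : modnat _ _ => s n) (isoproj_nat c s).
Qed.

(** [avg_shift] moves [X i] from the functor into the argument. There the projection kills every
    term except the one of [c], which is the loop [L2 c]. *)
Lemma avg_theta (i c : 'I_r) n :
  avg B (theta c) (X i) n = om i (L2 c) *: idm (X i n).
Proof.
have e := avg_nat (P := mfun_id Z) B (theta_natural c) (mod_lun_fwd (X i)) n.
rewrite /= comp1m compm1 in e; rewrite -{}e.
rewrite -(avg_shift S B (theta_natural c) (mfun_id Z) (X i) n) avgE.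
rewrite (big_only1 c) // => [|j jc _]; rewrite thetaE isoproj_unit.
  rewrite eqxx scale1r compm1 -omE; exact: erefl.
by rewrite (negbTE jc) scale0r compm0 comp0m.
Qed.

Variable rt : 'I_r -> k.
Hypothesis rt_sq : forall i, rt i ^+ 2 = m i.

Let rt_nz i : rt i != 0.
Proof. by rewrite -sqrf_eq0 rt_sq bal_norm_nz. Qed.

(* In the presence of a spherical structure these would be the fusion
   multiplicities of [X c] in [X i ⊙ X l], up to sign. *)
Definition fus (i l c : 'I_r) : k := rt i * rt l / rt c * \tr (Lam S B i l c).

Lemma fus_int i l c : exists z : int, fus i l c = z%:~R.
Proof.
rewrite /fus -mxtraceZ; apply: involution_trace => //.
rewrite -scalemxAl -scalemxAr Lam_square scalerA scale_scalar_mx.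
congr (_%:M); rewrite -!rt_sq !expr2 !invfM.
have := rt_nz i; have := rt_nz l; have := rt_nz c.
move: (rt i) (rt l) (rt c) => x y z z0 y0 x0.
by field; rewrite x0 y0 z0.
Qed.

Lemma fus_constituent i l c : fus i l c != 0 ->
  exists p : modnat (X c) (X i ⊙ X l), p <> 0.
Proof.
move=> f0; have [a] : exists a : 'I_(mult (D i l) c), true.
  case E : (mult (D i l) c) => [|n]; last by exists ord0.
  move: f0; rewrite /fus; suff -> : \tr (Lam S B i l c) = 0 by rewrite mulr0 eqxx.
  apply: big1 => a _; exfalso.
  have : (0 < mult (D i l) c)%N := leq_ltn_trans (leq0n a) (ltn_ord a).
  by rewrite E.
exists (inc a) => e; apply: (simple_nz S (i := c)).
have := prj_inc a a; rewrite e eqxx scale1r => <-; exact: compm0.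
Qed.

(** The traces of [Lam] add up to the partial trace of the identity of [X i ⊙ X l], which is the
    loop [L1 i] acting on [X l]. *)
Lemma fus_row i l :
  \sum_c fus i l c * rt c = rt i * rt l * om l (L1 i).
Proof.
transitivity (rt i * rt l * \sum_c \tr (Lam S B i l c)).
  rewrite mulr_sumr; apply: eq_bigr => c _.
  by rewrite /fus mulrAC divfK.
congr (_ * _); transitivity (lam S B (mnat_id (X i ⊙ X l))).
  have LL : linear (fun f : modnat (X i ⊙ X l) (X i ⊙ X l) => lam S B f : k^o).
    by move=> a f g; exact: lam_lin.
  rewrite -[mnat_id _]/(idm (X i ⊙ X l : E)) -(inc_prj (D i l)).
  rewrite (lin_sum LL); apply: eq_bigr => c _; rewrite (lin_sum LL).
  by apply: eq_bigr => a _; rewrite mxE.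
apply: scal_of => n; rewrite ltrE fmap_id compm1.
exact: (omE l (L1 i)).
Qed.

(** By [rtr_lam] the weights [m l] turn the traces into right partial traces of isotypic
    projections. Summed over [l] these form the average of [theta c], computed in [avg_theta]. *)
Lemma fus_col i c : \sum_l fus i l c * rt l = rt i / rt c * om i (L2 c).
Proof.
transitivity (rt i / rt c * \sum_l m l * \tr (Lam S B i l c)).
  rewrite mulr_sumr; apply: eq_bigr => l _; rewrite /fus -rt_sq expr2.
  by rewrite mulrAC !mulrA; congr (_ * _); rewrite -!mulrA; congr (_ * _); rewrite mulrCA mulrA mulrC.
congr (_ * _); apply: esym; apply: om_eq => n.
rewrite omE -avg_theta avgE scaler_suml; apply: eq_bigr => l _.
transitivity (\sum_(a < mult (D i l) c) rtr B (mnat_comp (inm (S := S) a) (prm a)) n).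
  rewrite thetaE modnat_sumE comp_sumr comp_suml; apply: eq_bigr => a _.
  by rewrite rtrE.
rewrite /mxtrace mulr_sumr scaler_suml; apply: eq_bigr => a _.
by rewrite (rtr_lam S) mxE.
Qed.

(** Some simple summand [X i] of the unit acts on [X j] by a nonzero map. Then [X i ⊙ X j] embeds in
    [X j], so no other simple object occurs in it; this yields the isolated entry that
    [sum_squares_nonsingular] asks for. *)
Lemma unit_summand j : exists2 i,
  exists p : modnat (X j) (X i ⊙ X j), p <> 0 &
  forall c, c != j -> forall p : modnat (X c) (X i ⊙ X j), p = 0.
Proof.
pose U := simple_dec S (mfun_id Z : E).
pose u i (a : 'I_(mult U i)) : modnat (X i ⊙ X j) (X j) :=
  mnat_comp (mod_lun_fwd (X j)) (wr (inc a) (X j)).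
pose t i (a : 'I_(mult U i)) : modnat (X j) (X i ⊙ X j) :=
  mnat_comp (wr (prj a) (X j)) (mod_lun_bwd (X j)).
have uE i (a : 'I_(mult U i)) n : u i a n = (inc a : modnat _ _) (X j n).
  by rewrite /= ?fmap_id ?comp1m ?compm1.
have tE i (a : 'I_(mult U i)) n : t i a n = (prj a : modnat _ _) (X j n).
  by rewrite /= ?fmap_id ?comp1m ?compm1.
have tu i (a : 'I_(mult U i)) n : t i a n • u i a n = idm (X i (X j n)).
  rewrite uE tE; have := congr1 (fun s : modnat _ _ => s (X j n)) (prj_inc a a).
  by rewrite eqxx scale1r.
have [i [a t0]] : exists i (a : 'I_(mult U i)), t i a <> 0.
  apply: contrapT => t0; apply: (simple_nz S (i := j)); apply: modnat_eq => n.
  have := congr1 (fun s : modnat _ _ => s (X j n)) (inc_prj U).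
  rewrite modnat_sumE => /= <-; apply: big1 => i _; rewrite modnat_sumE; apply: big1 => a _.
  rewrite [LHS]/= -tE; have -> : t i a = 0 by apply: contrapT => ta; apply: t0; exists i, a.
  exact: compm0.
exists i; first by exists (t i a).
move=> c /eqP cj p; apply: modnat_eq => n.
have up : mnat_comp (u i a) p = 0 := simple_hom S cj _.
rewrite -[LHS]comp1m -(tu i a n) -compA.
have -> : u i a n • p n = 0 := congr1 (fun s : modnat _ _ => s n) up.
exact: compm0.
Qed.

Definition total_loop : End1 := \sum_i L2 i.

(** The global dimension may differ between blocks, so the vector of square roots is truncated to
    the indices where it vanishes. By [omD] the total loop takes the same value at [i] and [j]
    whenever [om i (L2 j)] is nonzero; hence the truncated vector lies in the kernel of the Gram
    matrix and must be 0. *)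
Lemma om_total_loop c : om c total_loop != 0.
Proof.
apply/negP => /eqP c0; have omD i j : om i total_loop * om i (L2 j) = om j total_loop * om i (L2 j).
  by rewrite -omM om_loop2 omZ.
pose x j := if om j total_loop == 0 then rt j else 0.
suff /(_ c) : forall j, x j = 0.
  by rewrite /x c0 eqxx => /eqP; apply/negP; exact: rt_nz.
have [a aE] : exists a : 'I_r * 'I_r -> 'I_r -> int, forall i j, fus i.1 i.2 j = (a i j)%:~R.
  have /choice[a aE] (t : 'I_r * 'I_r * 'I_r) : exists z : int, fus t.1.1 t.1.2 t.2 = z%:~R.
    exact: fus_int.
  by exists (fun i j => a (i, j)) => i j; rewrite -aE.
have fx i l : \sum_j fus i l j * x j
    = if om i total_loop == 0 then rt i * rt l * om l (L1 i) else 0.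
  transitivity (\sum_j (if om i total_loop == 0 then fus i l j * rt j else 0)).
    apply: eq_bigr => j _; have [f0|f0] := eqVneq (fus i l j) 0.
      by rewrite f0 !mul0r if_same.
    have [p p0] := fus_constituent f0.
    by rewrite /x (om_constituent p0); case: ifP; rewrite ?mulr0.
  by case: ifP => _; [exact: fus_row | exact: big1].
apply: (sum_squares_nonsingular k_char0 (a := a)) => j; last first.
  transitivity (\sum_i \sum_l fus i l j * \sum_j' fus i l j' * x j').
    rewrite pair_big /=; apply: eq_bigr => i _; rewrite -aE; congr (_ * _).
    by apply: eq_bigr => j' _; rewrite -aE.
  transitivity (\sum_i (if om i total_loop == 0 then rt i * \sum_l fus i l j * rt l else 0)).
    apply: eq_bigr => i _; under eq_bigr do rewrite fx.
    case: ifP => _; last by rewrite big1 // => l _; rewrite mulr0.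
    rewrite mulr_sumr; apply: eq_bigr => l _.
    have [f0|f0] := eqVneq (fus i l j) 0; first by rewrite f0 !mul0r mulr0.
    have [p p0] := fus_constituent f0.
    by rewrite (om_unit p0) mulr1 mulrCA.
  (* [fus_col] and the symmetry [om_sym] exchange [i] and [j], so that the sum over [i] is the part
     of the total loop at [j] coming from the retained indices. *)
  transitivity (\sum_i (if om i total_loop == 0 then rt j * om j (L2 i) else 0)).
    apply: eq_bigr => i _; case: ifP => // _; rewrite fus_col.
    rewrite !mulrA -expr2 rt_sq mulrAC [m i * _]mulrC om_sym -rt_sq expr2.
    by rewrite -!mulrA divff // mulr1 mulrC.
  case: (eqVneq (om j total_loop) 0) => [j0|j0].
    transitivity (rt j * om j total_loop); last by rewrite j0 mulr0.
    rewrite om_sum mulr_sumr; apply: eq_bigr => i _; case: ifP => // /negbT i0.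
    have := omD j i; rewrite j0 mul0r => /esym/eqP.
    by rewrite mulf_eq0 (negbTE i0) /= => /eqP ->; rewrite mulr0.
  apply: big1 => i _; case: ifP => // /eqP i0; have := omD j i.
  by rewrite i0 mul0r => /eqP; rewrite mulf_eq0 (negbTE j0) /= => /eqP ->; rewrite mulr0.
have [i [p p0] ij] := unit_summand j; exists (i, j).
have fc c' : c' != j -> fus i j c' = 0.
  move=> cj; apply/eqP; apply: contrapT => /negP/fus_constituent[q]; apply.
  exact: ij.
split=> [|c' cj]; last first.
  have := fc c' cj; rewrite (aE (i, j)) => e; apply/eqP; apply: contrapT => /negP.
  by move/(intr_neq0 k_char0); rewrite e eqxx.
have := fus_row i j; rewrite (big_only1 j) // => [|c' cj _]; last by rewrite fc ?mul0r.
rewrite (om_unit p0) mulr1 (aE (i, j)) => e; apply/eqP => a0; move/eqP: e.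
by rewrite a0 mul0r eq_sym mulf_eq0 !(negbTE (rt_nz _)).
Qed.

End GlobalDimension.

(* [total_loop] is the global dimension, one scalar for each summand of the unit. *)
Lemma total_loop_invertible (k : closedFieldType) (k_char0 : [pchar k] =i pred0)
    (C : monoidal k) (Z : modcat C) (r : nat) (X : 'I_r -> modfun Z Z)
    (S : @simples k (mod_hom Z Z) r X) (B : balanced X) :
  exists w : modnat (mfun_id Z) (mfun_id Z),
    forall n, w n • total_loop B n = idm n /\ total_loop B n • w n = idm n.
Proof.
have /choice[rt rt_sq] (i : 'I_r) : exists x : k, x ^+ 2 = bal_norm B i.
  have [x] : exists x, root ('X^2 - (bal_norm B i)%:P) x.
    by apply/closed_rootP; rewrite size_XnsubC.
  by rewrite /root !hornerE subr_eq0 => /eqP <-; exists x.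
move: (total_loop B) (om_total_loop k_char0 S rt_sq) => T T0.
pose U := simple_dec S (mfun_id Z : mod_hom Z Z).
pose t i (a : 'I_(mult U i)) : modnat (mfun_id Z) (mfun_id Z) :=
  mnat_comp (inc a : modnat (X i) (mfun_id Z)) (prj a).
(* On a simple summand [X i] of the unit, [T] is the scalar [om i T]; the inverse is assembled from
   the inverse scalars. *)
pose w : modnat (mfun_id Z) (mfun_id Z) :=
  \sum_i \sum_a (om S i T)^-1 *: t i a.
have e n : T n • w n = idm n.
  transitivity ((idm (mfun_id Z : mod_hom Z Z) : modnat _ _) n); last by [].
  rewrite -(inc_prj U) !modnat_sumE comp_sumr; apply: eq_bigr => i _.
  rewrite !modnat_sumE comp_sumr; apply: eq_bigr => a _.
  rewrite modnat_scaleE compZr.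
  have -> : T n • t i a n = om S i T *: t i a n.
    transitivity ((inc a : modnat (X i) (mfun_id Z)) n • T (X i n)
        • (prj a : modnat _ (X i)) n).
      rewrite [LHS]compA; congr (_ • _).
      exact: (mnat_nat T ((inc a : modnat (X i) (mfun_id Z)) n)).
    by rewrite (omE S) compZr compm1 compZl.
  rewrite scalerA mulVf ?scale1r //.
exists w => n; split=> //; rewrite -[RHS](e n); exact: loop_comm.
Qed.

(** * The regular module and sections of module transformations *)

Definition reg_mod (k : fieldType) (C : monoidal k) : modcat C :=
  @ModCat k C C (tens C) (fun m c d => massoc m c d) (fun m => mrun m)
    (@massoc_nat k C) (@mrun_nat k C) (fun m c d e => mpentagon m c d e)
    (fun m c => mtriangle m c).

Section MonoidalUnits.

Variables (k : fieldType) (C : monoidal k).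

(** Kelly's unit coherence again, by the same reduction as [lun_asc]. *)
Lemma mlun_asc (z c : C) :
  mlun (z ⊗ c) • massoc (munit C) z c = mlun z ⊠ idm c.
Proof.
have inj (x y : C) (a b : hom C x y) : idm (munit C) ⊠ a = idm (munit C) ⊠ b -> a = b.
  by move=> e; apply: (iso_epic (f := mlun x)); rewrite -!mlun_nat e.
apply: inj; rewrite bmap_compr.
apply: (iso_epic (f := massoc (munit C) (munit C ⊗ z) c)).
apply: (iso_epic (f := iso_bmap (tens C) (massoc (munit C) (munit C) z) (iso_refl c))) => /=.
rewrite -!compA (compA (idm _ ⊠ massoc _ _ _)) -mpentagon !compA mtriangle.
rewrite -bmap_id -massoc_nat -mtriangle bmap_compl compA.
by rewrite massoc_nat.
Qed.

End MonoidalUnits.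

Section ModuleUnits.

Variables (k : fieldType) (C : monoidal k) (M : modcat C).

Lemma aasc_natr (m : M) (c d d' : C) (h : hom C d d') :
  aasc m c d' • (idm (m ◁ c) ◂ h) = (idm m ◂ (idm c ⊠ h)) • aasc m c d.
Proof. by rewrite -aasc_nat bmap_id. Qed.

Lemma aasc_natl (m m' : M) (c d : C) (f : hom M m m') :
  aasc m' c d • ((f ◂ idm c) ◂ idm d) = (f ◂ idm (c ⊗ d)) • aasc m c d.
Proof. by rewrite aasc_nat bmap_id. Qed.

Lemma act_inj (m n : M) (a b : hom M m n) :
  a ◂ idm (munit C) = b ◂ idm (munit C) -> a = b.
Proof. by move=> e; apply: (iso_epic (f := aun m)); rewrite -!aun_nat e. Qed.

Lemma aun_asc (m : M) (c : C) :
  (idm m ◂ mrun c) • aasc m c (munit C) = aun (m ◁ c).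
Proof.
apply: act_inj; rewrite bmap_compl.
apply: (iso_monic (f := aasc m c (munit C))).
rewrite -[in RHS]atriangle compA aasc_nat [in RHS]compA aasc_natr -mtriangle.
by rewrite bmap_compr -!compA apentagon !compA.
Qed.

End ModuleUnits.

Section Generated.

Variables (k : fieldType) (C : monoidal k) (M : modcat C).
Notation Z := (reg_mod C).
Notation "F ⊙ G" := (mfun_comp F G) (at level 39, left associativity).

Section GenFun.

Variable n : M.

Lemma gen_lin (z z' : C) : linear (fun f : hom C z z' => idm n ◂ f).
Proof. exact: bmap_linr. Qed.

Definition gen_lfun : lfunctor Z M :=
  @LFunctor k Z M (fun z => n ◁ z) (fun z z' f => idm n ◂ f) gen_lin
    (fun z => bmap_id _ n z) (fun z z' z'' f g => bmap_compr _ n f g).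

Lemma gen_nat (z z' c c' : C) (f : hom C z z') (g : hom C c c') :
  iso_sym (aasc n z' c') • fmap gen_lfun (f ⊠ g)
  = (fmap gen_lfun f ◂ g) • iso_sym (aasc n z c).
Proof.
apply: (iso_epic (f := aasc n z c)); rewrite /= fwdKr.
by apply: (iso_monic (f := aasc n z' c')); rewrite aasc_nat -compA bwdKl.
Qed.

Lemma gen_asc (z c d : C) :
  aasc (n ◁ z) c d • (iso_sym (aasc n z c) ◂ idm d) • iso_sym (aasc n (z ⊗ c) d)
  = iso_sym (aasc n z (c ⊗ d)) • fmap gen_lfun (massoc z c d).
Proof.
apply: (iso_monic (f := aasc n z (c ⊗ d))); rewrite /= bwdKl !compA apentagon.
rewrite -(compA _ _ (_ ◂ idm d)) -bmap_compl bwdK bmap_id compm1.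
by rewrite -compA bwdK compm1.
Qed.

Lemma gen_un (z : C) :
  aun (n ◁ z) • iso_sym (aasc n z (munit C)) = fmap gen_lfun (mrun z).
Proof. by rewrite /= -aun_asc bwdKr. Qed.

Definition gen_fun : modfun Z M :=
  @ModFun k C Z M gen_lfun (fun z c => iso_sym (aasc n z c)) gen_nat gen_asc gen_un.

End GenFun.

Lemma gen_map (n n' : M) (f : hom M n n') :
  exists s : modnat (gen_fun n) (gen_fun n'), forall z, s z = f ◂ idm z.
Proof.
unshelve eexists (@ModNat k C Z M (gen_fun n) (gen_fun n') (fun z => f ◂ idm z) _ _) => //.
  by move=> z z' g /=; rewrite bmap_interchange.
move=> z c /=; apply: (iso_epic (f := aasc n z c)); rewrite fwdKr.
by apply: (iso_monic (f := aasc n' z c)); rewrite !compA bwdK comp1m -aasc_natl.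
Qed.

Notation I := (munit C).

(* A module functor out of [C] is determined by its value at the unit object. *)
Lemma eval_iso (v : modfun Z M) :
  exists (K : modnat (gen_fun (v I)) v) (K' : modnat v (gen_fun (v I))),
    [/\ forall z, K z • mstr v I z = fmap v (mlun z : hom Z _ _),
        forall z, K z • K' z = idm (v z) & forall z, K' z • K z = idm (v I ◁ z)].
Proof.
have [K KE] : exists K : forall z, @iso k M (v I ◁ z) (v z),
    forall z, K z • mstr v I z = fmap v (mlun z : hom Z _ _).
  exists (fun z => iso_trans (iso_fmap v (mlun z : @iso k Z (I ⊗ z) z)) (iso_sym (mstr v I z))).
  by move=> z /=; rewrite -compA fwdK compm1.
have K_nat (z z' : Z) (f : hom Z z z') : K z' • fmap (gen_fun (v I)) f = fmap v f • K z.
  apply: (iso_epic (f := mstr v I z)); rewrite -!compA KE.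
  have := mstr_nat v (idm (I : Z)) f; rewrite fmap_id => <-.
  by rewrite compA KE -!fmap_comp; congr fmap; exact: mlun_nat.
have K_act (z : Z) (c : C) :
    mstr v z c • K (z ◁ c) = (K z ◂ idm c) • mstr (gen_fun (v I)) z c.
  apply: (iso_epic (f := mstr v I (z ⊗ c))).
  rewrite -compA KE /= -compA.
  apply: (iso_epic (f := iso_fmap v (massoc I z c : @iso k Z _ _))) => /=.
  have e : aasc (v I) z c • (mstr v I z ◂ idm c) • mstr v (I ⊗ z) c
      = mstr v I (z ⊗ c) • fmap v (massoc I z c : hom Z _ _) := mstr_asc v (I : Z) z c.
  rewrite -!compA -e -fmap_comp [_ • _ as X in fmap v X]mlun_asc.
  rewrite (compA (aasc _ _ _)⁻) (compA (aasc _ _ _)⁻) fwdK comp1m compA -bmap_compl KE.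
  exact: (mstr_nat v (mlun z : hom Z _ _) (idm c)).
pose K1 := @ModNat k C Z M (gen_fun (v I)) v (fun z => K z) K_nat K_act.
have KK (z : Z) : K1 z • (K z)⁻ = idm _ := bwdK (K z).
have K'K (z : Z) : (K z)⁻ • K1 z = idm _ := fwdK (K z).
by exists K1, (@inv_modnat k C Z M _ _ K1 (fun z => (K z)⁻) K'K KK); split.
Qed.

Section Extension.

Variables (P : modfun M M) (sg : forall n : M, hom M n (P n)).
Hypothesis sg_nat : forall n n' (f : hom M n n'), sg n' • f = fmap P f • sg n.

Lemma eval_nat (v v' : modfun Z M) (s : modnat v v')
    (K : modnat (gen_fun (v I)) v) (K' : modnat (gen_fun (v' I)) v') :
  (forall z, K z • mstr v I z = fmap v (mlun z : hom Z _ _)) ->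
  (forall z, K' z • mstr v' I z = fmap v' (mlun z : hom Z _ _)) ->
  forall z, s z • K z = K' z • (s I ◂ idm z).
Proof.
move=> KE K'E z; apply: (iso_epic (f := mstr v I z)).
rewrite -!compA KE -(mnat_act s (I : Z) z) compA K'E.
exact: (mnat_nat s).
Qed.

(** As [v] is isomorphic to [v I ◁ -], the map [sg] is applied at [v I] alone and the action carries
    it to every [z]. This is a module transformation for each [v], although [sg] itself need not
    respect the action. *)
Lemma extension_exists : exists th : forall v : modfun Z M, modnat v (P ⊙ v),
  (forall (v v' : modfun Z M) (s : modnat v v') z,
    fmap P (s z) • th v z = th v' z • s z) /\
  (forall (eps : modnat P (mfun_id M)), (forall n, eps n • sg n = idm n) ->
    forall (v : modfun Z M) z, eps (v z) • th v z = idm (v z)).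
Proof.
pose K v := sval (cid (eval_iso v)).
pose K' v := sval (cid (svalP (cid (eval_iso v)))).
have KP v : [/\ forall z, K v z • mstr v I z = fmap v (mlun z : hom Z _ _),
    forall z, K v z • K' v z = idm (v z) & forall z, K' v z • K v z = idm (v I ◁ z)].
  exact: svalP (cid (svalP (cid (eval_iso v)))).
move: K K' KP => K K' KP.
have gm n n' (f : hom M n n') : {s : modnat (gen_fun n) (gen_fun n') | forall z, s z = f ◂ idm z}.
  exact: cid (gen_map f).
exists (fun v => mnat_comp (K (P ⊙ v)) (mnat_comp (sval (gm _ _ (sg (v I)))) (K' v))).
split=> [v v' s z|eps se v z] /=.
  have [KE KK' K'K] := KP v; have [K2E KK2' K2'K] := KP v'.
  have [K3E _ _] := KP (P ⊙ v); have [K4E _ _] := KP (P ⊙ v').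
  rewrite !(svalP (gm _ _ _)).
  have := eval_nat (wl P s) K3E K4E z; rewrite !wlE compA => ->.
  rewrite -!compA; congr (_ • _); rewrite compA -bmap_compl -sg_nat bmap_compl -compA.
  congr (_ • _); rewrite -[s z]compm1 -(KK' z) (compA (s z)) (eval_nat s KE K2E z).
  by rewrite -compA (compA (K' v' z)) K2'K comp1m.
have [KE KK' K'K] := KP v; have [K3E _ _] := KP (P ⊙ v).
rewrite (svalP (gm _ _ _)).
have := eval_nat (mnat_comp (mod_lun_fwd v) (wr eps v)) K3E KE z.
rewrite /= !fmap_id !comp1m !compm1 compA => ->.
by rewrite -compA (compA (_ ◂ _)) -bmap_compl se bmap_id comp1m KK'.
Qed.

End Extension.

End Generated.

Section ModuleSection.

Variables (k : closedFieldType) (k_char0 : [pchar k] =i pred0) (C : monoidal k) (M : modcat C).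
Notation Z := (reg_mod C).
Notation "F ⊙ G" := (mfun_comp F G) (at level 39, left associativity).
Notation I := (munit C).
Variables (r : nat) (X : 'I_r -> modfun Z Z).
Variables (S : @simples k (mod_hom Z Z) r X) (B : balanced X).

Lemma gen_translate (n : M) (c : C) :
  exists s : modnat (gen_fun (n ◁ c)) (gen_fun n ⊙ (gen_fun (c : Z))),
    forall z, s z = aasc n c z.
Proof.
unshelve eexists (@ModNat k C Z M (gen_fun (n ◁ c)) (gen_fun n ⊙ (gen_fun (c : Z)))
  (fun z => aasc n c z) _ _) => //.
  by move=> z z' g /=; rewrite aasc_natr.
move=> z d /=; apply: (iso_epic (f := aasc (n ◁ c) z d)); rewrite -!compA fwdK compm1.
rewrite apentagon -!compA (compA (idm n ◂ _) (idm n ◂ _)) -bmap_compr.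
have -> : (massoc c z d)⁻ • massoc c z d = idm _ by exact: fwdK.
by rewrite bmap_id comp1m fwdKl.
Qed.

Variables (P : modfun M M) (eps : modnat P (mfun_id M)).
Variables (q : nat) (y : 'I_q -> M) (T : simples y).
Hypothesis eps_epi : forall t, exists s : hom M (y t) (P (y t)), eps (y t) • s = idm (y t).

Lemma plain_section : exists sg : forall n : M, hom M n (P n),
  (forall n n' (f : hom M n n'), sg n' • f = fmap P f • sg n) /\
  forall n, eps n • sg n = idm n.
Proof.
pose s t := sval (cid (eps_epi t)).
have sE t : eps (y t) • s t = idm (y t) := svalP (cid (eps_epi t)).
exists (nat_ext T (F := lfunctor_id M) (G := P) s); split.
  by move=> n n' f; exact: (nat_ext_nat T (F := lfunctor_id M) (G := P) s f).
move=> n; rewrite /nat_ext -[RHS](inc_prj (simple_dec T n)) comp_sumr.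
apply: eq_bigr => i _; rewrite comp_sumr; apply: eq_bigr => a _.
have e := mnat_nat eps (inc a : hom M (y i) n).
by rewrite !compA e -(compA _ (eps _)) sE compm1.
Qed.

Theorem module_section : exists phi : modnat (mfun_id M) P,
  forall n, eps n • phi n = idm n.
Proof.
have [sg [sg_nat sgE]] := plain_section.
have [th [th_nat /(_ eps sgE) thE]] := extension_exists sg_nat.
(* [G n] is the average for the functor [n ◁ -]. Its compatibility with the action comes from
   [avg_shift]; composed with [eps], every term of the average closes to a loop. *)
have [G [GN Gshift Geps]] : exists G : forall n : M, modnat (gen_fun n) (P ⊙ gen_fun n),
    [/\ forall n n' (s : modnat (gen_fun n) (gen_fun n')) z,
        fmap P (s z) • G n z = G n' z • s z,
      forall n c, fmap P (aasc n c I) • G (n ◁ c) I = G n (c ⊗ I) • aasc n c I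
    & forall n (z : Z), eps (n ◁ z) • G n z = idm n ◂ (total_loop B z : hom C z z)].
  exists (fun n => avg B th (gen_fun n)); split.
  - by move=> n n' s z; exact: avg_nat.
  - move=> n c; have [s sE] := gen_translate n c.
    have := avg_nat B th_nat s I; rewrite sE => ->; congr (_ • _).
    exact: esym (avg_shift S B th_nat (gen_fun n) (gen_fun (c : Z)) I).
  move=> n z; rewrite avgE comp_sumr.
  transitivity (fmap (gen_fun n) (total_loop B z)); last by [].
  rewrite /total_loop modnat_sumE fmap_sum; apply: eq_bigr => i _.
  have e := mnat_nat eps (fmap (gen_fun n) (ev (bal2 B i) z)).
  rewrite !compA e -(compA _ (eps _)) thE compm1.
  exact: esym (fmap_comp (gen_fun n) _ _).
(* The component at [n] is read off from [G n] at the unit object, along [n ◁ I] and [n]. *)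
pose ph n : hom M n (P n) := fmap P (aun n) • G n I • (aun n)⁻.
have ph_nat n n' (f : hom M n n') : ph n' • f = fmap P f • ph n.
  have [s sE] := gen_map f.
  have e : (aun n')⁻ • f = (f ◂ idm I) • (aun n)⁻.
    apply: (iso_monic (f := aun n')); rewrite bwdKl compA aun_nat.
    by rewrite bwdKr.
  have := GN _ _ s I; rewrite sE => e2.
  rewrite /ph -compA e !compA -(compA _ (G n' I)) -e2 !compA -!fmap_comp.
  by rewrite aun_nat.
have phG n c : ph (n ◁ c) = G n c.
  have e3 : fmap P (idm n ◂ mrun c) • G n (c ⊗ I) = G n c • (idm n ◂ mrun c).
    by have := mnat_nat (G n) (mrun c : hom Z (c ⊗ I) c) => /= <-.
  rewrite /ph -aun_asc fmap_comp -(compA _ (fmap P (aasc n c I))) Gshift compA e3.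
  by rewrite -(compA (G n c)) aun_asc bwdKr.
have ph_act n c : mstr P n c • ph (n ◁ c) = (ph n ◂ idm c) • mstr (mfun_id M) n c.
  rewrite phG compm1.
  have e1 : fmap P (idm n ◂ mlun c) • G n (I ⊗ c) = G n c • (idm n ◂ mlun c).
    by have := mnat_nat (G n) (mlun c : hom Z (I ⊗ c) c) => /= <-.
  have e2 : mstr P (n ◁ I) c • fmap P (aasc n I c)⁻ • G n (I ⊗ c)
      = (G n I ◂ idm c) • (aasc n I c)⁻ := mnat_act (G n) (I : Z) c.
  apply: (iso_epic (f := iso_bmap (act M) (iso_refl n) (mlun c))) => /=.
  apply: (iso_epic (f := aasc n I c)).
  have e3 : idm n ◂ mlun c = (aun n ◂ idm c) • (aasc n I c)⁻.
    by rewrite -atriangle bwdKr.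
  rewrite -[RHS]compA atriangle -bmap_compl /ph fwdKr -(compA (mstr P n c)) -e1.
  rewrite e3 fmap_comp !compA mstr_nat -!compA (compA (mstr P _ _)) (compA (mstr P _ _ • _)) e2.
  by rewrite fwdKr -bmap_compl.
have epsph n : eps n • ph n = aun n • (idm n ◂ (total_loop B (I : Z) : hom C I I)) • (aun n)⁻.
  by rewrite /ph !compA -Geps; have := mnat_nat eps (aun n) => /= ->; rewrite -!compA.
have [w wP] := total_loop_invertible k_char0 S B.
pose phi0 := @ModNat k C M M (mfun_id M) P ph ph_nat ph_act.
pose inv (n : M) : hom M n n := aun n • (idm n ◂ (w (I : Z) : hom C I I)) • (aun n)⁻.
have [w1 w2] := wP (I : Z).
have conj (n : M) (f g : hom C I I) : f • g = idm I ->
    aun n • (idm n ◂ f) • (aun n)⁻ • (aun n • (idm n ◂ g) • (aun n)⁻) = idm n.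
  move=> fg; rewrite !compA fwdKr -(compA (aun n)) -bmap_compr fg bmap_id compm1.
  exact: bwdK.
(* This composite is the action of the total loop at the unit, invertible at each object. Its
   inverse is again a module transformation, and it corrects [phi0] to a section. *)
pose e0 := mnat_comp eps phi0.
have i1 (n : M) : inv n • e0 n = idm _ by rewrite [e0 n]epsph; exact: conj.
have i2 (n : M) : e0 n • inv n = idm _ by rewrite [e0 n]epsph; exact: conj.
exists (mnat_comp phi0 (@inv_modnat k C M M _ _ e0 inv i1 i2)) => n.
by rewrite /= compA; exact: i2.
Qed.

End ModuleSection.

(** * Right adjoints of module functors *)

Section RightAdjoint.

Variables (k : fieldType) (C : monoidal k).
Hypothesis right_dual : forall c : C, exists c', dual_pair c c'.

(** On every module category [- ◁ c'] is left adjoint to [- ◁ c]; the equation is a triangle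
    identity of this adjunction. *)
Lemma dual_act (c : C) : exists (c' : C) (ev : hom C (c ⊗ c') (munit C))
    (coev : hom C (munit C) (c' ⊗ c)), forall (M : modcat C) (n : M),
  ((aun n • (idm n ◂ ev) • aasc n c c') ◂ idm c)
    • ((aasc (n ◁ c) c' c)⁻ • (idm (n ◁ c) ◂ coev) • (aun (n ◁ c))⁻) = idm (n ◁ c).
Proof.
have [c' [ev [coev [_ snake]]]] := right_dual c; exists c', ev, coev => M n.
rewrite -[RHS]bmap_id -[X in _ = _ ◂ X]snake !bmap_compr !bmap_compl -atriangle.
rewrite -!compA (compA (aasc n (munit C) c)) aasc_nat -!compA; congr (_ • (_ • _)).
have e : aasc n (c ⊗ c') c • (aasc n c c' ◂ idm c)
    = (idm n ◂ (massoc c c' c)⁻) • aasc n c (c' ⊗ c) • aasc (n ◁ c) c' c.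
  by rewrite -compA apentagon -!compA (compA (idm n ◂ _)) -bmap_compr fwdK bmap_id comp1m.
rewrite (compA (aasc n (c ⊗ c') c)) e -!compA bwdKl; congr (_ • _).
rewrite (compA (aasc n c (c' ⊗ c))) aasc_natr -!compA; congr (_ • _).
apply: (iso_epic (f := aun (n ◁ c))); rewrite -!compA fwdK compm1 -aun_asc.
by rewrite compA -bmap_compr fwdK bmap_id comp1m.
Qed.

Variables (Z M : modcat C) (L : modfun Z M).

(** The object [r] represents the functor sending [z] to the morphisms from [L z] to [n], with [e]
    as the value of the counit. *)
Definition universal (n : M) (r : Z) (e : hom M (L r) n) : Prop :=
  forall (z : Z) (f : hom M (L z) n), exists g : hom Z z r,
    e • fmap L g = f /\ forall g', e • fmap L g' = f -> g' = g.

(** Maps from [L z] to [n ◁ c] correspond to maps from [L z ◁ c'], that is from [L (z ◁ c')], to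
    [n], hence to maps from [z ◁ c'] to [r], hence to maps from [z] to [r ◁ c]. *)
Lemma universal_act (n : M) (r : Z) (e : hom M (L r) n) (c : C) :
  universal e -> universal ((e ◂ idm c) • mstr L r c).
Proof.
move=> eU z f; have [c' [ev [coev snake]]] := dual_act c.
pose cu (N : modcat C) (p : N) : hom N (p ◁ c ◁ c') p := aun p • (idm p ◂ ev) • aasc p c c'.
pose un (N : modcat C) (p : N) : hom N p (p ◁ c' ◁ c) :=
  (aasc p c' c)⁻ • (idm p ◂ coev) • (aun p)⁻.
have snk (N : modcat C) (p : N) : (cu N p ◂ idm c) • un N (p ◁ c) = idm (p ◁ c) := snake N p.
have cu_nat (N : modcat C) (p p' : N) (h : hom N p p') :
    cu N p' • ((h ◂ idm c) ◂ idm c') = h • cu N p.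
  rewrite /cu -!compA aasc_natl (compA (idm p' ◂ ev)) bmap_interchange.
  by rewrite -compA (compA (aun p')) aun_nat -!compA.
have un_nat (N : modcat C) (p p' : N) (h : hom N p p') :
    un N p' • h = ((h ◂ idm c') ◂ idm c) • un N p.
  apply: (iso_epic (f := aun p)); rewrite /un -!compA -aun_nat fwdKl fwdK compm1.
  rewrite bmap_interchange !compA; congr (_ • _).
  apply: (iso_epic (f := aasc p c' c)); rewrite fwdKr.
  by apply: (iso_monic (f := aasc p' c' c)); rewrite !compA bwdK comp1m aasc_natl.
have L_un (x : Z) : (mstr L x c' ◂ idm c) • mstr L (x ◁ c') c • fmap L (un Z x) = un M (L x).
  apply: (iso_monic (f := aasc (L x) c' c)); apply: (iso_epic (f := iso_fmap L (aun x))).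
  have e1 : fmap L (un Z x) • fmap L (aun x) = fmap L (aasc x c' c)⁻ • fmap L (idm x ◂ coev).
    by rewrite -!fmap_comp /un -compA fwdK compm1.
  have e2 : un M (L x) • fmap L (aun x) = (aasc (L x) c' c)⁻ • ((idm (L x) ◂ coev) • mstr L x (munit C)).
    by rewrite -mstr_un /un -!compA fwdKl.
  rewrite /= -(compA (aasc _ _ _)) -(compA _ (fmap L (un Z x))) e1 -[RHS]compA e2 bwdKl.
  rewrite !compA mstr_asc -(compA (mstr L _ _)) -fmap_comp bwdK fmap_id compm1.
  by rewrite mstr_nat fmap_id.
have L_cu (x : Z) : cu M (L x) • (mstr L x c ◂ idm c') • mstr L (x ◁ c) c' = fmap L (cu Z x).
  have e1 : mstr L x (munit C) • fmap L (idm x ◂ ev) = (idm (L x) ◂ ev) • mstr L x (c ⊗ c').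
    by rewrite mstr_nat fmap_id.
  rewrite /cu !fmap_comp -mstr_un -(compA (aun _) (mstr L _ _)) e1 -!compA.
  by rewrite (compA (aasc _ _ _)) mstr_asc.
move: (cu) (un) snk cu_nat un_nat L_un L_cu => {}cu {}un snk cu_nat un_nat L_un L_cu.
have [h [hE hU]] := eU (z ◁ c') (cu M n • (f ◂ idm c') • mstr L z c').
exists ((h ◂ idm c) • un Z z); split=> [|g gE].
  rewrite fmap_comp -!compA (compA (mstr L r c)) mstr_nat !compA -bmap_compl hE.
  rewrite !bmap_compl -!compA (compA (mstr L z c' ◂ _)) L_un -un_nat compA snk.
  exact: comp1m.
rewrite -(hU (cu Z r • (g ◂ idm c'))).
  rewrite bmap_compl -compA -un_nat compA snk; exact: esym (comp1m _).
rewrite fmap_comp -L_cu -!compA mstr_nat !compA -cu_nat -gE !bmap_compl.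
by rewrite !compA.
Qed.

Section Construction.

Variables (r : M -> Z) (e : forall n, hom M (L (r n)) n).
Hypothesis eU : forall n, universal (e n).

Lemma universal_inj n (u : Z) (q : hom M (L u) n) : universal q ->
  forall z (g g' : hom Z z u), q • fmap L g = q • fmap L g' -> g = g'.
Proof.
move=> qU z g g' gg; have [h [_ hU]] := qU z (q • fmap L g').
by rewrite (hU g gg) (hU g' erefl).
Qed.

(** By [universal_act] both [e (n ◁ c)] and [E n c] are universal, so they differ by a unique
    isomorphism. It is the module structure of [R], and all laws follow from uniqueness. *)
Lemma right_adjoint : exists (R : modfun M Z)
    (eta : modnat (mfun_id Z) (mfun_comp R L)) (eps : modnat (mfun_comp L R) (mfun_id M)),
  (forall z, eps (L z) • fmap L (eta z) = idm (L z)) /\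
  (forall n, fmap R (eps n) • eta (R n) = idm (R n)).
Proof.
have [lift liftE] : exists lift : forall n z, hom M (L z) n -> hom Z z (r n),
    forall n z f, e n • fmap L (lift n z f) = f.
  exists (fun n z f => sval (cid (@eU n z f))) => n z f.
  by case: (svalP (cid (@eU n z f))).
have inj n z (g g' : hom Z z (r n)) : e n • fmap L g = e n • fmap L g' -> g = g'.
  exact: universal_inj.
pose E n c : hom M (L (r n ◁ c)) (n ◁ c) := (e n ◂ idm c) • mstr L (r n) c.
have EU n c : universal (E n c) by exact: universal_act.
have injE n c z (g g' : hom Z z (r n ◁ c)) : E n c • fmap L g = E n c • fmap L g' -> g = g'.
  exact: universal_inj.
pose Rm n n' (f : hom M n n') : hom Z (r n) (r n') := lift _ _ (f • e n).
have RmE n n' (f : hom M n n') : e n' • fmap L (Rm _ _ f) = f • e n by exact: liftE.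
have R_lin n n' : linear (Rm n n').
  by move=> a f g; apply: inj; rewrite fmap_lin comp_linr !RmE comp_linl.
have R_id n : Rm n n (idm n) = idm (r n).
  by apply: inj; rewrite RmE fmap_id comp1m compm1.
have R_comp n n' n'' (g : hom M n' n'') (f : hom M n n') :
    Rm _ _ (g • f) = Rm _ _ g • Rm _ _ f.
  by apply: inj; rewrite RmE fmap_comp compA RmE -!compA RmE.
pose R := LFunctor R_lin R_id R_comp.
have [st stE] : exists st : forall n c, iso (r (n ◁ c)) (r n ◁ c),
    forall n c, E n c • fmap L (st n c) = e (n ◁ c).
  have H n c : exists s : iso (r (n ◁ c)) (r n ◁ c), E n c • fmap L s = e (n ◁ c).
    have [s [sE _]] := EU n c _ (e (n ◁ c)).
    pose t := lift _ _ (E n c); have tE : e (n ◁ c) • fmap L t = E n c by exact: liftE.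
    have ts : t • s = idm _.
      by apply: inj; rewrite fmap_comp compA tE sE fmap_id compm1.
    have st : s • t = idm _.
      by apply: injE; rewrite fmap_comp compA sE tE fmap_id compm1.
    by exists (Iso ts st).
  exists (fun n c => sval (cid (H n c))) => n c; exact: svalP (cid (H n c)).
have st_nat n n' c c' (f : hom M n n') (g : hom C c c') :
    st n' c' • fmap R (f ◂ g) = (fmap R f ◂ g) • st n c.
  apply: injE; rewrite !fmap_comp !compA stE [fmap R _]/= RmE /E.
  rewrite -(compA _ (mstr L _ _)) mstr_nat compA -bmap_comp RmE comp1m.
  rewrite -[f • e n]/(f • e n) -[g in RHS]compm1 bmap_comp -!compA; congr (_ • _).
  by rewrite compA stE.
have st_asc n c d : aasc (r n) c d • (st n c ◂ idm d) • st (n ◁ c) d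
    = st n (c ⊗ d) • fmap R (aasc n c d).
  apply: injE; rewrite !fmap_comp !compA stE [fmap R _]/= RmE /E.
  rewrite -(compA _ (mstr L _ _)) -mstr_asc !compA -aasc_natl -!compA; congr (_ • _).
  rewrite (compA (mstr L _ _)) mstr_nat -!compA.
  have e2 : (((e n ◂ idm c) • mstr L (r n) c) ◂ idm d) • (fmap L (st n c) ◂ idm d) = e (n ◁ c) ◂ idm d.
    by rewrite -bmap_compl; congr (_ ◂ _); exact: stE.
  have e3 : (e (n ◁ c) ◂ idm d) • (mstr L (r (n ◁ c)) d • fmap L (st (n ◁ c) d)) = e (n ◁ c ◁ d).
    by rewrite compA; exact: stE.
  move: e3; rewrite -e2 bmap_compl -!compA => e3; exact: e3.
have st_un n : aun (r n) • st n (munit C) = fmap R (aun n).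
  apply: inj; rewrite [fmap R _]/= RmE fmap_comp -mstr_un.
  rewrite compA (compA (e n)) -aun_nat -!compA; congr (_ • _).
  by rewrite compA; exact: stE.
pose RR := @ModFun k C M Z R st st_nat st_asc st_un.
pose epsn := @ModNat k C M M (mfun_comp L RR) (mfun_id M) e RmE
  (fun n c => etrans (comp1m _) (etrans (esym (stE n c)) (esym (compA _ _ _)))).
pose et z : hom Z z (r (L z)) := lift _ _ (idm (L z)).
have etE z : e (L z) • fmap L (et z) = idm (L z) by exact: liftE.
have et_nat z z' (f : hom Z z z') : et z' • f = Rm _ _ (fmap L f) • et z.
  apply: inj; rewrite !fmap_comp !compA etE RmE -compA etE.
  by rewrite comp1m compm1.
have et_act z c : mstr (mfun_comp RR L) z c • et (z ◁ c) = (et z ◂ idm c) • mstr (mfun_id Z) z c.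
  transitivity (st (L z) c • (Rm _ _ (mstr L z c) • et (z ◁ c))); first by rewrite compA.
  rewrite [mstr (mfun_id Z) z c]/= compm1; apply: injE; rewrite !fmap_comp !compA stE.
  rewrite RmE -!compA etE compm1 mstr_nat compA -bmap_compl etE bmap_id comp1m.
  by [].
pose etan := @ModNat k C Z Z (mfun_id Z) (mfun_comp RR L) et et_nat et_act.
exists RR, etan, epsn; split=> [z|n]; first exact: etE.
apply: inj; rewrite fmap_comp compA RmE -compA etE fmap_id compm1.
by [].
Qed.

End Construction.

End RightAdjoint.

Section FiniteSums.

Variables (k : fieldType) (C : lincat k).
Hypothesis Cadd : additive_cat C.
Variables (T : eqType) (z : T -> C).

Let dl (u v : T) : hom C (z u) (z v) :=
  if u =P v is ReflectT e then ecast w (hom C (z u) (z w)) e (idm (z u)) else 0.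

Let dl1 u : dl u u = idm (z u).
Proof. by rewrite /dl; case: eqP => // e; rewrite (eq_axiomK e). Qed.

Lemma finite_sum (s : seq T) : uniq s ->
  exists (x : C) (i : forall u, hom C (z u) x) (p : forall u, hom C x (z u)),
    [/\ forall u, u \in s -> p u • i u = idm (z u),
        forall u v, u \in s -> v \in s -> u != v -> p u • i v = 0
      & \sum_(u <- s) i u • p u = idm x].
Proof.
elim: s => [_|t s IH /= /andP[ts us]].
  have [[x x0] _] := Cadd; exists x, (fun=> 0), (fun=> 0); split=> //.
  rewrite big_nil; exact: (x0 x).1.
have [x [i [p [pi1 pi0 ip]]]] := IH us.
have [_ /(_ (z t) x)[y [i1 [i2 [p1 [p2 [p1i1 p2i2 p2i1 p1i2 e]]]]]]] := Cadd.
exists y, (fun u => if u == t then i1 • dl u t else i2 • i u),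
  (fun u => if u == t then dl t u • p1 else p u • p2); split.
- move=> u; rewrite inE; case: eqVneq => [-> _|_ /= us'].
    by rewrite dl1 compm1 comp1m.
  by rewrite -compA (compA p2) p2i2 comp1m pi1.
- move=> u v; rewrite !inE; case: (eqVneq u t) => [->|_]; case: (eqVneq v t) => [->|_] //=; rewrite ?eqxx //.
  + by move=> _ _ _; rewrite dl1 comp1m compA p1i2 comp0m.
  + by move=> _ _ _; rewrite dl1 compm1 -compA p2i1 compm0.
  by move=> us' vs uv; rewrite -compA (compA p2) p2i2 comp1m pi0.
rewrite big_cons eqxx dl1 compm1 comp1m -e; congr (_ + _).
rewrite -[i2 in RHS]compm1 -ip comp_sumr comp_suml; apply: eq_big_seq => u us'.
have /negbTE -> : u != t by apply/eqP => ut; rewrite -ut us' in ts.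
by rewrite !compA.
Qed.

End FiniteSums.

Lemma finite_sum_all (k : fieldType) (C : lincat k) (Cadd : additive_cat C)
    (T : finType) (z : T -> C) :
  exists (x : C) (i : forall u, hom C (z u) x) (p : forall u, hom C x (z u)),
    [/\ forall u, p u • i u = idm (z u), forall u v, u != v -> p u • i v = 0
      & \sum_u i u • p u = idm x].
Proof.
have [x [i [p [h1 h2 h3]]]] := finite_sum Cadd z (enum_uniq T).
exists x, i, p; split=> [u|u v uv|].
- by rewrite h1 ?mem_enum.
- by rewrite h2 ?mem_enum.
by rewrite -h3 big_enum.
Qed.

Section Universal.

Variables (k : fieldType) (C : monoidal k) (Z M : modcat C) (L : modfun Z M).
Hypotheses (Zadd : additive_cat Z) (Mfd : locally_fd M).
Variables (q : nat) (x : 'I_q -> Z) (S : simples x).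

Lemma fin_dim_basis (V : lmodType k) : fin_dim V ->
  exists (d : nat) (b : 'I_d -> V) (co : V -> 'I_d -> k),
    (forall v, v = \sum_j co v j *: b j) /\ (forall c : 'I_d -> k, forall j, co (\sum_j c j *: b j) j = c j).
Proof.
move=> [d [[v vL [w vw wv]]]].
have wL : linear w by move=> a u1 u2; apply: (can_inj vw); rewrite wv vL !wv.
exists d, (fun j => w (delta_mx 0 j)), (fun u j => v u 0 j); split=> [u|c j].
  rewrite -[LHS]vw {1}[v u]row_sum_delta (lin_sum wL); apply: eq_bigr => j _.
  exact: (linZ wL).
rewrite (lin_sum vL) summxE (bigD1 j) //= (linZ vL) wv !mxE !eqxx mulr1.
rewrite big1 ?addr0 // => i ij; rewrite (linZ vL) wv !mxE eqxx /= eq_sym (negbTE ij).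
by rewrite mulr0.
Qed.

(** The object [r] contains one copy of [x t] for each vector of a basis of the maps from [L (x t)]
    to [n], and [e] is the sum of the basis vectors. Composition with [e] is then bijective on maps
    from each [x t], hence on maps from every [z]. *)
Lemma universal_exists (n : M) : exists (r : Z) (e : hom M (L r) n), universal e.
Proof.
pose B t := fin_dim_basis (Mfd (L (x t)) n).
pose d t := sval (cid (B t)).
pose b t : 'I_(d t) -> hom M (L (x t)) n := sval (cid (svalP (cid (B t)))).
pose co t : hom M (L (x t)) n -> 'I_(d t) -> k := sval (cid (svalP (cid (svalP (cid (B t)))))).
have bP t : (forall v, v = \sum_j co t v j *: b t j) /\
    (forall c : 'I_(d t) -> k, forall j, co t (\sum_j c j *: b t j) j = c j).
  exact: svalP (cid (svalP (cid (svalP (cid (B t)))))).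
move: (d) (b) (co) bP => {}d {}b {}co bP.
pose T := {t : 'I_q & 'I_(d t)}.
have [r [i [p [pi1 pi0 ip]]]] := finite_sum_all Zadd (fun u : T => x (tag u)).
pose e : hom M (L r) n := \sum_(u : T) b (tag u) (tagged u) • fmap L (p u).
have ei (u : T) : e • fmap L (i u) = b (tag u) (tagged u).
  rewrite /e comp_suml (big_only1 u) // => [|v vu _].
    by rewrite -compA -fmap_comp pi1 fmap_id compm1.
  by rewrite -compA -fmap_comp pi0 // fmap0 compm0.
have eij t j : e • fmap L (i (Tagged (fun t => 'I_(d t)) j) : hom Z (x t) r) = b t j.
  exact: (ei (Tagged (fun t => 'I_(d t)) j)).
exists r, e => z f.
pose ex t (h : hom M (L (x t)) n) : hom Z (x t) r :=
  \sum_j co t h j *: (i (Tagged (fun t => 'I_(d t)) j) : hom Z (x t) r).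
have exE t h : e • fmap L (ex t h) = h.
  rewrite fmap_sum comp_sumr [RHS](bP t).1; apply: eq_bigr => j _.
  by rewrite fmapZ compZr eij.
have ex_inj t (g : hom Z (x t) r) : e • fmap L g = 0 -> g = 0.
  have gE : g = \sum_(j < d t) coef S (p (Tagged (fun t => 'I_(d t)) j) • g : hom Z (x t) (x t))
      *: (i (Tagged (fun t => 'I_(d t)) j) : hom Z (x t) r).
    rewrite -[LHS]comp1m -ip comp_suml.
    transitivity (\sum_(t' < q) \sum_(j < d t') i (Tagged (fun t => 'I_(d t)) j)
        • (p (Tagged (fun t => 'I_(d t)) j) • g)).
      rewrite (sig_big_dep xpredT (fun _ => xpredT) (fun t' (j : 'I_(d t')) =>
        i (Tagged (fun t => 'I_(d t)) j) • (p (Tagged (fun t => 'I_(d t)) j) • g))).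
      by apply: eq_bigr => -[t' j] _; rewrite -compA.
    rewrite (big_only1 t) // => [|t' /eqP tt' _].
      apply: eq_bigr => j _; rewrite [in LHS](coefE S (p (Tagged (fun t => 'I_(d t)) j) • g : hom Z (x t) (x t))).
      by rewrite compZr compm1.
    apply: big1 => j _.
    have -> : (p (Tagged (fun t => 'I_(d t)) j) • g : hom Z (x t) (x t')) = 0.
      exact: (@simple_hom _ _ _ _ S t t' (nesym tt') _).
    exact: compm0.
  rewrite {1}gE fmap_sum comp_sumr => e0.
  have {}e0 : \sum_(j < d t) coef S (p (Tagged (fun t => 'I_(d t)) j) • g : hom Z (x t) (x t)) *: b t j = 0.
    by rewrite -[RHS]e0; apply: eq_bigr => j _; rewrite fmapZ compZr eij.
  rewrite gE; apply: big1 => j _.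
  have := (bP t).2 (fun j => coef S (p (Tagged (fun t => 'I_(d t)) j) • g : hom Z (x t) (x t))) j.
  rewrite e0; have := (bP t).2 (fun=> 0) j; rewrite big1 => [->|j' _]; last by rewrite scale0r.
  by move=> <-; rewrite scale0r.
pose g := \sum_t \sum_(a < mult (simple_dec S z) t) ex t (f • fmap L (inc a)) • prj a.
have gE : e • fmap L g = f.
  rewrite -[RHS]compm1 -fmap_id -(inc_prj (simple_dec S z)) !fmap_sum !comp_sumr.
  apply: eq_bigr => t _; rewrite !fmap_sum !comp_sumr; apply: eq_bigr => a _.
  by rewrite !fmap_comp !compA exE.
exists g; split=> // g' g'E; apply/eqP; rewrite -subr_eq0; apply/eqP.
apply: (hom_ext_inc S) => t a; rewrite comp0m; apply: ex_inj.
by rewrite fmap_comp compA fmapB compBr g'E gE subrr comp0m.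
Qed.

End Universal.

(** * Duals from adjoints, and assembly of the proof *)

Section RepDual.

Variables (k : fieldType) (X : lin2cat k) (A : X).
Notation H := (hom1 X A A).

Lemma rep_dual (l r : H) (eta : hom H (id1 A) (r ∘ l)) (eps : hom H (l ∘ r) (id1 A)) :
  is_adjunction eta eps -> inhabited (dual (rep1 A r) (rep1 A l)).
Proof.
move=> [a1 a2]; split.
unshelve eapply (@Dual k (end_monoidal A) (rep_ob A A) (rep1 A r) (rep1 A l)
  (mnat_comp (rep_idn_bwd A A) (mnat_comp (rep2 A eps) (rep_cmp_fwd A l r)))
  (mnat_comp (rep_cmp_bwd A r l) (mnat_comp (rep2 A eta) (rep_idn_fwd A A)))) => n.
  rewrite /= -[RHS]bmap_id -[X in _ = X ∗ _]a2 !bmap_compr !bmap_compl -triangle.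
  rewrite -!compA; congr (_ • _); rewrite (compA (asc r (id1 A) n)) asc_natm -compA; congr (_ • _).
  have e : asc r (l ∘ r) n • (asc r l r ∗ idm n)
      = (idm r ∗ (asc l r n)⁻) • (asc r l (r ∘ n) • asc (r ∘ l) r n).
    by rewrite pentagon !compA -bmap_compr fwdK bmap_id comp1m.
  rewrite (compA (asc r (l ∘ r) n)) e -!compA; congr (_ • (_ • _)).
  rewrite (compA (asc (r ∘ l) r n)) asc_natl -compA; congr (_ • _).
  apply: (iso_monic (f := lun (r ∘ n))); rewrite bwdK compA lun_asc.
  by rewrite -bmap_compl bwdK bmap_id.
rewrite /= -[RHS]bmap_id -[X in _ = X ∗ _]a1 !bmap_compr !bmap_compl -lun_asc.
rewrite -!compA; congr (_ • _); rewrite (compA (asc (id1 A) l n)) asc_natl -compA; congr (_ • _).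
have e : asc (l ∘ r) l n • ((asc l r l)⁻ ∗ idm n)
    = (asc l r (l ∘ n))⁻ • ((idm l ∗ asc r l n) • asc l (r ∘ l) n).
  apply: (iso_monic (f := asc l r (l ∘ n))); rewrite bwdKl compA pentagon -!compA.
  by rewrite -bmap_compl bwdK bmap_id compm1.
rewrite (compA (asc (l ∘ r) l n)) e -!compA; congr (_ • (_ • _)).
rewrite (compA (asc l (r ∘ l) n)) asc_natm -compA; congr (_ • _).
apply: (iso_monic (f := iso_bmap (comp1 X A A A) (iso_refl l) (lun n))) => /=.
rewrite -bmap_compr bwdK bmap_id compA triangle.
by rewrite -bmap_compl bwdK bmap_id.
Qed.

End RepDual.

(** The triangle identities of adjoint 1-endomorphisms of [A] are literally the snake identities of
    [dual_pair]. *)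
Lemma end_multifusion (k : fieldType) (X : lin2cat k) (A : X) :
  has_adjoints X -> locally_finite_semisimple X -> multifusion (end_monoidal A).
Proof.
move=> adj lfs; split; first exact: lfs.
move=> x; have [[g [eta [eps [a1 a2]]]] [h [eta' [eps' [b1 b2]]]]] := adj A A x.
by split; [exists g, eps, eta | exists h, eps', eta'].
Qed.

Lemma module_realized (k : closedFieldType) (k_char0 : [pchar k] =i pred0) (X : lin2cat k)
    (X_fss : finite_semisimple2 X) (A : X) (domA : forall B, dominated A B)
    (lfs : locally_finite_semisimple X) (M : fsmodcat (end_monoidal A)) :
  exists (B : X) (e : modfun (rep_ob A B) M),
    @equivalence1 k (Mod (end_monoidal A)) (rep_fs A lfs B) M e.
Proof.
have [[_ adj _ X_ic] _ _] := X_fss.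
pose C := end_monoidal A; have [_ duals] := end_multifusion A adj lfs.
have right_dual (c : C) : exists c', dual_pair c c' by have [] := duals c.
have [q0 [s0 [S0]]] := finite_semisimple_simples (lfs A A).
have ic : idem_complete_cat (hom1 X A A) by have [[]] := lfs A A.
have [S] := transport_simples S0 (rep_faithful domA (B:=A) (B':=A)) (rep_full domA (B:=A) (B':=A))
  (rep_surj domA lfs ic).
have [B] : inhabited (balanced (fun i => rep1 A (s0 i))).
  have H i : exists (Y : modfun (rep_ob A A) (rep_ob A A)) (d1 : dual (rep1 A (s0 i)) Y)
      (d2 : dual Y (rep1 A (s0 i))) (m : k),
    [/\ loop d1 d2 <> 0, mnat_comp (loop d1 d2) (loop d1 d2) = loop d1 d2, m != 0,
      mnat_comp (loop d2 d1) (loop d2 d1) = m *: loop d2 d1 & loop d2 d1 <> 0].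
    apply: (normalized_duals (i := i) S).
    have [[g [eta [eps ad]]] _] := adj A A (s0 i); have [d] := rep_dual ad.
    have [[g' [eta' [eps' ad']]] _] := adj A A g; have [d'] := rep_dual ad'.
    by exists (rep1 A g), d, (rep1 A g'), d'.
  pose Y i := sval (cid (H i)); pose d1 i := sval (cid (svalP (cid (H i)))).
  pose d2 i := sval (cid (svalP (cid (svalP (cid (H i)))))).
  pose m i := sval (cid (svalP (cid (svalP (cid (svalP (cid (H i)))))))).
  have P i : [/\ loop (d1 i) (d2 i) <> 0,
      mnat_comp (loop (d1 i) (d2 i)) (loop (d1 i) (d2 i)) = loop (d1 i) (d2 i), m i != 0,
      mnat_comp (loop (d2 i) (d1 i)) (loop (d2 i) (d1 i)) = m i *: loop (d2 i) (d1 i)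
      & loop (d2 i) (d1 i) <> 0].
    exact: (svalP (cid (svalP (cid (svalP (cid (svalP (cid (H i))))))))).
  by split; exists Y d1 d2 m => i; have [] := P i.
have [M_ss _] := fsmodP M; have [Mfd Madd _ _ _] := M_ss.
have [Hss _] := lfs A A; have [_ Hadd _ _ _] := Hss.
have [q [y [T]]] := finite_semisimple_simples (fsmodP M).
(* The object [m] is the direct sum of all simple objects of [M]. *)
have [m [i [p [pi1 _ _]]]] := finite_sum_all Madd y.
pose L : modfun (rep_ob A A) M := gen_fun m.
have U n : exists (r : rep_ob A A) (e : hom M (L r) n), universal e.
  exact: (@universal_exists k C (rep_ob A A) M L Hadd Mfd q0 s0 S0 n).
have [R [eta [eps [tri_l tri_r]]]] := right_adjoint right_dual
  (fun n => svalP (cid (svalP (cid (U n))))).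
have [phi eps_phi] : exists phi : modnat (mfun_id M) (mfun_comp L R), forall n, eps n • phi n = idm n.
  apply: (@module_section k k_char0 C M _ _ S B (mfun_comp L R) eps _ _ T) => t.
  (* The simple [y t] is a retract of [m], which is isomorphic to the value of [L] at the unit; so
     the projection factors through [eps] by adjunction. *)
  pose f : hom M (L (munit C)) (y t) := p t • aun m.
  have e : eps (y t) • fmap L (fmap R f • eta (munit C)) = f.
    rewrite fmap_comp compA; have -> : eps (y t) • fmap L (fmap R f) = f • eps (L (munit C)).
      exact: (mnat_nat eps f).
    by rewrite -compA tri_l compm1.
  exists (fmap L (fmap R f • eta (munit C)) • ((aun m)⁻ • i t)).
  by rewrite compA e /f -!compA bwdKl pi1.
exact: (@adjunction_splits k X A domA lfs X_ic M L R eta eps phi tri_l tri_r eps_phi).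
Qed.

Theorem theorem3 (k : closedFieldType) (k_char0 : [pchar k]%R =i pred0)
    (X : lin2cat k) (X_fss : finite_semisimple2 X) :
  exists C : monoidal k, multifusion C /\ equivalent2 X (Mod C).
Proof.
have [A domA] := generator_exists X_fss; have [[_ adj _ _] lfs _] := X_fss.
exists (end_monoidal A); split; first exact: end_multifusion.
by apply: (rep_equivalent domA (lfs := lfs)) => M; exact: module_realized.
Qed.
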